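(* Let $R$ be a commutative Noetherian local ring, and let $M$ and $N$ be non-zero finitely generated $R$-modules. Suppose that $\operatorname{P}_R(M,N)<\infty$. Then the equality $$\operatorname{P}_R(M,N)=\operatorname{depth} R-\operatorname{depth} M$$ holds in each one of the following cases: (1) $M$ has finite quasi-projective dimension. (2) $M$ has finite Gorenstein dimension and $N$ has finite quasi-projective dimension. (3) $N$ has finite quasi-injective dimension.
   Context: For non-zero finitely generated $R$-modules $M,N$, $\operatorname{P}_R(M,N):=\sup\{i\ge 0:\operatorname{Ext}^i_R(M,N)\neq 0\}$. For a complex $X$ of $R$-modules (homologically indexed, $\cdots\to X_{i+1}\to X_i\to X_{i-1}\to\cdots$), put $\sup X=\sup\{i: X_i\ne 0\}$, $\inf X=\inf\{i: X_i\neq 0\}$, $\operatorname{hsup}X=\sup\{i: H_i(X)\neq 0\}$, $\operatorname{hinf}X=\inf\{i: H_i(X)\ne 0\}$. $X$ is bounded below if $\inf X>-\infty$, bounded above if $\sup X<\infty$, and bounded if $\sup X-\inf X<\infty$. Let $M$ be a finitely generated $R$-module. A quasi-projective resolution of $M$ is a bounded below complex $P$ of (finitely generated) projective $R$-modules such that for all $i\ge\inf P$ there exist non-negative integers $a_i$, not all zero, with $H_i(P)\cong M^{\oplus a_i}$. The quasi-projective dimension of $M\neq 0$ is $\operatorname{qpd}_R M=\inf\{\sup P-\operatorname{hsup}P : P \text{ is a bounded quasi-projective resolution of } M\}$ (equal to $\infty$ if no bounded one exists), and $\operatorname{qpd}_R 0=-\infty$. A quasi-injective resolution of $M$ is a bounded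 above complex $I$ of injective $R$-modules (not required to be finitely generated) such that for all $i\le\sup I$ there exist non-negative integers $b_i$, not all zero, with $H_i(I)\cong M^{\oplus b_i}$. The quasi-injective dimension of $M\ne0$ is $\operatorname{qid}_R M=\inf\{\operatorname{hinf}I-\inf I : I\text{ is a bounded quasi-injective resolution of }M\}$ (equal to $\infty$ if no bounded one exists), and $\operatorname{qid}_R 0=-\infty$. With $M^*=\operatorname{Hom}_R(M,R)$, $M$ is totally reflexive if $M$ is reflexive and $\operatorname{Ext}^i_R(M,R)=0=\operatorname{Ext}^i_R(M^*,R)$ for all $i>0$. The Gorenstein dimension $\operatorname{G-dim}_R M$ is the infimum of all non-negative integers $k$ such that there is an exact sequence $0\to G_k\to\cdots\to G_0\to M\to 0$ with each $G_i$ totally reflexive. *)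

(* Defs.v *)
From HB Require Import structures.
From mathcomp Require Import all_boot all_order all_algebra.
From mathcomp Require Import boolp classical_sets functions cardinality.
From mathcomp Require Import fsbigop constructive_ereal.
Set Implicit Arguments.
Unset Strict Implicit.
Unset Printing Implicit Defensive.
Import Order.TTheory GRing.Theory Num.Theory.
Local Open Scope classical_set_scope.
Local Open Scope ring_scope.

(* Suprema and infima of sets of integers, in {-oo} U Z U {+oo}; the supremum
   of the empty set is -oo and its infimum is +oo. *)
Definition esupz (S : set int) : \bar int := supremum -oo%E (EFin @` S).
Definition einf (S : set (\bar int)) : \bar int := infimum +oo%E S.
Definition einfz (S : set int) : \bar int := einf (EFin @` S).

Section Modules.
Variable R : comNzRingType.
Implicit Types U V W M N : lmodType R.

Definition nonzero_module M : Prop := exists x : M, x != 0.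

Definition isomorphic U V : Prop := exists f : {linear U -> V}, bijective f.

Definition lin_span V (s : seq V) : set V :=
  [set v | exists c : nat -> R, v = \sum_(i < size s) c i *: s`_i].

Definition fg V : Prop := exists s : seq V, lin_span s = setT.

Definition projective_module V : Prop :=
  forall (A B : lmodType R) (g : {linear A -> B}) (f : {linear V -> B}),
    (forall b, exists a, g a = b) ->
    exists h : {linear V -> A}, forall v, g (h v) = f v.

Definition injective_module V : Prop :=
  forall (A B : lmodType R) (g : {linear A -> B}) (f : {linear A -> V}),
    injective g -> exists h : {linear B -> V}, forall a, h (g a) = f a.

End Modules.

Section LocalRings.
Variable R : comNzRingType.

Definition ideal (J : set R) : Prop :=
  J 0 /\ forall a x y, J x -> J y -> J (a * x + y).

Definition maximal_ideal (J : set R) : Prop :=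
  [/\ ideal J, J != setT &
      forall K, ideal K -> J `<=` K -> K = J \/ K = setT].

Definition noetherian : Prop :=
  forall J : set R, ideal J -> exists s : seq R^o, J = lin_span s.

Definition local_ring (m : set R) : Prop :=
  maximal_ideal m /\ forall J, maximal_ideal J -> J = m.

(* The submodule (x_1, ..., x_n) M of M. *)
Definition seq_mul (M : lmodType R) (xs : seq R) : set M :=
  [set u | exists v : nat -> M, u = \sum_(i < size xs) xs`_i *: v i].
Arguments seq_mul M xs : clear implicits.

Definition regular_seq (M : lmodType R) (xs : seq R) : Prop :=
  (forall i, (i < size xs)%N -> forall u : M,
     seq_mul M (take i xs) (xs`_i *: u) -> seq_mul M (take i xs) u)
  /\ seq_mul M xs != setT.

(* Depth with respect to the ideal m: the supremum of the lengths of the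
   M-regular sequences contained in m. *)
Definition depth (m : set R) (M : lmodType R) : \bar int :=
  esupz [set n | exists xs : seq R,
    [/\ forall x, x \in xs -> m x, regular_seq M xs & n = (size xs)%:Z]].

End LocalRings.

Section Kernel.
Variables (R : comNzRingType) (U V : lmodType R) (f : {linear U -> V}).

Definition ker_pred : {pred U} := [pred x | f x == 0].

Fact ker_pred_submod : submod_closed ker_pred.
Proof.
split=> [|a x y]; rewrite !inE ?linear0 // => /eqP fx /eqP fy.
by rewrite linearP fx fy scaler0 addr0.
Qed.

HB.instance Definition _ := GRing.isSubmodClosed.Build R U ker_pred
  ker_pred_submod.

Record ker := Ker { ker_val : U; ker_valP : ker_val \in ker_pred }.

HB.instance Definition _ := [isSub for ker_val].
HB.instance Definition _ := [Choice of ker by <:].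
HB.instance Definition _ := [SubChoice_isSubLmodule of ker by <:].

End Kernel.

Section QuotientModule.
Variables (R : comNzRingType) (V : lmodType R) (S : zmodClosed V).
Hypothesis SZ : GRing.scaler_closed S.

Definition quotmod of GRing.scaler_closed S : Type := Quotient.quot S.
HB.instance Definition _ := GRing.Zmodule.on (quotmod SZ).

Definition qproj (x : V) : quotmod SZ := (\pi_(Quotient.quot S) x)%qT.

Definition qrepr (x : quotmod SZ) : V := repr (x : Quotient.quot S).

Lemma qreprK : cancel qrepr qproj.
Proof. exact: reprK. Qed.

Lemma qprojE x y : (qproj x == qproj y) = (x - y \in S).
Proof. by rewrite Quotient.idealrBE. Qed.

Lemma qprojD x y : qproj (x + y) = qproj x + qproj y.
Proof. exact: Quotient.pi_add. Qed.

Definition qscale (a : R) (x : quotmod SZ) : quotmod SZ := qproj (a *: qrepr x).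

Lemma qscale_proj a x : qscale a (qproj x) = qproj (a *: x).
Proof. by apply/eqP; rewrite qprojE -scalerBr SZ // -qprojE qreprK. Qed.

Fact qscaleA a b (x : quotmod SZ) : qscale a (qscale b x) = qscale (a * b) x.
Proof. by rewrite -[x]qreprK !qscale_proj scalerA. Qed.

Fact qscale1 : left_id 1 qscale.
Proof. by move=> x; rewrite -[x]qreprK qscale_proj scale1r. Qed.

Fact qscaleDr : right_distributive qscale +%R.
Proof.
move=> a x y; rewrite -[x]qreprK -[y]qreprK -qprojD !qscale_proj.
by rewrite scalerDr qprojD.
Qed.

Fact qscaleDl (x : quotmod SZ) : {morph qscale^~ x : a b / a + b}.
Proof.
by move=> a b; rewrite -[x]qreprK !qscale_proj scalerDl qprojD.
Qed.

HB.instance Definition _ := GRing.Zmodule_isLmodule.Build R (quotmod SZ)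
  qscaleA qscale1 qscaleDr qscaleDl.

End QuotientModule.

(* The homology ker g / im f of A -f-> B -g-> C, meant for g \o f = 0. *)
Section Homology.
Variables (R : comNzRingType) (A B C : lmodType R).
Variables (f : {linear A -> B}) (g : {linear B -> C}).

Definition bound_pred : {pred ker g} :=
  [pred z | `[< exists a, f a = ker_val z >]].

Fact bound_pred_submod : submod_closed bound_pred.
Proof.
split=> [|k x y]; rewrite !inE; first by exists 0; rewrite raddf0.
move=> [a fa] [b fb]; exists (k *: a + b).
by rewrite linearP fa fb.
Qed.

HB.instance Definition _ := GRing.isSubmodClosed.Build R (ker g) bound_pred
  bound_pred_submod.

Definition homology : lmodType R :=
  quotmod
    (GRing.subsemimod_closedZ (GRing.submod_closed_semi bound_pred_submod)).

End Homology.

Section HomModule.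
Variables (R : comNzRingType) (U V : lmodType R).
Local Notation hom := {linear U -> V}.

HB.instance Definition _ := gen_eqMixin hom.
HB.instance Definition _ := gen_choiceMixin hom.

Lemma homP (f g : hom) : f =1 g -> f = g.
Proof.
case: f g => f [[fa] [fl]] [g [[ga] [gl]]] /= /funext fg; subst g.
by rewrite (Prop_irrelevance fa ga) (Prop_irrelevance fl gl).
Qed.

Definition hom_add (f g : hom) : hom := f \+ g.
Definition hom_opp (f : hom) : hom := \- f.
Definition hom_zero : hom := \0.
Definition hom_scale (a : R) (f : hom) : hom := a \*: f.

Fact hom_addA : associative hom_add.
Proof. by move=> f g h; apply: homP => x /=; rewrite addrA. Qed.
Fact hom_addC : commutative hom_add.
Proof. by move=> f g; apply: homP => x /=; rewrite addrC. Qed.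
Fact hom_add0 : left_id hom_zero hom_add.
Proof. by move=> f; apply: homP => x /=; rewrite add0r. Qed.
Fact hom_addN : left_inverse hom_zero hom_opp hom_add.
Proof. by move=> f; apply: homP => x /=; rewrite addNr. Qed.
HB.instance Definition _ :=
  GRing.isZmodule.Build hom hom_addA hom_addC hom_add0 hom_addN.

Fact hom_scaleA a b (f : hom) :
  hom_scale a (hom_scale b f) = hom_scale (a * b) f.
Proof. by apply: homP => x /=; rewrite scalerA. Qed.
Fact hom_scale1 : left_id 1 hom_scale.
Proof. by move=> f; apply: homP => x /=; rewrite scale1r. Qed.
Fact hom_scaleDr : right_distributive hom_scale +%R.
Proof. by move=> a f g; apply: homP => x /=; rewrite scalerDr. Qed.
Fact hom_scaleDl (f : hom) : {morph hom_scale^~ f : a b / a + b}.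
Proof. by move=> a b; apply: homP => x /=; rewrite scalerDl. Qed.
HB.instance Definition _ := GRing.Zmodule_isLmodule.Build R hom
  hom_scaleA hom_scale1 hom_scaleDr hom_scaleDl.

End HomModule.

Section Duality.
Variable R : comNzRingType.

Definition hom (U V : lmodType R) : lmodType R := {linear U -> V}.

Section Precomp.
Variables (U U' V : lmodType R) (d : {linear U' -> U}).

Definition precomp_fun (f : hom U V) : hom U' V :=
  (f : {linear U -> V}) \o d.

Fact precomp_linear : linear precomp_fun.
Proof. by move=> a f g; apply: homP. Qed.

HB.instance Definition _ :=
  GRing.isLinear.Build R (hom U V) (hom U' V) *:%R precomp_fun precomp_linear.

Definition precomp : {linear hom U V -> hom U' V} := precomp_fun.

End Precomp.

Definition dual_module (M : lmodType R) : lmodType R := hom M R^o.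

Section Biduality.
Variable M : lmodType R.

Definition eval_at (x : M) (phi : dual_module M) : R^o :=
  (phi : {linear M -> R^o}) x.

Fact eval_at_linear x : linear (eval_at x).
Proof. by []. Qed.

HB.instance Definition _ x :=
  GRing.isLinear.Build R (dual_module M) R^o *:%R
    (eval_at x) (eval_at_linear x).

Definition biduality (x : M) : dual_module (dual_module M) :=
  eval_at x : {linear _ -> _}.

End Biduality.

Definition reflexive (M : lmodType R) : Prop := bijective (@biduality M).

End Duality.

(* The free module R^(X): finitely supported functions from X to R. *)
Section FreeModule.
Variables (R : comNzRingType) (X : Type).

Definition finsupp_pred : {pred X -> R^o} :=
  [pred f | `[< finite_set [set x | f x != 0] >]].

Fact finsupp_submod : submod_closed finsupp_pred.
Proof.
split=> [|a f g]; rewrite !inE.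
  rewrite (_ : [set _ | _] = set0) //.
  by apply/seteqP; split=> x //=; rewrite eqxx.
move=> ff fg.
apply: (@sub_finite_set _ _ ([set x | f x != 0] `|` [set x | g x != 0]));
  last by rewrite finite_setU.
move=> x /=; apply: contraPP => /not_orP[/negP/negPn/eqP fx /negP/negPn/eqP gx].
apply/negP/negPn; rewrite -[(a *: f + g) x]/(a *: f x + g x) fx gx.
by rewrite scaler0 addr0.
Qed.

HB.instance Definition _ := GRing.isSubmodClosed.Build R (X -> R^o)
  finsupp_pred finsupp_submod.

Record free_module :=
  Free { coeff : X -> R^o; coeffP : coeff \in finsupp_pred }.

HB.instance Definition _ := [isSub for coeff].
HB.instance Definition _ := [Choice of free_module by <:].
HB.instance Definition _ := [SubChoice_isSubLmodule of free_module by <:].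

End FreeModule.

Section FreeCover.
Variables (R : comNzRingType) (V : lmodType R).

Definition free_supp (f : free_module R V) : set V := [set v | coeff f v != 0].

Definition cover_fun (f : free_module R V) : V :=
  \sum_(v \in free_supp f) coeff f v *: v.

Fact finite_free_supp f : finite_set (free_supp f).
Proof. by have := coeffP f; rewrite inE. Qed.

Fact cover_funE (A : set V) f : finite_set A -> free_supp f `<=` A ->
  cover_fun f = \sum_(v \in A) coeff f v *: v.
Proof.
move=> fA sfA; apply: fsbig_widen => // v [_ /= /negP/negPn/eqP ->].
exact: scale0r.
Qed.

Fact cover_linear : linear cover_fun.
Proof.
move=> a f g.
pose A := free_supp f `|` free_supp g `|` free_supp (a *: f + g).
have fA : finite_set A.
  by rewrite !finite_setU; split; [split|]; exact: finite_free_supp.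
rewrite !(@cover_funE A) //; [|by move=> x; left; right
  |by move=> x; left; left|by move=> x; right].
rewrite !fsbig_finite //= scaler_sumr -big_split; apply: eq_bigr => v _ /=.
by rewrite scalerA -scalerDl.
Qed.

HB.instance Definition _ :=
  GRing.isLinear.Build R (free_module R V) V *:%R cover_fun cover_linear.

Definition free_cover : {linear free_module R V -> V} := cover_fun.

End FreeCover.

(* The standard free resolution ... -> F_1 -> F_0 -> M -> 0, in which F_n is
   the free module on the underlying set of the n-th syzygy. *)
Section Ext.
Variables (R : comNzRingType) (M : lmodType R).

Fixpoint syz (n : nat) : lmodType R :=
  if n is n'.+1 then ker (free_cover (syz n')) else M.

Definition res_obj (n : nat) : lmodType R := free_module R (syz n).

Definition res_diff (n : nat) : {linear res_obj n.+1 -> res_obj n} :=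
  (val : {linear ker (free_cover (syz n)) -> free_module R (syz n)})
    \o free_cover (syz n.+1).

End Ext.

(* Ext^n_R(M, N), computed from the standard free resolution of M. *)
Definition Ext (R : comNzRingType) (n : nat) (M N : lmodType R) : lmodType R :=
  if n is n'.+1
  then homology (precomp N (res_diff M n')) (precomp N (res_diff M n'.+1))
  else homology (\0 : {linear hom (res_obj M 0) N -> hom (res_obj M 0) N})
                (precomp N (res_diff M 0)).

(* P_R(M, N), equal to -oo when every Ext^n_R(M, N) vanishes. *)
Definition ext_sup (R : comNzRingType) (M N : lmodType R) : \bar int :=
  esupz [set n%:Z | n in [set n | nonzero_module (Ext n M N)]].

Section GorensteinDimension.
Variable R : comNzRingType.

Definition totally_reflexive (G : lmodType R) : Prop :=
  [/\ fg G, reflexive G &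
      forall n, (0 < n)%N -> ~ nonzero_module (Ext n G R^o) /\
                             ~ nonzero_module (Ext n (dual_module G) R^o)].

Definition exact_at (A B C : lmodType R) (f : {linear A -> B})
    (g : {linear B -> C}) : Prop :=
  forall b, g b = 0 <-> exists a, f a = b.

(* 0 -> G_k -> ... -> G_0 -> M -> 0, continued by zero modules beyond G_k. *)
Definition G_resolution (M : lmodType R) (k : nat) : Prop :=
  exists (G : nat -> lmodType R) (d : forall i, {linear G i.+1 -> G i})
         (e : {linear G 0%N -> M}),
    [/\ forall i, (i <= k)%N -> totally_reflexive (G i),
        forall i, (k < i)%N -> ~ nonzero_module (G i),
        forall x, exists g, e g = x,
        exact_at (d 0%N) e &
        forall i, exact_at (d i.+1) (d i)].

Definition Gdim (M : lmodType R) : \bar int :=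
  einfz [set k%:Z | k in [set k | G_resolution M k]].

End GorensteinDimension.

Section Complexes.
Variable R : comNzRingType.

(* Only the differentials X_(j+1) -> X_j carry information; indexing them by
   both endpoints avoids transporting along equalities of indices. *)
Record complex := Complex {
  obj :> int -> lmodType R;
  diff : forall i j, {linear obj i -> obj j};
  diff_shape : forall i j, i != j + 1 -> forall x, diff i j x = 0;
  diff_diff : forall i j k x, diff j k (diff i j x) = 0
}.

Definition homology_at (i : int) (X : complex) : lmodType R :=
  homology (diff X (i + 1) i) (diff X i (i - 1)).

Definition csup (X : complex) := esupz [set i | nonzero_module (X i)].
Definition cinf (X : complex) := einfz [set i | nonzero_module (X i)].
Definition chsup (X : complex) :=
  esupz [set i | nonzero_module (homology_at i X)].
Definition chinf (X : complex) :=
  einfz [set i | nonzero_module (homology_at i X)].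

Definition bounded_below (X : complex) : Prop := (-oo < cinf X)%E.
Definition bounded_above (X : complex) : Prop := (csup X < +oo)%E.
Definition bounded (X : complex) : Prop := (csup X - cinf X < +oo)%E.

Definition dsum (M : lmodType R) (a : nat) : lmodType R := {ffun 'I_a -> M}.

Definition quasi_projective_resolution (M : lmodType R) (P : complex) : Prop :=
  [/\ bounded_below P,
      forall i, fg (P i) /\ projective_module (P i) &
      exists a : int -> nat,
        (forall i, (cinf P <= i%:E)%E ->
           isomorphic (homology_at i P) (dsum M (a i))) /\
        (exists i, (cinf P <= i%:E)%E /\ a i != 0%N)].

Definition quasi_injective_resolution (M : lmodType R) (I : complex) : Prop :=
  [/\ bounded_above I,
      forall i, injective_module (I i) &
      exists b : int -> nat,
        (forall i, (i%:E <= csup I)%E ->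
           isomorphic (homology_at i I) (dsum M (b i))) /\
        (exists i, (i%:E <= csup I)%E /\ b i != 0%N)].

Definition qpd (M : lmodType R) : \bar int :=
  if `[< nonzero_module M >] then
    einf [set x | exists P : complex,
      [/\ bounded P, quasi_projective_resolution M P &
          x = (csup P - chsup P)%E]]
  else -oo%E.

Definition qid (M : lmodType R) : \bar int :=
  if `[< nonzero_module M >] then
    einf [set x | exists I : complex,
      [/\ bounded I, quasi_injective_resolution M I &
          x = (chinf I - cinf I)%E]]
  else -oo%E.

End Complexes.

(* Main.v *)
(* Write t = depth R, d = depth M.

   (3) Let I be a bounded complex of injectives with H_i(I) = N^(b_i). The
   contravariant functors T_i(L) = H_i(Hom(L, I)) have long exact sequences. If q
   is the least degree with T_q(k) <> 0, devissage and Nakayama's lemma show that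
   the least degree with T_i(L) <> 0 is q + depth L. For L = R this is the least
   degree h with H_h(I) <> 0, and for L = M it is h - P(M, N), as one sees by
   comparing Ext(M, -) of cycles and boundaries of I.

   (1) Let P be a bounded complex of projectives with H_i(P) = M^(a_i) and top
   homology in degree s. Comparing Ext(-, N) of boundaries and cokernels of P, the
   top degree c of H^i(Hom(P, N)) is s + P(M, N); by devissage c does not depend on
   N, so it is the top degree of the homology of the dual complex D of P. On
   the other hand Hom(D, R) = P, and dividing R and M by common regular elements
   yields c - s = t - d.

   (2) The argument for c - s = t - d applies to a G-resolution of M in place of P
   and gives P(M, R) = t - d. If N is quasi-resolved by projectives P_i, then
   P(M, N) = P(M, R) follows by comparing Ext(M, -) of cycles and boundaries. *)

Require Import Defs.
From HB Require Import structures.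
From mathcomp Require Import all_boot all_order all_algebra.
From mathcomp Require Import finmap boolp classical_sets functions cardinality.
From mathcomp Require Import fsbigop constructive_ereal.
From mathcomp Require Import zify.
(* [hom] is also defined in the vector library of mathcomp. *)
Import Defs.
Set Implicit Arguments.
Unset Strict Implicit.
Unset Printing Implicit Defensive.
Import Order.TTheory GRing.Theory Num.Theory.
Local Open Scope classical_set_scope.
Local Open Scope ring_scope.

(** * Modules over a Noetherian local ring *)

(** No long exact sequence of Ext groups is built. Only vanishing and finite generation of cokernels
    are tracked, so exactness takes the form of implications between neighbouring terms.

    Two obstacles shape the argument. The bound on P(M, N) still allows every Ext to vanish, so each
    case has to exclude this first. And the modules to which Nakayama's lemma should apply are
    quotients of Hom modules that are not finitely generated themselves (the standard free
    resolution has infinite rank, injective modules are large). Hence Nakayama is stated relative to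
    a submodule, and finite generation of the quotient is recovered from that of the homology.

    In (1), independence of N comes from right exactness: once the cohomology of Hom(P, -) vanishes
    above degree c on all finitely generated modules, the functor in degree c is right exact; if it
    kills N, it kills the quotient k of N, and then every finitely generated module. *)

Section Modules.
Context {R : comNzRingType}.
Implicit Types U V W A B C K L M N P Q : lmodType R.

(** Constructions below are existence statements with a pointwise equation. This keeps linear maps
    opaque and avoids declaring a structure for each of them. *)
Lemma make_linear U V (F : U -> V) :
  (forall a x y, F (a *: x + y) = a *: F x + F y) ->
  exists f : {linear U -> V}, forall x, f x = F x.
Proof.
move=> H; pose f0 : {linear U -> V} := HB.pack F (GRing.isLinear.Build R U V *:%R F H).
by exists f0.
Qed.

Lemma scale_map V (v : V) :
  exists f : {linear R^o -> V}, forall r, f r = r *: v.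
Proof. by apply: make_linear => a x y; rewrite scalerDl -scalerA. Qed.

Definition surj U V (f : U -> V) : Prop := forall v, exists u, f u = v.

Definition submod V (S : set V) : Prop :=
  S 0 /\ forall a x y, S x -> S y -> S (a *: x + y).

Definition zero_module V : Prop := forall x : V, x = 0.

Lemma zero_moduleP V : zero_module V <-> ~ nonzero_module V.
Proof.
split=> [H [x /eqP]|H x]; first by [].
by apply: contra_notP H => /eqP ?; exists x.
Qed.

Lemma submodD V (S : set V) x y : submod S -> S x -> S y -> S (x + y).
Proof. by move=> [_ H] Sx Sy; have := H 1 x y Sx Sy; rewrite scale1r. Qed.

Lemma submodZ V (S : set V) a x : submod S -> S x -> S (a *: x).
Proof. by move=> [S0 H] Sx; have := H a x 0 Sx S0; rewrite addr0. Qed.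

Lemma submodN V (S : set V) x : submod S -> S x -> S (- x).
Proof. by move=> Ss Sx; rewrite -scaleN1r; apply: submodZ. Qed.

Lemma submodB V (S : set V) x y : submod S -> S x -> S y -> S (x - y).
Proof. by move=> Ss Sx Sy; apply: submodD => //; apply: submodN. Qed.

Lemma submod_sum V (S : set V) n (F : nat -> V) : submod S ->
  (forall i, (i < n)%N -> S (F i)) -> S (\sum_(i < n) F i).
Proof.
move=> Ss; elim: n => [|n IH] H; first by rewrite big_ord0; case: Ss.
rewrite big_ord_recr /=; apply: submodD => //; last exact: H.
by apply: IH => i /ltnW; apply: H.
Qed.

Lemma submod_setT V : submod (setT : set V).
Proof. by []. Qed.

Lemma submod_zero V : submod [set x : V | x = 0].
Proof. by split=> //= a x y -> ->; rewrite scaler0 addr0. Qed.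

Lemma submod_ker U V (f : {linear U -> V}) : submod [set x | f x = 0].
Proof.
split=> /= [|a x y fx fy]; first exact: linear0.
by rewrite linearP fx fy scaler0 addr0.
Qed.

Lemma submod_preim U V (f : {linear U -> V}) (S : set V) :
  submod S -> submod (f @^-1` S).
Proof.
move=> [S0 H]; split=> /= [|a x y fx fy]; first by rewrite linear0.
by rewrite linearP; apply: H.
Qed.

Lemma submod_im U V (f : {linear U -> V}) : submod (range f).
Proof.
split=> [|a _ _ [x _ <-] [y _ <-]]; first by exists 0; rewrite ?linear0.
by exists (a *: x + y); rewrite ?linearP.
Qed.

Definition sub_pred V (S : set V) of submod S : {pred V} := [pred x | `[< S x >]].

Fact sub_pred_submod V (S : set V) (SS : submod S) : submod_closed (sub_pred SS).
Proof.
by case: (SS) => S0 H; split=> [|a x y]; rewrite !inE => //; apply: H.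
Qed.

HB.instance Definition _ V (S : set V) (SS : submod S) :=
  GRing.isSubmodClosed.Build R V (sub_pred SS) (sub_pred_submod SS).

Lemma quotmod_proj V (S : zmodClosed V) (h : GRing.scaler_closed S) :
  exists p : {linear V -> quotmod h}, surj p /\ forall v, p v = 0 <-> v \in S.
Proof.
have [|p Hp] := @make_linear V (quotmod h) (@qproj R V S h).
  move=> a x y; rewrite qprojD; congr (_ + _).
  by rewrite -(qscale_proj h a x).
exists p; split.
  by move=> v; exists (qrepr v); rewrite Hp; exact: qreprK.
move=> v; rewrite Hp; have -> : (0 : quotmod h) = qproj h 0 by rewrite -Hp linear0.
by split=> [/eqP|Sv]; [|apply/eqP]; rewrite qprojE subr0.
Qed.

Lemma quotient_exists V (S : set V) : submod S ->
  exists (Q : lmodType R) (p : {linear V -> Q}), surj p /\ forall v, p v = 0 <-> S v.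
Proof.
move=> SS.
have h : GRing.scaler_closed (sub_pred SS).
  exact: (GRing.subsemimod_closedZ (GRing.submod_closed_semi (sub_pred_submod SS))).
have [p [sp Hp]] := quotmod_proj h.
by exists (quotmod h), p; split=> // v; rewrite Hp inE.
Qed.

Lemma kernel_exists U V (f : {linear U -> V}) :
  exists (K : lmodType R) (i : {linear K -> U}),
    injective i /\ forall u, f u = 0 <-> exists k, i k = u.
Proof.
exists (ker f), (val : {linear ker f -> U}); split; first exact: val_inj.
move=> u; split=> [fu|[k <-]].
  have h : u \in ker_pred f by rewrite inE; apply/eqP.
  by exists (Ker h).
by case: k => k /= /eqP.
Qed.

Lemma submodule_exists V (S : set V) : submod S ->
  exists (K : lmodType R) (i : {linear K -> V}),
    injective i /\ forall v, S v <-> exists k, i k = v.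
Proof.
move=> SS; have [Q [p [_ Hp]]] := quotient_exists SS.
have [K [i [ii Hi]]] := kernel_exists p.
by exists K, i; split=> // v; rewrite -Hi Hp.
Qed.

Lemma factor_surj A B C (p : {linear A -> B}) (f : {linear A -> C}) :
  surj p -> (forall a, p a = 0 -> f a = 0) ->
  exists g : {linear B -> C}, forall a, g (p a) = f a.
Proof.
move=> sp H; have [s Hs] := choice sp.
have E a b : p a = p b -> f a = f b.
  move=> e; apply/eqP; rewrite -subr_eq0 -linearB H //.
  by rewrite linearB e subrr.
have [|g Hg] := @make_linear B C (f \o s).
  by move=> c x y; rewrite /= -linearP; apply: E; rewrite linearP !Hs.
by exists g => a; rewrite Hg /=; apply: E; rewrite Hs.
Qed.

Lemma factor_inj K A C (i : {linear K -> A}) (f : {linear C -> A}) :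
  injective i -> (forall c, exists k, i k = f c) ->
  exists g : {linear C -> K}, forall c, i (g c) = f c.
Proof.
move=> ii H; have [s Hs] := choice H.
have [|g Hg] := @make_linear C K s.
  by move=> c x y; apply: ii; rewrite linearP !Hs linearP.
by exists g => c; rewrite Hg Hs.
Qed.

Definition ses A B C (i : {linear A -> B}) (p : {linear B -> C}) : Prop :=
  [/\ injective i, surj p & forall b, p b = 0 <-> exists a, i a = b].

Lemma ses_comp A B C (i : {linear A -> B}) (p : {linear B -> C}) a :
  ses i p -> p (i a) = 0.
Proof. by case=> _ _ H; apply/H; exists a. Qed.

Lemma ses_of_surj B C (p : {linear B -> C}) : surj p ->
  exists (A : lmodType R) (i : {linear A -> B}), ses i p.
Proof. by move=> sp; have [K [i [ii Hi]]] := kernel_exists p; exists K, i. Qed.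

Lemma ses_of_submod V (S : set V) : submod S ->
  exists (A C : lmodType R) (i : {linear A -> V}) (p : {linear V -> C}),
    ses i p /\ forall v, S v <-> exists a, i a = v.
Proof.
move=> SS; have [C [p [sp Hp]]] := quotient_exists SS.
have [A [i Hi]] := ses_of_surj sp.
by exists A, C, i, p; split=> // v; rewrite -Hp; case: Hi.
Qed.

Lemma injective_ker U V (f : {linear U -> V}) :
  (forall u, f u = 0 -> u = 0) -> injective f.
Proof.
move=> H u v e; apply/eqP; rewrite -subr_eq0; apply/eqP/H.
by rewrite linearB e subrr.
Qed.

Definition regular (x : R) L : Prop := forall u : L, x *: u = 0 -> u = 0.

Definition mulx (x : R) V : {linear V -> V} :=
  GRing.scale x : {linear V -> V}.

End Modules.

Section FinitelyGenerated.
Context {R : comNzRingType}.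
Implicit Types U V W A B C K L M N P Q : lmodType R.

Lemma span_nil V (x : V) : lin_span [::] x <-> x = 0.
Proof.
split=> [[c ->]|->]; first by rewrite big_ord0.
by exists (fun=> 0); rewrite big_ord0.
Qed.

Lemma span_cons V (v : V) s x :
  lin_span (v :: s) x <-> exists a w, lin_span s w /\ x = a *: v + w.
Proof.
split=> [[c ->]|[a [_ [[c ->] ->]]]].
  rewrite /= big_ord_recl /=; exists (c 0%N), (\sum_(i < size s) c i.+1 *: s`_i).
  by split=> //; exists (fun i => c i.+1).
exists (fun i => if i is j.+1 then c j else a).
by rewrite /= big_ord_recl.
Qed.

Lemma submod_span V (s : seq V) : submod (lin_span s).
Proof.
split=> [|a _ _ [c ->] [c' ->]].
  by exists (fun=> 0); rewrite big1 // => i _; rewrite scale0r.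
exists (fun i => a * c i + c' i); rewrite scaler_sumr -big_split /=.
by apply: eq_bigr => i _; rewrite scalerA -scalerDl.
Qed.

Lemma span_mem V (s : seq V) x : x \in s -> lin_span s x.
Proof.
elim: s => // v s IH; rewrite inE => /orP[/eqP ->|/IH H]; apply/span_cons.
  exists 1, 0; split; last by rewrite scale1r addr0.
  by case: (submod_span s).
by exists 0, x; rewrite scale0r add0r.
Qed.

Lemma span_min V (s : seq V) (S : set V) : submod S ->
  (forall x, x \in s -> S x) -> lin_span s `<=` S.
Proof.
move=> SS; elim: s => [|v s IH] H x.
  by move/span_nil ->; case: SS.
move=> /span_cons [a [w [sw ->]]]; apply: SS.2.
  by apply: H; rewrite inE eqxx.
by apply: IH => // y ys; apply: H; rewrite inE ys orbT.
Qed.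

Lemma span_mono V (s t : seq V) : (forall x, x \in s -> lin_span t x) ->
  lin_span s `<=` lin_span t.
Proof. by move=> H; apply: span_min => //; apply: submod_span. Qed.

Lemma span_catl V (s t : seq V) : lin_span s `<=` lin_span (s ++ t).
Proof.
by apply: span_mono => x xs; apply: span_mem; rewrite mem_cat xs.
Qed.

Lemma span_catr V (s t : seq V) : lin_span t `<=` lin_span (s ++ t).
Proof.
by apply: span_mono => x xs; apply: span_mem; rewrite mem_cat xs orbT.
Qed.

Lemma span_map U V (f : {linear U -> V}) s x :
  lin_span s x -> lin_span (map f s) (f x).
Proof.
move=> [c ->]; exists c; rewrite size_map linear_sum; apply: eq_bigr => i _.
by rewrite linearZ /= (nth_map 0).
Qed.

Lemma fgP V : fg V <-> exists s : seq V, forall x, lin_span s x.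
Proof.
split=> -[s H]; exists s; first by move=> x; rewrite H.
by apply/seteqP; split.
Qed.

Lemma fg_surj U V (f : {linear U -> V}) : surj f -> fg U -> fg V.
Proof.
move=> sf /fgP[s Hs]; apply/fgP; exists (map f s) => v.
by have [u <-] := sf v; apply: span_map.
Qed.

Lemma fg_iso U V (f : {linear U -> V}) : bijective f -> fg U -> fg V.
Proof. by move=> [g fg gf]; apply: fg_surj => v; exists (g v). Qed.

Lemma fg_zero V : zero_module V -> fg V.
Proof. by move=> H; apply/fgP; exists [::] => x; apply/span_nil/H. Qed.

Lemma fg_regular : fg (R^o : lmodType R).
Proof.
apply/fgP; exists [:: 1 : R^o] => x; apply/span_cons; exists x, 0.
split; first exact/span_nil.
by rewrite addr0 -[LHS]mulr1.
Qed.

Lemma fg_ext A B C (i : {linear A -> B}) (p : {linear B -> C}) :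
  ses i p -> fg A -> fg C -> fg B.
Proof.
move=> [_ sp ex] /fgP[s Hs] /fgP[t Ht].
have [l Hl] := choice sp.
apply/fgP; exists (map i s ++ map l t) => b.
have [c Hc] := Ht (p b).
pose b' := \sum_(j < size t) c j *: (map l t)`_j.
have /ex[a Ha] : p (b - b') = 0.
  rewrite linearB /= Hc linear_sum -sumrB big1 // => j _.
  by rewrite linearZ /= (nth_map 0) // Hl subrr.
rewrite -(subrK b' b) -Ha; apply: submodD; first exact: submod_span.
  by apply: span_catl; apply: span_map.
by apply: span_catr; exists c; rewrite size_map.
Qed.

Lemma prod_ses U V :
  exists (i : {linear U -> (U * V)%type}) (p : {linear (U * V)%type -> V}), ses i p.
Proof.
have [|i Hi] := @make_linear R U (U * V)%type (fun u => (u, 0%R)).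
  by move=> a x y; rewrite [RHS]surjective_pairing /= scaler0 addr0.
have [//|p Hp] := @make_linear R (U * V)%type V snd.
exists i, p; split.
- by move=> x y; rewrite !Hi => -[].
- by move=> v; exists (0, v); rewrite Hp.
- move=> [u v]; rewrite Hp /=; split=> [->|[a]]; first by exists u; rewrite Hi.
  by rewrite Hi => -[].
Qed.

Lemma fg_prod U V : fg U -> fg V -> fg (U * V)%type.
Proof. by have [i [p s]] := prod_ses U V; apply: fg_ext s. Qed.

Definition fg_submod V (S : set V) : Prop :=
  exists s : seq V, (forall x, x \in s -> S x) /\ S `<=` lin_span s.

End FinitelyGenerated.

(** * Submodules of finitely generated modules over a Noetherian ring *)

Section Noetherian.
Context {R : comNzRingType} (noethR : noetherian R).
Implicit Types U V W A B C K L M N P Q : lmodType R.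

(** Induction on the spanning list. The possible coefficients of [v] in elements of [S] form a
    finitely generated ideal [J]; subtracting a lift of the coefficient leaves an element of [S] in
    the span of the remaining list. *)
Lemma submod_of_span_fg V (s : seq V) (S : set V) :
  submod S -> S `<=` lin_span s -> fg_submod S.
Proof.
elim: s S => [|v s IH] S SS sub.
  by exists [::]; split.
pose J : set R := [set a | exists w, lin_span s w /\ S (a *: v + w)].
have iJ : ideal J.
  split; first by exists 0; rewrite scale0r addr0; split; [case: (submod_span s)|case: SS].
  move=> a x y [w [sw Sw]] [w' [sw' Sw']]; exists (a *: w + w').
  split; first by apply: (submod_span s).2.
  have -> : (a * x + y) *: v + (a *: w + w') = a *: (x *: v + w) + (y *: v + w').
    by rewrite scalerDl scalerDr scalerA addrACA.
  exact: SS.2.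
have [c Jc] := noethR iJ.
have [t [tS Ht]] : exists t : seq V, (forall x, x \in t -> S x) /\
    forall a, lin_span c a -> exists w, lin_span s w /\ lin_span t (a *: v + w).
  have : forall x, x \in c -> J x by move=> x xc; rewrite Jc; apply: span_mem.
  move: (c) => {Jc}; elim=> [|b e IHe] Hc.
    exists [::]; split=> // a /span_nil ->; exists 0; split; first by case: (submod_span s).
    by apply/span_nil; rewrite scale0r addr0.
  have [|t [tS Ht]] := IHe; first by move=> x xe; apply: Hc; rewrite inE xe orbT.
  have [w [sw Sw]] : J b by apply: Hc; rewrite inE eqxx.
  exists ((b *: v + w) :: t); split.
    by move=> x; rewrite inE => /orP[/eqP ->|/tS].
  move=> a /span_cons[d [a' [/Ht[w' [sw' Hw']] ->]]].
  exists (d *: w + w'); split; first by apply: (submod_span s).2.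
  apply/span_cons; exists d, (a' *: v + w'); split=> //.
  rewrite scalerDl scalerDr scalerA addrACA; congr (_ *: _ + _ + _).
have SI : submod (S `&` lin_span s).
  split=> [|a x y [Sx sx] [Sy sy]]; first by split; [case: SS|case: (submod_span s)].
  by split; [apply: SS.2|apply: (submod_span s).2].
have [t' [t'S Ht']] := IH _ SI (@subIsetr _ _ _).
exists (t ++ t'); split.
  by move=> x; rewrite mem_cat => /orP[/tS|/t'S []].
move=> x Sx; have /span_cons[a [w [sw ex]]] := sub _ Sx.
have /Ht[w' [sw' tw']] : lin_span c a by rewrite -Jc; exists w; rewrite -ex.
rewrite -(subrK (a *: v + w') x); apply: submodD; first exact: submod_span.
  apply: span_catr; apply: Ht'; split.
    by apply: submodB => //; apply: (span_min SS tS).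
  rewrite ex opprD addrACA subrr add0r.
  by apply: submodB => //; apply: submod_span.
exact: span_catl.
Qed.

Lemma submod_fg V (S : set V) : fg V -> submod S -> fg_submod S.
Proof. by move=> /fgP[s Hs] SS; apply: (@submod_of_span_fg _ s). Qed.

Lemma fg_sub A B (i : {linear A -> B}) : injective i -> fg B -> fg A.
Proof.
move=> ii fB; have [s [sr Hs]] := submod_fg fB (submod_im i).
have : exists t : seq A, s = map i t.
  elim: s sr {Hs} => [|x s IH] H; first by exists [::].
  have [|t ->] := IH; first by move=> y ys; apply: H; rewrite inE ys orbT.
  have [|a _ <-] := H x; first by rewrite inE eqxx.
  by exists (a :: t).
move=> [t es]; apply/fgP; exists t => a.
have [|c Hc] := Hs (i a); first by exists a.
exists c; apply: ii; rewrite Hc es size_map linear_sum; apply: eq_bigr => j _.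
by rewrite linearZ /= (nth_map 0).
Qed.

(** If [G] lies in [U] plus a finite span, then [G] modulo [U] has finitely many generators taken
    from [G] itself. The ambient module need not be finitely generated, so the Noetherian property
    is applied to [T], the elements of the span that are congruent to elements of [G] modulo [U]. *)
Lemma relative_fg V (G U : set V) (s : seq V) : submod G -> submod U ->
  (forall g, G g -> exists u, U u /\ lin_span s (g - u)) ->
  exists t : seq V, (forall x, x \in t -> G x) /\
    forall g, G g -> exists u, U u /\ lin_span t (g - u).
Proof.
move=> SG SU H.
pose T := [set w | lin_span s w /\ exists u, U u /\ G (w + u)].
have ST : submod T.
  split.
    split; first by case: (submod_span s).
    by exists 0; rewrite addr0; split; [case: SU|case: SG].
  move=> a x y [sx [u [Uu Gu]]] [sy [u' [Uu' Gu']]]; split.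
    by apply: (submod_span s).2.
  exists (a *: u + u'); split; first by apply: SU.2.
  have -> : a *: x + y + (a *: u + u') = a *: (x + u) + (y + u').
    by rewrite scalerDr addrACA.
  exact: SG.2.
have [|t [tT Ht]] := @submod_of_span_fg _ s T ST; first by move=> x [].
have [t' [t'G Ht']] : exists t' : seq V, (forall x, x \in t' -> G x) /\
    forall w, lin_span t w -> exists u, U u /\ lin_span t' (w - u).
  elim: t tT {Ht} => [|b e IHe] Hc.
    exists [::]; split=> // w /span_nil ->; exists 0; split; first by case: SU.
    by apply/span_nil; rewrite subrr.
  have [|t [tS Ht]] := IHe; first by move=> x xe; apply: Hc; rewrite inE xe orbT.
  have [|_ [u [Uu Gu]]] := Hc b; first by rewrite inE eqxx.
  exists ((b + u) :: t); split.
    by move=> x; rewrite inE => /orP[/eqP ->|/tS].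
  move=> w /span_cons[d [a' [/Ht[u' [Uu' Hu']] ->]]].
  exists (u' - d *: u); split; first by apply: submodB => //; apply: submodZ.
  apply/span_cons; exists d, (a' - u'); split=> //.
  by rewrite scalerDr opprB addrACA.
exists t'; split=> // g Gg.
have [u [Uu su]] := H g Gg.
have [|u' [Uu' tu']] := Ht' (g - u).
  by apply: Ht; split=> //; exists u; rewrite subrK.
by exists (u + u'); rewrite opprD addrA; split=> //; apply: submodD.
Qed.

(** Without a maximal member, choice yields a strictly increasing chain; its union is generated by a
    finite list that already lies in one term. *)
Lemma noetherian_max V (F : set V -> Prop) (S0 : set V) : fg V ->
  (forall S, F S -> submod S) -> F S0 ->
  exists S, F S /\ forall S', F S' -> S `<=` S' -> S' = S.
Proof.
move=> fV sF F0; apply: contrapT => /forallNP no.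
have step (S : {S | F S}) : exists S' : {S | F S}, sval S `<=` sval S' /\ sval S' <> sval S.
  case: S => S FS /=; have /not_andP[//|/existsNP[S' H]] := no S.
  by move/not_implyP: H => [FS' /not_implyP[]]; exists (exist _ S' FS').
have [nx Hnx] := choice step.
pose c n := iter n nx (exist _ S0 F0).
have inc n k : sval (c n) `<=` sval (c (n + k)%N).
  elim: k => [|k IH]; first by rewrite addn0.
  by rewrite addnS; apply: subset_trans IH _; have [] := Hnx (c (n + k)%N).
have mono n k : (n <= k)%N -> sval (c n) `<=` sval (c k).
  by move=> nk; rewrite -(subnKC nk).
pose T := \bigcup_n sval (c n).
have ST : submod T.
  split; first by exists 0%N => //; have [] := sF _ F0.
  move=> a x y [n _ cx] [k _ cy]; exists (maxn n k) => //.
  have [_ H] := sF _ (svalP (c (maxn n k))); apply: H.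
    exact: mono (leq_maxl n k) _ cx.
  exact: mono (leq_maxr n k) _ cy.
have [s [sT Ts]] := submod_fg fV ST.
have [n sn] : exists n, forall x, x \in s -> sval (c n) x.
  elim: s sT {Ts} => [|x s IH] H; first by exists 0%N.
  have [|n Hn] := IH; first by move=> y ys; apply: H; rewrite inE ys orbT.
  have [|k _ Hk] := H x; first by rewrite inE eqxx.
  exists (maxn n k) => y; rewrite inE => /orP[/eqP ->|ys].
    exact: mono (leq_maxr n k) _ Hk.
  exact: mono (leq_maxl n k) _ (Hn _ ys).
have [i ne] := Hnx (c n); apply: ne; apply/seteqP; split=> //.
apply: subset_trans (_ : T `<=` _); first by move=> x cx; exists n.+1.
apply: subset_trans Ts _; apply: span_min => //; exact: sF (svalP (c n)).
Qed.

Lemma noetherian_ind V (F : set V -> Prop) : fg V ->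
  (forall S, submod S ->
    (forall S', submod S' -> S `<=` S' -> S' <> S -> F S') -> F S) ->
  forall S, submod S -> F S.
Proof.
move=> fV H S0 S0s; apply: contrapT => nF.
have [//|//|S [[SS nS] mx]] := @noetherian_max V (fun S => submod S /\ ~ F S) S0 fV.
  by move=> S [].
apply: nS; apply: H => // S' S's sub ne; apply: contrapT => nF'.
by apply: ne; apply: mx.
Qed.

End Noetherian.

(** * Residue field, Nakayama's lemma and devissage *)

Section LocalRing.
Context {R : comNzRingType} {m : set R}.
Context (noethR : noetherian R) (R_local : local_ring m).
Implicit Types U V W A B C K L M N P Q k : lmodType R.

Lemma ideal_submod (J : set R) : ideal J -> submod (J : set (R^o : lmodType R)).
Proof. by []. Qed.

Lemma ideal_m : ideal m.
Proof. by case: R_local => -[]. Qed.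

Lemma m_proper : ~ m 1.
Proof.
case: R_local => -[_ /eqP ne _] _ m1; apply: ne; apply/seteqP; split=> // r _.
by have := submodZ r (ideal_submod ideal_m) m1; rewrite /GRing.scale /= mulr1.
Qed.

(** A maximal member among the proper ideals containing [J] is a maximal ideal, hence equal to
    [m]. *)
Lemma proper_ideal_sub (J : set R) : ideal J -> ~ J 1 -> J `<=` m.
Proof.
move=> iJ J1.
pose F (K : set (R^o : lmodType R)) := [/\ ideal K, J `<=` K & ~ K 1].
have [||K [[iK JK K1] mx]] := noetherian_max noethR (F := F) (S0 := J) (@fg_regular R).
- by move=> K [].
- by split.
suff -> : m = K by [].
apply/esym; apply: (R_local.2); split=> //.
  by apply/eqP => eK; apply: K1; rewrite eK.
move=> K' iK' sub; have [K'1|K'1] := pselect (K' 1); [right|left].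
  apply/seteqP; split=> // r _.
  by have := submodZ r (ideal_submod iK') K'1; rewrite /GRing.scale /= mulr1.
by apply: mx => //; split=> //; apply: subset_trans JK sub.
Qed.

Lemma unit_notin (a : R) : ~ m a -> exists b, b * a = 1.
Proof.
move=> ma; apply: contrapT => no; apply: ma.
pose J : set R := [set r | exists b, r = b * a].
apply: (@proper_ideal_sub J); last by exists 1; rewrite mul1r.
  split; first by exists 0; rewrite mul0r.
  by move=> c _ _ [x ->] [y ->]; exists (c * x + y); rewrite mulrDl mulrA.
by move=> [b e]; apply: no; exists b.
Qed.

Lemma mulm a x : m x -> m (a * x).
Proof. exact: (submodZ a (ideal_submod ideal_m)). Qed.

(** A property rather than a chosen quotient, so that devissage can recognise any cyclic module with
    annihilator [m] as a copy of the residue field. *)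
Definition residue (k : lmodType R) : Prop :=
  exists p : {linear R^o -> k}, surj p /\ forall r, p r = 0 <-> m r.

Lemma residue_exists : exists k : lmodType R, residue k.
Proof.
have [k [p Hp]] := quotient_exists (ideal_submod ideal_m).
by exists k, p.
Qed.

Lemma residue_kill k x (u : k) : residue k -> m x -> x *: u = 0.
Proof.
move=> [p [sp Hp]] mx; have [r <-] := sp u.
by rewrite -linearZ; apply/Hp; rewrite /GRing.scale /= mulrC; apply: mulm.
Qed.

Lemma residue_nonzero k : residue k -> nonzero_module k.
Proof.
move=> [p [sp Hp]]; exists (p 1); apply/eqP => /Hp; exact: m_proper.
Qed.

(** Modulo a maximal proper submodule [S], the module is generated by any element outside [S]. The
    annihilator of that generator contains no unit, so the projection from R to [k] factors through
    this quotient. *)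
Lemma residue_quotient k Q : residue k -> fg Q -> nonzero_module Q ->
  exists u : {linear Q -> k}, surj u.
Proof.
move=> [p [sp Hp]] fQ [v0 /eqP v0n].
pose F (S : set Q) := submod S /\ exists v, ~ S v.
have [||S [[SS [v Sv]] mx]] := noetherian_max noethR (F := F) (S0 := [set x | x = 0]) fQ.
- by move=> S [].
- by split; [exact: submod_zero|exists v0].
have [C [q [sq Hq]]] := quotient_exists SS.
have [mu Hmu] : exists mu : {linear (R^o : lmodType R) -> C}, forall r, mu r = r *: q v.
  by apply: make_linear => a x y; rewrite scalerDl -scalerA.
have gen w : ~ S w -> forall x, exists r s, S s /\ x = r *: w + s.
  move=> Sw x; pose T := [set x | exists r s, S s /\ x = r *: w + s].
  suff : T x by [].
  apply: contrapT => nT; apply: Sw; suff <- : T = S.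
    by exists 1, 0; rewrite scale1r addr0; split=> //; case: SS.
  apply: mx; last by move=> y Sy; exists 0, y; rewrite scale0r add0r.
  split; last by exists x.
  split; first by exists 0, 0; rewrite scale0r addr0; split=> //; case: SS.
  move=> a y z [r [s [Ss ->]]] [r' [s' [Ss' ->]]].
  exists (a * r + r'), (a *: s + s'); split; first by apply: SS.2.
  by rewrite scalerDl scalerDr scalerA addrACA.
have smu : surj mu.
  move=> c; have [x <-] := sq c; have [r [s [Ss ->]]] := gen _ Sv x.
  by exists r; rewrite Hmu linearD linearZ /=; have /Hq -> := Ss; rewrite addr0.
have [|u Hu] := @factor_surj R _ _ _ mu p smu.
  move=> a; rewrite Hmu => e; apply/Hp; apply: contrapT => /unit_notin[b ba].
  apply: Sv; apply/Hq; rewrite -[q v]scale1r -ba -scalerA e scaler0 //.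
exists (u \o q) => c; have [r <-] := sp c; exists (r *: v).
by rewrite /= linearZ /= -Hmu Hu.
Qed.

(** Only the quotient of [V] by [U] is assumed finitely generated. If it were nonzero it would map
    onto the residue field, which is impossible because it equals its own multiple by [m]. *)
Lemma nakayama V (U : set V) : submod U ->
  (exists s, forall v, exists u, U u /\ lin_span s (v - u)) ->
  (forall v, exists n (y : nat -> R) (w : nat -> V) u,
     [/\ forall i, (i < n)%N -> m (y i), U u & v = \sum_(i < n) y i *: w i + u]) ->
  forall v, U v.
Proof.
move=> SU [s Hs] H v.
have [Q [p [sp Hp]]] := quotient_exists SU.
have fQ : fg Q.
  apply/fgP; exists (map p s) => c; have [w <-] := sp c.
  have [u [Uu su]] := Hs w; rewrite -(subrK u w) linearD /=.
  by have /Hp -> := Uu; rewrite addr0; apply: span_map.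
apply/Hp; apply: contrapT => ne.
have [k rk] := residue_exists.
have [|u su] := @residue_quotient k Q rk fQ; first by exists (p v); apply/eqP.
have [c /eqP cn] := residue_nonzero rk; apply: cn.
have [c' <-] := su c; have [w <-] := sp c'.
have [n [y [z [t [my Ut ->]]]]] := H w.
rewrite linearD /=; have /Hp -> := Ut; rewrite addr0 !linear_sum big1 // => i _.
by rewrite !linearZ /=; apply: residue_kill => //; apply: my.
Qed.

Lemma nakayama1 V (U : set V) x : m x -> submod U ->
  (exists s, forall v, exists u, U u /\ lin_span s (v - u)) ->
  (forall v, exists w, U (v - x *: w)) -> forall v, U v.
Proof.
move=> mx SU fgU H; apply: nakayama => // v; have [w Hw] := H v.
exists 1%N, (fun=> x), (fun=> w), (v - x *: w); split=> //.
by rewrite big_ord1 addrCA subrr addr0.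
Qed.

Lemma fg_mulx_nonzero L x : m x -> fg L -> nonzero_module L ->
  exists v : L, forall w, v <> x *: w.
Proof.
move=> mx /fgP[s Hs] [v0 /eqP nv]; apply: contrapT => no; apply: nv.
apply: (@nakayama1 L [set v | v = 0] x mx); first exact: submod_zero.
  by exists s => v; exists 0; rewrite subr0.
move=> v; apply: contrapT => /forallNP H; apply: no; exists v => w e.
by apply: (H w) => /=; rewrite e subrr.
Qed.

Definition quot_by (x : R) L C (p : {linear L -> C}) : Prop :=
  surj p /\ forall v, p v = 0 <-> exists w, v = x *: w.

Lemma quot_by_exists x L : exists (C : lmodType R) (p : {linear L -> C}), quot_by x p.
Proof.
have [C [p [sp Hp]]] := quotient_exists (submod_im (mulx x L)).
exists C, p; split=> // v; rewrite Hp; split=> [[w _ <-]|[w ->]]; by exists w.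
Qed.

Lemma quot_by_ses x L C (p : {linear L -> C}) :
  regular x L -> quot_by x p -> ses (mulx x L) p.
Proof.
move=> rx [sp Hp]; split=> //; first by apply: injective_ker; apply: rx.
by move=> b; rewrite Hp; split=> -[w]; [move=> ->|move=> <-]; exists w.
Qed.

Lemma quot_by_nonzero x L C (p : {linear L -> C}) : m x -> fg L ->
  nonzero_module L -> quot_by x p -> nonzero_module C.
Proof.
move=> mx fL nL [_ Hp]; have [v Hv] := fg_mulx_nonzero mx fL nL.
by exists (p v); apply/eqP => /Hp[w]; apply: Hv.
Qed.

Section Devissage.
Context (F : lmodType R -> Prop).
Hypothesis F_zero : forall L, zero_module L -> F L.
Hypothesis F_residue : forall k, residue k -> F k.
Hypothesis F_ext : forall A B C (i : {linear A -> B}) (p : {linear B -> C}),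
  fg A -> fg B -> fg C -> ses i p -> F A -> F C -> F B.
Hypothesis F_regular : forall x L C (p : {linear L -> C}), fg L -> m x ->
  regular x L -> quot_by x p -> F C -> F L.

(** Noetherian induction on the annihilator [J]. For [x] in [m] outside [J], the quotient L/xL has a
    larger annihilator. If (J : x) = J, then [x] is regular on [L]; otherwise xL is R/(J : x), again
    with a larger annihilator, and [L] is an extension of L/xL by it. *)
Lemma devissage_cyclic (J : set (R^o : lmodType R)) : submod J ->
  forall L (p : {linear R^o -> L}), surj p -> (forall r, p r = 0 <-> J r) -> F L.
Proof.
move: J; apply: (noetherian_ind noethR); first exact: fg_regular.
move=> J SJ IH L p sp Hp.
have fL : fg L by apply: fg_surj sp fg_regular.
have [J1|J1] := pselect (J 1).
  apply: F_zero => v; have [r <-] := sp v; apply/Hp.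
  by have := submodZ r SJ J1; rewrite /GRing.scale /= mulr1.
have Jm := proper_ideal_sub SJ J1.
have [mJ|] := pselect (m `<=` J).
  by apply: F_residue; exists p; split=> // r; rewrite Hp; split; [apply: Jm|apply: mJ].
move=> /existsNP[x /not_implyP[mx Jx]].
have [C [q qq]] := quot_by_exists x L.
have FC : F C.
  apply: (IH [set r | q (p r) = 0] (submod_ker (q \o p)) _ _ _ (q \o p)) => //.
  - by move=> r Jr /=; have /Hp -> := Jr; rewrite linear0.
  - move=> e; apply: Jx; rewrite -e /=; apply/(qq.2); exists (p 1).
    by rewrite -linearZ /GRing.scale /= mulr1.
  - by move=> c; have [v <-] := qq.1 c; have [r <-] := sp v; exists r.
(* The annihilator of xL. *)
pose J' : set (R^o : lmodType R) := [set r | J (x *: r)].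
have SJ' : submod J' by apply: (submod_preim (mulx x (R^o : lmodType R)) SJ).
have JJ' : J `<=` J' by move=> r Jr; apply: submodZ.
have [JJ|nJ] := pselect (J' = J).
  apply: (F_regular fL mx _ qq FC) => u; have [r <-] := sp u.
  by rewrite -linearZ => /Hp Jrx; apply/Hp; rewrite -JJ.
have [A [j [ij Hj]]] := submodule_exists (submod_im (mulx x L)).
have [|mu Hmu] := @factor_inj R A L (R^o : lmodType R) j (p \o mulx x (R^o : lmodType R)) ij.
  by move=> r; apply/Hj; exists (p r) => //=; rewrite linearZ.
have smu : surj mu.
  move=> a; have /Hj[v _ e] : exists a', j a' = j a by exists a.
  by have [r er] := sp v; exists r; apply: ij; rewrite Hmu /= linearZ /= er -e.
have FA : F A.
  apply: (IH J' SJ' JJ' nJ A mu smu) => r; split=> [e|/Hp e].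
    by apply/Hp; have := Hmu r; rewrite e linear0.
  by apply: ij; rewrite Hmu linear0.
apply: (@F_ext A L C j q) => //.
- exact: fg_surj smu fg_regular.
- exact: fg_surj qq.1 fL.
split=> //; first exact: qq.1.
by move=> b; rewrite -Hj qq.2; split=> -[w]; [move=> ->|move=> _ <-]; exists w.
Qed.

(** Induction on the number of generators: the first one spans a cyclic submodule, and its quotient
    needs one generator less. *)
Lemma devissage L : fg L -> F L.
Proof.
move=> /fgP[s0]; move: {2}(size s0) (erefl (size s0)) => n.
elim: n L s0 => [|n IH] L [|v s] // => [_|[sz]] Hs.
  by apply: F_zero => x; apply/span_nil/Hs.
have fL : fg L by apply/fgP; exists (v :: s).
have [f Hf] := scale_map v.
have [A [C [i [p [sq Hi]]]]] := ses_of_submod (submod_im f).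
have [ij sp ex] := sq.
have [|mu Hmu] := @factor_inj R A L (R^o : lmodType R) i f ij.
  by move=> r; apply/Hi; exists r.
have smu : surj mu.
  move=> a; have /Hi[r _ e] : exists a', i a' = i a by exists a.
  by exists r; apply: ij; rewrite Hmu.
have fA : fg A by apply: fg_surj smu fg_regular.
apply: (F_ext fA fL _ sq); first exact: fg_surj sp fL.
  by apply: (devissage_cyclic (submod_ker mu) smu) => r; split.
apply: (IH C (map p s)); first by rewrite size_map.
move=> c; have [x <-] := sp c; have /span_cons[a [w [sw ->]]] := Hs x.
rewrite linearD linearZ /=; have /ex -> : exists b, i b = v.
  by apply/Hi; exists 1; rewrite // Hf scale1r.
by rewrite scaler0 add0r; apply: span_map.
Qed.

End Devissage.
End LocalRing.

(** * Associated primes, prime avoidance and regular elements *)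

Section RegularElement.
Context {R : comNzRingType} {m : set R}.
Context (noethR : noetherian R) (R_local : local_ring m).
Implicit Types U V W A B C K L M N P : lmodType R.

Definition prime_ideal (J : set R) : Prop :=
  [/\ submod (J : set (R^o : lmodType R)), ~ J 1 &
      forall a b, J (a * b) -> J a \/ J b].

Definition colon V (S : set V) (v : V) : set R := [set r | S (r *: v)].

Lemma submod_colon V (S : set V) v :
  submod S -> submod (colon S v : set (R^o : lmodType R)).
Proof.
move=> SS; split; first by rewrite /colon /= scale0r; case: SS.
by move=> a x y; rewrite /colon /= scalerDl -scalerA => Sx Sy; apply: SS.2.
Qed.

(** Multiply an element of [J] outside the prime [Q a] by elements of the other primes outside
    [Q a]; primality keeps the product outside. *)
Lemma prime_product n (Q : 'I_n -> set R) (J : set R) a :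
  (forall i, prime_ideal (Q i)) -> submod (J : set (R^o : lmodType R)) ->
  (exists x, J x /\ ~ Q a x) ->
  forall s : seq 'I_n, (forall i, i \in s -> exists x, Q i x /\ ~ Q a x) ->
  exists x, [/\ J x, forall i, i \in s -> Q i x & ~ Q a x].
Proof.
move=> pQ SJ [x [Jx Qx]]; elim=> [|i s IH] H; first by exists x.
have [|y [Jy Qy nQy]] := IH; first by move=> j js; apply: H; rewrite inE js orbT.
have [|z [Qz nQz]] := H i; first by rewrite inE eqxx.
exists (z * y); split.
- exact: (submodZ z SJ).
- move=> j; have [SQ _ _] := pQ j; rewrite inE => /orP[/eqP ej|/Qy Qjy].
    by rewrite mulrC; apply: (submodZ y SQ); rewrite ej.
  exact: (submodZ z SQ).
- by have [_ _ H'] := pQ a; move=> /H'[].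
Qed.

Lemma prime_avoidance n (Q : 'I_n -> set R) (J : set R) :
  (forall i, prime_ideal (Q i)) -> submod (J : set (R^o : lmodType R)) ->
  forall A : {set 'I_n}, (forall i, i \in A -> exists x, J x /\ ~ Q i x) ->
  exists x, J x /\ forall i, i \in A -> ~ Q i x.
Proof.
move=> pQ SJ A; move: {2}#|A| (leqnn #|A|) => k.
elim: k A => [|k IH] A.
  rewrite leqn0 cards_eq0 => /eqP -> _; exists 0; split; first by case: SJ.
  by move=> i; rewrite inE.
move=> Ak H; have [->|[a aA]] := set_0Vmem A.
  by exists 0; split; [case: SJ|move=> i; rewrite inE].
have rem i : i \in A -> exists x, J x /\ forall j, j \in A :\ i -> ~ Q j x.
  move=> iA; apply: IH.
    by rewrite -ltnS; apply: leq_trans Ak; rewrite (cardsD1 i A) iA.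
  by move=> j /setD1P[_ /H].
have [x [Jx Hx]] := rem a aA.
have [Qx|Qx] := pselect (Q a x); last first.
  exists x; split=> // i iA; have [->//|ia] := eqVneq i a.
  by apply: Hx; rewrite in_setD1 ia.
have [[i [/setD1P[ia iA] sub]]|no] :=
    pselect (exists i, i \in A :\ a /\ Q i `<=` Q a).
  have [y [Jy Hy]] := rem i iA; exists y; split=> // j jA.
  have [->|ji] := eqVneq j i; last by apply: Hy; rewrite in_setD1 ji.
  by move=> /sub; apply: Hy; rewrite in_setD1 eq_sym ia.
have [||y [Jy Qy nQy]] := @prime_product n Q J a pQ SJ _ (enum (A :\ a)).
- exact: H.
- move=> i; rewrite mem_enum => iA; apply: contrapT => no'; apply: no.
  exists i; split=> // z Qz; apply: contrapT => nQz; apply: no'.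
  by exists z.
exists (x + y); split; first exact: (submodD SJ).
move=> i iA; have [SQ _ _] := pQ i; have [ei|ia] := eqVneq i a.
  rewrite ei in SQ *; move=> Qxy; apply: nQy; rewrite -(addKr x y) addrC.
  exact: (submodB SQ).
have iA' : i \in A :\ a by rewrite in_setD1 ia.
move=> Qxy; apply: (Hx _ iA'); rewrite -(addrK y x).
by apply: (submodB SQ) => //; apply: Qy; rewrite mem_enum.
Qed.

(** A maximal proper colon ideal is prime. Restricting to those containing [x] makes the prime catch
    a given zero divisor. *)
Lemma associated_prime V (S : set V) v0 x : submod S -> ~ S v0 ->
  colon S v0 x -> exists v, [/\ ~ S v, colon S v x & prime_ideal (colon S v)].
Proof.
move=> SS Sv0 Cx.
pose F (K : set (R^o : lmodType R)) := exists v, [/\ ~ S v, K = colon S v & K x].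
have [||K [[v [Sv -> Kx]] mx]] := noetherian_max noethR (F := F)
    (S0 := colon S v0) (@fg_regular R).
- by move=> K [v [_ -> _]]; apply: submod_colon.
- by exists v0.
exists v; split=> //; split; first exact: submod_colon.
  by rewrite /colon /= scale1r.
move=> a b Cab; have [Sb|Sb] := pselect (S (b *: v)); [by right|left].
have sub : colon S v `<=` colon S (b *: v).
  by move=> r Cr; rewrite /colon /= scalerA mulrC -scalerA; apply: submodZ.
rewrite -(mx (colon S (b *: v))) //; first by rewrite /colon /= scalerA.
by exists (b *: v); split=> //; apply: sub.
Qed.

(** Noetherian induction on [S]: adjoining some [v] with prime colon ideal gives [S'], which
    accounts for all associated primes but that of [v]. Indeed, if a multiple of [w] outside [S]
    falls into [S'], then [w] has the colon ideal of [v]; otherwise its colon ideals for [S] and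
    [S'] agree. *)
Lemma finitely_many_associated V : fg V -> forall S : set V, submod S ->
  exists n (Q : 'I_n -> set R), (forall i, prime_ideal (Q i)) /\
    forall v, ~ S v -> prime_ideal (colon S v) -> exists i, colon S v = Q i.
Proof.
move=> fV; apply: (noetherian_ind noethR fV) => S SS IH.
have [[v0 Sv0]|none] := pselect (exists v, ~ S v); last first.
  by exists 0%N, (fun=> setT); split=> [[]//|v Sv]; case: none; exists v.
have [|v [Sv _ pv]] := @associated_prime V S v0 0 SS Sv0.
  by rewrite /colon /= scale0r; case: SS.
pose S' := [set w | exists r s, S s /\ w = r *: v + s].
have SS' : submod S'.
  split; first by exists 0, 0; rewrite scale0r addr0; split=> //; case: SS.
  move=> a y z [r [s [Ss ->]]] [r' [s' [Ss' ->]]].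
  exists (a * r + r'), (a *: s + s'); split; first by apply: SS.2.
  by rewrite scalerDl scalerDr scalerA addrACA.
have SS'sub : S `<=` S' by move=> s Ss; exists 0, s; rewrite scale0r add0r.
have [//|//||n [Q [pQ HQ]]] := IH S'.
  move=> e; apply: Sv; rewrite -e; exists 1, 0; rewrite scale1r addr0.
  by split=> //; case: SS.
exists n.+1, (fun i => if unlift ord0 i is Some j then Q j else colon S v).
split=> [i|w Sw pw]; first by case: unliftP.
have [[r [Sr S'r]]|no] := pselect (exists r, ~ S (r *: w) /\ S' (r *: w)).
  exists ord0; rewrite unlift_none.
  have e1 : colon S (r *: w) = colon S w.
    apply/seteqP; split=> c; rewrite /colon /=; last first.
      by move=> Sc; rewrite scalerA mulrC -scalerA; apply: submodZ.
    by rewrite scalerA; have [_ _ H] := pw; move=> /H[].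
  have [a [s [Ss e]]] := S'r.
  have av : ~ S (a *: v).
    by move=> Sa; apply: Sr; rewrite e; apply: submodD.
  rewrite -e1; apply/seteqP; split=> c; rewrite /colon /= e scalerDr.
    move=> Sc; have [_ _ H] := pv; have [|//|//] := H c a.
    rewrite /colon /= -scalerA -[X in S X](addrK (c *: s)).
    by apply: submodB => //; apply: submodZ.
  move=> Sc; apply: submodD => //; last exact: submodZ.
  by rewrite scalerA mulrC -scalerA; apply: submodZ.
have e1 : colon S' w = colon S w.
  apply/seteqP; split=> c; rewrite /colon /=; last exact: SS'sub.
  by move=> S'c; apply: contrapT => Sc; apply: no; exists c.
have [||i Hi] := HQ w.
- by move=> S'w; apply: no; exists 1; rewrite scale1r.
- by rewrite e1.
by exists (lift ord0 i); rewrite liftK -e1.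
Qed.

Definition socle_nonzero L : Prop :=
  exists u : L, u <> 0 /\ forall a, m a -> a *: u = 0.

(** Were [m] contained in an associated prime, the corresponding element would lie in the socle. So
    prime avoidance gives an element of [m] outside all associated primes. *)
Lemma regular_element L : fg L -> ~ socle_nonzero L ->
  exists x, m x /\ regular x L.
Proof.
move=> fL soc; have [n [Q [pQ HQ]]] := finitely_many_associated fL (submod_zero L).
pose A := [set i : 'I_n | `[< exists v : L, v <> 0 /\ Q i = colon [set x | x = 0] v >]]%SET.
have [|x [mx Hx]] := @prime_avoidance n Q m pQ (ideal_submod (ideal_m R_local)) A.
  move=> i; rewrite inE => /asboolP[v [vn ->]].
  apply: contrapT => no; apply: soc; exists v; split=> // a ma.
  by apply: contrapT => av; apply: no; exists a.
exists x; split=> // u xu; apply: contrapT => un.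
have [v [Sv Cx pv]] := @associated_prime L _ u x (submod_zero L) un xu.
have [i Hi] := HQ v Sv pv.
apply: (Hx i); last by rewrite -Hi.
by rewrite inE; apply/asboolP; exists v.
Qed.

(** An element is regular on both modules as soon as it is regular on their product. *)
Lemma regular_element2 L M : fg L -> fg M ->
  ~ socle_nonzero L -> ~ socle_nonzero M ->
  exists x, [/\ m x, regular x L & regular x M].
Proof.
move=> fL fM sL sM.
have [||x [mx rx]] := @regular_element (L * M)%type.
- exact: fg_prod.
- move=> [[u v] [uv H]].
  have Hu a (ma : m a) : a *: u = 0 by have [] := H a ma.
  have Hv a (ma : m a) : a *: v = 0 by have [] := H a ma.
  have [eu|nu] := eqVneq u 0; last by apply: sL; exists u; split=> //; apply/eqP.
  have [ev|nv] := eqVneq v 0; last by apply: sM; exists v; split=> //; apply/eqP.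
  by apply: uv; rewrite eu ev.
exists x; split=> // u xu.
  have /(congr1 fst)// : ((u, 0%R) : (L * M)%type) = 0.
  by apply: rx; rewrite [LHS]surjective_pairing /= xu scaler0.
have /(congr1 snd)// : ((0%R, u) : (L * M)%type) = 0.
by apply: rx; rewrite [LHS]surjective_pairing /= xu scaler0.
Qed.

End RegularElement.

(** * Ext by dimension shifting *)

Section FreeModules.
Context {R : comNzRingType}.

Section Extension.
Context (X : choiceType) (V : lmodType R) (phi : X -> V).

Let supp (f : free_module R X) : set X := [set x | coeff f x != 0].

Let finite_supp f : finite_set (supp f).
Proof. by have := coeffP f; rewrite inE. Qed.

Definition free_ext_fun (f : free_module R X) : V :=
  \sum_(x \in supp f) coeff f x *: phi x.

Let free_ext_funE (A : set X) f : finite_set A -> supp f `<=` A ->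
  free_ext_fun f = \sum_(x \in A) coeff f x *: phi x.
Proof.
move=> fA sfA; apply: fsbig_widen => // v [_ /= /negP/negPn/eqP ->].
exact: scale0r.
Qed.

Lemma free_ext_exists :
  exists f : {linear free_module R X -> V}, forall c, f c = free_ext_fun c.
Proof.
apply: make_linear => a f g.
pose A := supp f `|` supp g `|` supp (a *: f + g).
have fA : finite_set A.
  by rewrite !finite_setU; split; [split|]; exact: finite_supp.
rewrite !(@free_ext_funE A) //; [|by move=> x; left; right
  |by move=> x; left; left|by move=> x; right].
rewrite !fsbig_finite //= scaler_sumr -big_split; apply: eq_bigr => v _ /=.
by rewrite scalerA -scalerDl.
Qed.

End Extension.

Section Basis.
Context (X : choiceType).

Definition delta_fun (x : X) : X -> R^o := fun y => (x == y)%:R.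

Fact delta_finsupp x : delta_fun x \in @finsupp_pred R X.
Proof.
rewrite inE; apply: (@sub_finite_set _ _ [set x]); last exact: finite_set1.
by move=> y /=; rewrite /delta_fun; case: (eqVneq x y) => [->//|_]; rewrite eqxx.
Qed.

Definition delta (x : X) : (free_module R X : lmodType R) := Free (delta_finsupp x).

Lemma free_decomp (f : free_module R X) :
  f = \sum_(x \in [set x | coeff f x != 0]) (coeff f x : R) *: delta x.
Proof.
have fin : finite_set [set x | coeff f x != 0] by have := coeffP f; rewrite inE.
apply: val_inj; apply/funext => y /=.
have [ev Hev] : exists ev : {linear free_module R X -> (R^o : lmodType R)},
    forall c, ev c = coeff c y by apply: make_linear.
rewrite -[RHS]Hev -[LHS]Hev Hev fsbig_finite //= linear_sum /=.
have [y0|yn] := eqVneq (coeff f y) 0.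
  rewrite y0 big1_seq // => x /andP[_]; rewrite in_fset_set // inE /= => xn.
  rewrite linearZ Hev /= /delta_fun; case: (eqVneq x y) => [xy|_]; last by rewrite scaler0.
  by rewrite xy y0 eqxx in xn.
have ys : y \in fset_set [set x | coeff f x != 0] by rewrite in_fset_set // inE.
rewrite (bigD1_seq y) //=.
rewrite big1 ?addr0 => [|x xy]; rewrite linearZ Hev /= /delta_fun.
  by rewrite eqxx -[LHS]mulr1.
by rewrite (negbTE xy) scaler0.
Qed.

End Basis.

Lemma free_projective (V : lmodType R) : projective_module (free_module R V).
Proof.
move=> A B g f sg.
have [a Ha] := choice (fun x => sg (f (delta x))).
have [h Hh] := free_ext_exists a; exists h => c.
rewrite Hh /free_ext_fun [c in RHS]free_decomp.
have fin : finite_set [set x | coeff c x != 0] by have := coeffP c; rewrite inE.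
rewrite !fsbig_finite //= !linear_sum; apply: eq_bigr => x _.
by rewrite !linearZ /= Ha.
Qed.

Lemma free_cover_surj (V : lmodType R) : surj (@free_cover R V).
Proof.
move=> v; exists (delta v); rewrite /= /cover_fun /free_supp /=.
rewrite (_ : [set _ | _] = [set v]).
  by rewrite fsbig_set1 /= /delta_fun eqxx scale1r.
apply/seteqP; split=> y /=; rewrite /delta_fun; last by move=> ->; rewrite eqxx oner_eq0.
by case: (eqVneq v y) => [->//|_]; rewrite eqxx.
Qed.

End FreeModules.

Section ProjectiveModules.
Context {R : comNzRingType}.
Implicit Types U V W A B C K L M N P Q X Z : lmodType R.

Lemma projective_prod P Q : projective_module P -> projective_module Q ->
  projective_module (P * Q)%type.
Proof.
move=> pP pQ A B g f sg.
have [|i1 H1] := @make_linear R P (P * Q)%type (fun u => (u, 0%R)).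
  by move=> a x y; rewrite [RHS]surjective_pairing /= scaler0 addr0.
have [|i2 H2] := @make_linear R Q (P * Q)%type (fun u => (0%R, u)).
  by move=> a x y; rewrite [RHS]surjective_pairing /= scaler0 addr0.
have [h1 Hh1] := pP A B g (f \o i1) sg.
have [h2 Hh2] := pQ A B g (f \o i2) sg.
have [|h Hh] := @make_linear R (P * Q)%type A (fun u => h1 u.1 + h2 u.2).
  by move=> a x y; rewrite /= !linearP scalerDr addrACA.
exists h => -[u v]; rewrite Hh linearD /= Hh1 Hh2 /= H1 H2 -linearD.
by congr (f _); rewrite [LHS]surjective_pairing /= addr0 add0r.
Qed.

Lemma projective_retract P Q (i : {linear Q -> P}) (r : {linear P -> Q}) :
  cancel i r -> projective_module P -> projective_module Q.
Proof.
move=> ir pP A B g f sg; have [h Hh] := pP A B g (f \o r) sg.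
by exists (h \o i) => v; rewrite /= Hh /= ir.
Qed.

Lemma projective_zero Z : zero_module Z -> projective_module Z.
Proof.
move=> z0 A B g f sg; exists \0 => v.
by rewrite (z0 v) !linear0.
Qed.

Lemma projective_regular : @projective_module R R^o.
Proof.
move=> A B g f sg; have [a Ha] := sg (f 1).
have [|h Hh] := @make_linear R (R^o : lmodType R) A (fun r => r *: a).
  by move=> b x y; rewrite scalerDl -scalerA.
by exists h => r; rewrite Hh linearZ /= Ha -linearZ /= [_ *: 1]mulr1.
Qed.

Lemma ses_split A B C (i : {linear A -> B}) (p : {linear B -> C}) :
  ses i p -> projective_module C ->
  exists (s : {linear C -> B}) (r : {linear B -> A}),
    [/\ cancel s p, cancel i r & forall b, b = i (r b) + s (p b)].
Proof.
move=> [ii sp ex] pC.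
have [s Hs] := pC B C p (idfun : {linear C -> C}) sp.
have [|r Hr] := @factor_inj R A B B i (idfun \- (s \o p)) ii.
  by move=> b; apply/ex; rewrite linearB /= Hs subrr.
have dec b : b = i (r b) + s (p b) by rewrite Hr /= subrK.
exists s, r; split=> // a; apply: ii; rewrite Hr /=.
by have -> : p (i a) = 0 by [apply/ex; exists a]; rewrite linear0 subr0.
Qed.

End ProjectiveModules.

(** * Ext as a cokernel of a restriction map *)

Section ExtGroups.
Context {R : comNzRingType}.
Implicit Types (z : bool) (U V W A B C K L M N P Q X Z : lmodType R).

(* [small true U] says that [U] is everything, [small false U] that the
   quotient by [U] is finitely generated; both are inherited alike along
   exact sequences. *)
Definition small z V (U : set V) : Prop :=
  exists s : seq V, (z -> s = [::]) /\
    forall v, exists u, U u /\ lin_span s (v - u).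

Lemma small_trueP V (U : set V) : small true U <-> forall v, U v.
Proof.
split=> [[s [/(_ isT) -> H]] v|H].
  by have [u [Uu /span_nil/subr0_eq ->]] := H v.
by exists [::]; split=> // v; exists v; split=> //; apply/span_nil; rewrite subrr.
Qed.

(** If [i] is the inclusion of a syzygy into a projective module, the quotient of Hom(A, N) by this
    submodule is Ext^1 of the cokernel of [i]. *)
Definition restrictions A B (i : {linear A -> B}) N : set (hom A N) :=
  [set f : hom A N | exists g : {linear B -> N}, forall a, (f : {linear A -> N}) a = g (i a)].

Lemma submod_restrictions A B (i : {linear A -> B}) N :
  submod (restrictions i (N := N)).
Proof.
split; first by exists \0.
move=> c f g [f' Hf] [g' Hg]; exists (c *: (f' : hom B N) + g' : hom B N) => a.
by rewrite -[LHS]/(c *: f a + g a) Hf Hg.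
Qed.

Definition ext1_small z A B (i : {linear A -> B}) N : Prop :=
  small z (restrictions i (N := N)).

Definition syz_incl M : {linear ker (free_cover M) -> free_module R M} :=
  (val : {linear ker (free_cover M) -> free_module R M}).

(** In positive degree n, Ext^n(M, N) is presented as Ext^1 of syzygy n - 1, a cokernel, instead of
    a subquotient. *)
Definition ext_small z (n : nat) M N : Prop :=
  if n is n'.+1 then ext1_small z (syz_incl (syz M n')) N
  else small z [set f : hom M N | f = 0].

Lemma syz_ses M : ses (syz_incl M) (free_cover M).
Proof.
split; [exact: val_inj|exact: free_cover_surj|move=> b; split=> [fb|[[a pa] <-]]].
  have h : b \in ker_pred (free_cover M) by rewrite inE; apply/eqP.
  by exists (Ker h).
by have /eqP := pa.
Qed.

Lemma syzS M n : syz (ker (free_cover M) : lmodType R) n = syz M n.+1.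
Proof. by elim: n => //= n ->. Qed.

Lemma ext_small_syz z n M N :
  ext_small z n.+2 M N = ext_small z n.+1 (ker (free_cover M)) N.
Proof. by rewrite /ext_small syzS. Qed.

Lemma small_image z V W (U : set V) (T : set W) (f : {linear V -> W}) :
  small z U -> (forall w, exists v, T (w - f v)) -> (forall v, U v -> T (f v)) ->
  submod T -> small z T.
Proof.
move=> [s [sz Hs]] sf UT ST; exists (map f s); split; first by move/sz ->.
move=> w; have [v Hv] := sf w; have [u [Uu su]] := Hs v.
exists (w - f v + f u); split; first by apply: submodD => //; apply: UT.
have -> : w - (w - f v + f u) = f (v - u).
  by rewrite linearB opprD opprB addrA [w + _]addrC subrK.
exact: span_map.
Qed.

Lemma precompE A B N (i : {linear A -> B}) (g : {linear B -> N}) a :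
  (precomp N i g : {linear A -> N}) a = g (i a).
Proof. by []. Qed.

(** Comparison maps between two projective presentations induce the isomorphism on cokernels. *)
Lemma ext1_small_indep z K P K' P' M N (i : {linear K -> P}) (p : {linear P -> M})
    (i' : {linear K' -> P'}) (p' : {linear P' -> M}) :
  ses i p -> ses i' p' -> projective_module P -> projective_module P' ->
  ext1_small z i N -> ext1_small z i' N.
Proof.
move=> [ii sp ex] [ii' sp' ex'] pP pP'.
have [al Hal] := pP _ _ p' p sp'.
have [be Hbe] := pP' _ _ p p' sp.
have [|alK HalK] := @factor_inj R K' P' K i' (al \o i) ii'.
  by move=> k; apply/ex'; rewrite /= Hal; apply/ex; exists k.
have [|beK HbeK] := @factor_inj R K P K' i (be \o i') ii.
  by move=> k; apply/ex; rewrite /= Hbe; apply/ex'; exists k.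
(* The homotopy: the round trip on [P'] differs from the identity by a map into the syzygy, so a map
   on the syzygy changes only by a restriction. *)
have [|d Hd] := @factor_inj R K' P' P' i' (idfun \- (al \o be)) ii'.
  by move=> y; apply/ex'; rewrite linearB /= Hal Hbe subrr.
move=> H; apply: (small_image (f := precomp N beK) H); last exact: submod_restrictions.
  move=> f; exists (precomp N alK f); exists ((f : {linear K' -> N}) \o d) => a.
  rewrite -[LHS]/((f : {linear K' -> N}) a - (f : {linear K' -> N}) (alK (beK a))).
  rewrite -linearB; congr ((f : {linear K' -> N}) _); apply: ii'.
  by rewrite linearB /= Hd HalK /= HbeK.
move=> f [g Hg]; exists (g \o be) => a.
by rewrite precompE Hg HbeK.
Qed.

End ExtGroups.

Arguments syz_incl : simpl never.

Section DimensionShift.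
Context {R : comNzRingType}.
Implicit Types (z : bool) (U V W A B C K L M N P Q X Z : lmodType R).

Lemma inl_exists U V : exists f : {linear U -> (U * V)%type}, forall u, f u = (u, 0).
Proof.
apply: make_linear => a x y.
by rewrite [RHS]surjective_pairing /= scaler0 addr0.
Qed.

Lemma inr_exists U V : exists f : {linear V -> (U * V)%type}, forall v, f v = (0, v).
Proof.
apply: make_linear => a x y.
by rewrite [RHS]surjective_pairing /= scaler0 addr0.
Qed.

Lemma copair_exists U V W (f : {linear U -> W}) (g : {linear V -> W}) :
  exists h : {linear (U * V)%type -> W}, forall p, h p = f p.1 + g p.2.
Proof.
apply: make_linear => a x y.
by rewrite /= !linearP scalerDr addrACA.
Qed.

Lemma pullback_exists A B C (f : {linear A -> C}) (g : {linear B -> C}) :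
  exists X (u : {linear X -> A}) (v : {linear X -> B}),
    [/\ forall x, f (u x) = g (v x), forall x y, u x = u y -> v x = v y -> x = y
      & forall a b, f a = g b -> exists x, u x = a /\ v x = b].
Proof.
have [h Hh] := copair_exists f (\- g).
have [X [j [ij Hj]]] := kernel_exists h.
have [//|u Hu] := @make_linear R X A (fun x => (j x).1).
  by move=> a x y; rewrite linearP.
have [//|v Hv] := @make_linear R X B (fun x => (j x).2).
  by move=> a x y; rewrite linearP.
exists X, u, v; split.
- move=> x; rewrite Hu Hv; apply/eqP; rewrite -subr_eq0; apply/eqP.
  by have := Hh (j x); rewrite /= => <-; apply/Hj; exists x.
- move=> x y; rewrite !Hu !Hv => e1 e2; apply: ij.
  by rewrite [LHS]surjective_pairing e1 e2 -surjective_pairing.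
- move=> a b e; have /Hj[x Hx] : h (a, b) = 0 by rewrite Hh /= e subrr.
  by exists x; rewrite Hu Hv Hx.
Qed.

(** Here [X] is the sum of [K] and a projective module, so it has a projective presentation with the
    very same syzygy as [K]. *)
Lemma ses_free_prod K X Q (i : {linear K -> X}) (p : {linear X -> Q}) :
  ses i p -> projective_module Q ->
  exists (j : {linear ker (free_cover K) -> (free_module R K * Q)%type})
         (c : {linear (free_module R K * Q)%type -> X}),
    ses j c /\ forall a, j a = (syz_incl K a, 0).
Proof.
move=> si pQ; have [s [r [sp ir dec]]] := ses_split si pQ.
have pi a : p (i a) = 0 by apply: ses_comp si.
have [j0 Hj0] := inl_exists (free_module R K) Q.
have [c Hc] := copair_exists (i \o free_cover K) s.
have [iK sK eK] := syz_ses K.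
exists (j0 \o syz_incl K), c; split; last by move=> a; rewrite /= Hj0.
split.
- by move=> a b; rewrite /= !Hj0 => -[/iK].
- move=> x; have [k Hk] := sK (r x).
  by exists (k, p x); rewrite Hc /= Hk -dec.
- move=> [k q]; rewrite Hc /=; split=> [e|[a /=]].
    have q0 : q = 0 by have := congr1 p e; rewrite linearD pi sp linear0 add0r.
    move: e; rewrite q0 linear0 addr0 => /(congr1 r); rewrite ir linear0.
    by move=> /eK[a Ha]; exists a; rewrite -Ha; apply: Hj0.
  rewrite Hj0 => -[<- <-].
  by rewrite linear0 addr0 (ses_comp _ (syz_ses K)) linear0.
Qed.

(** [X] is the pullback of the two surjections; its projections have the two syzygies as kernels. *)
Lemma schanuel K P K' P' M (i : {linear K -> P}) (p : {linear P -> M})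
    (i' : {linear K' -> P'}) (p' : {linear P' -> M}) : ses i p -> ses i' p' ->
  exists X (k : {linear K -> X}) (v : {linear X -> P'})
    (k' : {linear K' -> X}) (u : {linear X -> P}), ses k v /\ ses k' u.
Proof.
move=> si si'; have [ii sp ex] := si; have [ii' sp' ex'] := si'.
have [X [u [v [uv inj_uv fill]]]] := pullback_exists p p'.
have pi a : p (i a) = 0 by apply: ses_comp si.
have pi' a : p' (i' a) = 0 by apply: ses_comp si'.
have [k Hk] : exists k : {linear K -> X}, forall a, u (k a) = i a /\ v (k a) = 0.
  have [k Hk] := choice (fun a => fill (i a) 0 (etrans (pi a) (esym (linear0 p')))).
  have [|k0 Hk0] := @make_linear R K X k; last by exists k0 => a; rewrite Hk0.
  move=> c x y; apply: inj_uv; rewrite linearP.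
    by rewrite !(Hk _).1 linearP.
  by rewrite !(Hk _).2 scaler0 addr0.
have [k' Hk'] : exists k : {linear K' -> X}, forall a, u (k a) = 0 /\ v (k a) = i' a.
  have [k' Hk'] := choice (fun a => fill 0 (i' a) (etrans (linear0 p) (esym (pi' a)))).
  have [|k0 Hk0] := @make_linear R K' X k'; last by exists k0 => a; rewrite Hk0.
  move=> c x y; apply: inj_uv; rewrite linearP.
    by rewrite !(Hk' _).1 scaler0 addr0.
  by rewrite !(Hk' _).2 linearP.
exists X, k, v, k', u; split; split.
- by move=> a b e; apply: ii; rewrite -!(Hk _).1 e.
- move=> b; have [a Ha] := sp (p' b); have [x [_ <-]] := fill _ _ Ha; by exists x.
- move=> x; split=> [vx|[a <-]]; last exact: (Hk a).2.
  have /ex[a Ha] : p (u x) = 0 by rewrite uv vx linear0.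
  by exists a; apply: inj_uv; [rewrite (Hk a).1|rewrite (Hk a).2].
- by move=> a b e; apply: ii'; rewrite -!(Hk' _).2 e.
- move=> b; have [a Ha] := sp' (p b); have [x [<- _]] := fill _ _ (esym Ha); by exists x.
- move=> x; split=> [ux|[a <-]]; last exact: (Hk' a).1.
  have /ex'[a Ha] : p' (v x) = 0 by rewrite -uv ux linear0.
  by exists a; apply: inj_uv; [rewrite (Hk' a).1|rewrite (Hk' a).2].
Qed.

(** By Schanuel's lemma the first statement follows from the second in the same degree. The second,
    in the next degree, reduces to the first in the current degree for two presentations of [X]. *)
Lemma ext_small_schanuel z N n :
  (forall M K P K' P' (i : {linear K -> P}) (p : {linear P -> M})
      (i' : {linear K' -> P'}) (p' : {linear P' -> M}),
     ses i p -> ses i' p' -> projective_module P -> projective_module P' ->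
     ext_small z n.+1 K N -> ext_small z n.+1 K' N) /\
  (forall K X Q (i : {linear K -> X}) (p : {linear X -> Q}),
     ses i p -> projective_module Q ->
     (ext_small z n.+1 K N <-> ext_small z n.+1 X N)).
Proof.
suff H : forall K X Q (i : {linear K -> X}) (p : {linear X -> Q}),
     ses i p -> projective_module Q ->
     (ext_small z n.+1 K N <-> ext_small z n.+1 X N).
  split=> // M K P K' P' i p i' p' si si' pP pP' eK.
  have [X [k [v [k' [u [s1 s2]]]]]] := schanuel si si'.
  by apply/(H _ _ _ _ _ s2 pP); apply/(H _ _ _ _ _ s1 pP').
elim: n => [|n IH] K X Q i p si pQ; have [j [c [sj Hj]]] := ses_free_prod si pQ;
  have pX := projective_prod (free_projective (V := K)) pQ;
  have fX := free_projective (V := X).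
  have e : ext1_small z (syz_incl K) N = ext1_small z j N.
    congr (small z _); apply/seteqP; split=> f [g Hg].
      have [g' Hg'] := copair_exists g (\0 : {linear Q -> N}).
      by exists g' => a; rewrite Hg' Hj /= Hg addr0.
    have [l Hl] := inl_exists (free_module R K) Q.
    by exists (g \o l) => a; rewrite /= Hg Hj Hl.
  rewrite /ext_small /= e; split=> H.
    exact: (ext1_small_indep sj (syz_ses X) pX fX H).
  exact: (ext1_small_indep (syz_ses X) sj fX pX H).
have IHP A M B A' B' (a : {linear A -> B}) (b : {linear B -> M})
    (a' : {linear A' -> B'}) (b' : {linear B' -> M}) :
    ses a b -> ses a' b' -> projective_module B -> projective_module B' ->
    ext_small z n.+1 A N -> ext_small z n.+1 A' N.
  move=> sa sa' pB pB' eA.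
  have [Y [k [v [k' [u [s1 s2]]]]]] := schanuel sa sa'.
  by apply/(IH _ _ _ _ _ s2 pB); apply/(IH _ _ _ _ _ s1 pB').
rewrite !ext_small_syz; split.
  exact: IHP sj (syz_ses X) pX fX.
exact: IHP (syz_ses X) sj fX pX.
Qed.

Lemma ext_small1 z K P M N (i : {linear K -> P}) (p : {linear P -> M}) :
  ses i p -> projective_module P -> ext_small z 1 M N <-> ext1_small z i N.
Proof.
move=> si pP; have fM := free_projective (V := M); split=> H.
  exact: (ext1_small_indep (syz_ses M) si fM pP H).
exact: (ext1_small_indep si (syz_ses M) pP fM H).
Qed.

Lemma ext_small_shift z n K P M N (i : {linear K -> P}) (p : {linear P -> M}) :
  ses i p -> projective_module P ->
  ext_small z n.+2 M N <-> ext_small z n.+1 K N.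
Proof.
move=> si pP; have fM := free_projective (V := M); rewrite ext_small_syz.
have [H _] := ext_small_schanuel z N n.
by split; [apply: H (syz_ses M) si fM pP|apply: H si (syz_ses M) pP fM].
Qed.

Definition ext_zero n M N : Prop := ext_small true n M N.

Lemma ext_zero0 M N : ext_zero 0 M N <-> forall f : {linear M -> N}, forall a, f a = 0.
Proof.
rewrite /ext_zero /= small_trueP; split=> H f; last exact/homP/H.
by move=> a; have := H f => /= ->.
Qed.

Lemma ext_zero1 K P M N (i : {linear K -> P}) (p : {linear P -> M}) :
  ses i p -> projective_module P ->
  ext_zero 1 M N <->
  forall f : {linear K -> N}, exists g : {linear P -> N}, forall a, f a = g (i a).
Proof.
move=> si pP; rewrite /ext_zero (ext_small1 true N si pP) /ext1_small small_trueP.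
by split=> H f; apply: H.
Qed.

Lemma ext_zero_projective n P N : projective_module P -> ext_zero n.+1 P N.
Proof.
elim: n P => [|n IH] P pP.
  have [s [r [_ ir dec]]] := ses_split (syz_ses P) pP.
  apply/(ext_zero1 N (syz_ses P) (free_projective (V := P))) => f.
  by exists (f \o r) => a; rewrite /= ir.
apply/(ext_small_shift true n N (syz_ses P) (free_projective (V := P))).
have [s [r [_ ir dec]]] := ses_split (syz_ses P) pP.
by apply: IH; apply: projective_retract ir (free_projective (V := P)).
Qed.

End DimensionShift.

(** * Exact sequences in the first variable *)

Section LongExactFirst.
Context {R : comNzRingType}.
Implicit Types (z : bool) (U V W A B C K L M N P Q X Z : lmodType R).

(* A surjection from a projective [P] onto [B], composed with [p], gives
   syzygies [K] of [B] and [K'] of [C] with [0 -> K -> K' -> A -> 0] exact, so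
   the long exact sequence can be climbed by rotating. *)
Lemma ses_rotate A B C (i : {linear A -> B}) (p : {linear B -> C}) : ses i p ->
  exists P K K' (kB : {linear K -> P}) (c : {linear P -> B})
    (kC : {linear K' -> P}) (j : {linear K -> K'}) (r : {linear K' -> A}),
  [/\ projective_module P, ses kB c, ses kC (p \o c), ses j r &
      (forall a, kC (j a) = kB a) /\ forall x, i (r x) = c (kC x)].
Proof.
move=> si; have [ii sp ex] := si.
have sc := free_cover_surj (V := B).
have spc : surj (p \o free_cover B).
  by move=> x; have [b <-] := sp x; have [a <-] := sc b; exists a.
have [K' [kC s1]] := ses_of_surj spc.
have [kCi _ kCe] := s1.
have [kBi _ kBe] := syz_ses B.
have [|j Hj] := @factor_inj R K' _ _ kC (syz_incl B) kCi.
  by move=> a; apply/kCe; rewrite /= (ses_comp _ (syz_ses B)) linear0.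
have [|r Hr] := @factor_inj R A B K' i (free_cover B \o kC) ii.
  by move=> x; apply/ex; apply: (ses_comp x s1).
exists (free_module R B), (ker (free_cover B)), K', (syz_incl B), (free_cover B), kC, j, r.
split=> //; [exact: free_projective|split].
- by move=> a b e; apply: kBi; rewrite -!Hj e.
- move=> a; have [b Hb] := sc (i a).
  have /kCe[x Hx] : (p \o free_cover B) b = 0 by rewrite /= Hb (ses_comp _ si).
  by exists x; apply: ii; rewrite Hr /= Hx.
- move=> x; split=> [rx|[a <-]].
    have /kBe[a Ha] : free_cover B (kC x) = 0.
      by have := Hr x; rewrite rx linear0.
    by exists a; apply: kCi; rewrite Hj.
  by apply: ii; rewrite Hr /= Hj linear0 (ses_comp _ (syz_ses B)).
Qed.

(** Transport [f] to the syzygy of [C], extend it to the projective module; the extension kills the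
    syzygy of [B], so it descends to [B]. *)
Lemma ext_extend A B C (i : {linear A -> B}) (p : {linear B -> C}) N :
  ses i p -> ext_zero 1 C N ->
  forall f : {linear A -> N}, exists g : {linear B -> N}, forall a, f a = g (i a).
Proof.
move=> si VC f.
have [P [K [K' [kB [c [kC [j [r [pP sB sC sj [kj ir]]]]]]]]]] := ses_rotate si.
have [g Hg] := (ext_zero1 N sC pP).1 VC (f \o r).
have [_ sc ec] := sB; have [_ sr _] := sj.
have [|g' Hg'] := factor_surj (f := g) sc.
  move=> _ /ec[b <-].
  by rewrite -kj -Hg /= (ses_comp _ sj) linear0.
exists g' => a; have [x <-] := sr a.
by rewrite ir Hg' -Hg.
Qed.

Lemma ext_first_mid0 A B C (i : {linear A -> B}) (p : {linear B -> C}) N :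
  ses i p -> ext_zero 0 A N -> ext_zero 0 C N -> ext_zero 0 B N.
Proof.
move=> [_ sp ex] /ext_zero0 VA /ext_zero0 VC; apply/ext_zero0 => f b.
have [|g Hg] := factor_surj (f := f) sp.
  by move=> _ /ex[a <-]; rewrite -[LHS]/((f \o i) a) VA.
by rewrite -Hg VC.
Qed.

Lemma ext_first_left0 A B C (i : {linear A -> B}) (p : {linear B -> C}) N :
  ses i p -> ext_zero 0 B N -> ext_zero 1 C N -> ext_zero 0 A N.
Proof.
move=> si /ext_zero0 VB VC; apply/ext_zero0 => f a.
by have [g ->] := ext_extend si VC f; rewrite VB.
Qed.

Lemma ext_first_right0 A B C (i : {linear A -> B}) (p : {linear B -> C}) N :
  ses i p -> ext_zero 0 A N -> ext_zero 1 B N -> ext_zero 1 C N.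
Proof.
move=> si /ext_zero0 VA VB.
have [P [K [K' [kB [c [kC [j [r [pP sB sC sj [kj ir]]]]]]]]]] := ses_rotate si.
apply/(ext_zero1 N sC pP) => f.
have [g Hg] := (ext_zero1 N sB pP).1 VB (f \o j).
have [_ sr er] := sj.
have [|h Hh] := factor_surj (f := f \- (g \o kC)) sr.
  by move=> _ /er[b <-]; rewrite /= kj -Hg subrr.
exists g => a; apply/eqP; rewrite -subr_eq0; apply/eqP.
by rewrite -[LHS]/((f \- (g \o kC)) a) -Hh VA.
Qed.

Lemma ext_first_mid1 A B C (i : {linear A -> B}) (p : {linear B -> C}) N :
  ses i p -> ext_zero 1 A N -> ext_zero 1 C N -> ext_zero 1 B N.
Proof.
move=> si VA VC.
have [P [K [K' [kB [c [kC [j [r [pP sB sC sj [kj ir]]]]]]]]]] := ses_rotate si.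
apply/(ext_zero1 N sB pP) => f.
have [g Hg] := ext_extend sj VA f.
have [h Hh] := (ext_zero1 N sC pP).1 VC g.
by exists h => a; rewrite Hg Hh kj.
Qed.

(** Two rotations are needed: dimension shifting turns the vanishing for [C] in degree 2 into one
    for its syzygy in degree 1, which is the middle term of the first rotated sequence. *)
Lemma ext_first_left1 A B C (i : {linear A -> B}) (p : {linear B -> C}) N :
  ses i p -> ext_zero 1 B N -> ext_zero 2 C N -> ext_zero 1 A N.
Proof.
move=> si VB VC.
have [P [K [K' [kB [c [kC [j [r [pP sB sC sj [kj ir]]]]]]]]]] := ses_rotate si.
have {}VC : ext_zero 1 K' N by apply/(ext_small_shift true 0 N sC pP).
have [P2 [K2 [K3 [kB2 [c2 [kC2 [j2 [r2 [pP2 sB2 sC2 sj2 [kj2 ir2]]]]]]]]]] := ses_rotate sj.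
apply/(ext_zero1 N sC2 pP2) => f.
have [g Hg] := (ext_zero1 N sB2 pP2).1 VC (f \o j2).
have [_ sr er] := sj2.
have [|h Hh] := factor_surj (f := f \- (g \o kC2)) sr.
  by move=> _ /er[b <-]; rewrite /= kj2 -Hg subrr.
have [h' Hh'] := (ext_zero1 N sB pP).1 VB h.
exists (g \+ (h' \o kC \o c2)) => a /=.
by rewrite -ir2 kj -Hh' Hh /= addrC subrK.
Qed.

(** Rotation moves each of the three exactness statements to another one: [right] follows from [mid]
    one degree lower in the second index, [mid] in the next degree from [left], and [left] in the
    next degree from [right]. *)
Lemma ext_first N n :
  [/\ forall A B C (i : {linear A -> B}) (p : {linear B -> C}), ses i p ->
        ext_zero n A N -> ext_zero n C N -> ext_zero n B N,
      forall A B C (i : {linear A -> B}) (p : {linear B -> C}), ses i p ->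
        ext_zero n B N -> ext_zero n.+1 C N -> ext_zero n A N &
      forall A B C (i : {linear A -> B}) (p : {linear B -> C}), ses i p ->
        ext_zero n A N -> ext_zero n.+1 B N -> ext_zero n.+1 C N].
Proof.
have right k : (forall A B C (i : {linear A -> B}) (p : {linear B -> C}), ses i p ->
        ext_zero k.+1 A N -> ext_zero k.+1 C N -> ext_zero k.+1 B N) ->
      forall A B C (i : {linear A -> B}) (p : {linear B -> C}), ses i p ->
        ext_zero k.+1 A N -> ext_zero k.+2 B N -> ext_zero k.+2 C N.
  move=> mid A B C i p si VA VB.
  have [P [K [K' [kB [c [kC [j [r [pP sB sC sj _]]]]]]]]] := ses_rotate si.
  apply/(ext_small_shift true k N sC pP); apply: (mid _ _ _ _ _ sj) => //.
  exact/(ext_small_shift true k N sB pP).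
suff main k : [/\ forall A B C (i : {linear A -> B}) (p : {linear B -> C}), ses i p ->
        ext_zero k.+1 A N -> ext_zero k.+1 C N -> ext_zero k.+1 B N &
      forall A B C (i : {linear A -> B}) (p : {linear B -> C}), ses i p ->
        ext_zero k.+1 B N -> ext_zero k.+2 C N -> ext_zero k.+1 A N].
  case: n => [|n]; last first.
    by have [mid left] := main n; split=> //; apply: right.
  split=> A B C i p si.
  - exact: ext_first_mid0 si.
  - exact: ext_first_left0 si.
  - exact: ext_first_right0 si.
elim: k => [|k [mid left]].
  by split=> A B C i p si; [exact: ext_first_mid1 si|exact: ext_first_left1 si].
have rk := right k mid.
split=> A B C i p si V1 V2;
  have [P [K [K' [kB [c [kC [j [r [pP sB sC sj _]]]]]]]]] := ses_rotate si.
  apply/(ext_small_shift true k N sB pP); apply: (left _ _ _ _ _ sj) => //.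
  exact/(ext_small_shift true k N sC pP).
apply: (rk _ _ _ _ _ sj).
  exact/(ext_small_shift true k N sB pP).
exact/(ext_small_shift true k.+1 N sC pP).
Qed.

Section Corollaries.
Context A B C (i : {linear A -> B}) (p : {linear B -> C}) (N : lmodType R).
Context (si : ses i p) (n : nat).

Lemma ext_first_mid : ext_zero n A N -> ext_zero n C N -> ext_zero n B N.
Proof. by have [H _ _] := ext_first N n; apply: H si. Qed.

Lemma ext_first_left : ext_zero n B N -> ext_zero n.+1 C N -> ext_zero n A N.
Proof. by have [_ H _] := ext_first N n; apply: H si. Qed.

Lemma ext_first_right : ext_zero n A N -> ext_zero n.+1 B N -> ext_zero n.+1 C N.
Proof. by have [_ _ H] := ext_first N n; apply: H si. Qed.

End Corollaries.

Lemma ext_zero_dom n Z N : zero_module Z -> ext_zero n Z N.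
Proof.
move=> z0; case: n => [|n]; last by apply: ext_zero_projective; apply: projective_zero.
by apply/ext_zero0 => f a; rewrite (z0 a) linear0.
Qed.

Lemma ses_iso A B (i : {linear A -> B}) : bijective i ->
  exists Z (p : {linear B -> Z}), ses i p /\ zero_module Z.
Proof.
move=> [j ij ji]; have [Z [p [sp Hp]]] := quotient_exists (submod_setT B).
exists Z, p; split; last by move=> z; have [b <-] := sp z; apply/Hp.
split=> //; first exact: can_inj ij.
by move=> b; rewrite Hp; split=> // _; exists (j b).
Qed.

Lemma ext_zero_iso_dom n A B (i : {linear A -> B}) N : bijective i ->
  ext_zero n A N <-> ext_zero n B N.
Proof.
move=> /ses_iso[Z [p [si z0]]]; split=> V.
  by apply: (ext_first_mid si V); apply: ext_zero_dom.
by apply: (ext_first_left si V); apply: ext_zero_dom.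
Qed.

End LongExactFirst.

(** * Exact sequences in the second variable *)

Section LongExactSecond.
Context {R : comNzRingType} (noethR : noetherian R).
Implicit Types (z : bool) (U V W A B C K L M N P Q X Z : lmodType R).

Lemma small_in z V (G U : set V) (s : seq V) : submod G -> submod U ->
  (z -> s = [::]) -> (forall g, G g -> exists u, U u /\ lin_span s (g - u)) ->
  exists t : seq V, [/\ z -> t = [::], forall x, x \in t -> G x &
    forall g, G g -> exists u, U u /\ lin_span t (g - u)].
Proof.
case: z => SG SU sz Hs.
  exists s; split=> //; by rewrite (sz isT).
by have [t [tG Ht]] := relative_fg noethR SG SU Hs; exists t.
Qed.

Lemma lift_seq U V (f : U -> V) (t : seq V) :
  (forall x, x \in t -> exists u, f u = x) -> exists t' : seq U, t = map f t'.
Proof.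
elim: t => [|x t IH] H; first by exists [::].
have [|t' ->] := IH; first by move=> y yt; apply: H; rewrite inE yt orbT.
have [|u <-] := H x; first by rewrite inE eqxx.
by exists (u :: t').
Qed.

Lemma span_map_lift U V (f : {linear U -> V}) s v :
  lin_span (map f s) v -> exists u, lin_span s u /\ f u = v.
Proof.
move=> [c ->]; exists (\sum_(i < size s) c i *: s`_i); split; first by exists c.
rewrite linear_sum size_map; apply: eq_bigr => i _.
by rewrite linearZ /= (nth_map 0).
Qed.

(** Smallness passes to extensions: one part is the image of [f] modulo [T], the other the preimage
    of [T] modulo [U]. *)
Lemma small_ext z V W (U : set V) (T : set W) (f : {linear V -> W}) (s0 : seq V) :
  submod U -> submod T -> small z T -> (z -> s0 = [::]) ->
  (forall v, T (f v) -> exists u, U u /\ lin_span s0 (v - u)) -> small z U.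
Proof.
move=> SU ST [s [sz Hs]] s0z H.
have [|t [tz tG Ht]] := small_in (submod_im f) ST sz (s := s).
  by move=> g _; apply: Hs.
have [|t' et] := @lift_seq V W f t; first by move=> x /tG[u _ <-]; exists u.
exists (t' ++ s0); split.
  by move=> zt; rewrite s0z // cats0; case: t' et => //; rewrite tz.
move=> v; have [|w [Tw]] := Ht (f v); first by exists v.
rewrite et => /span_map_lift[x [sx ex]].
have [|u [Uu su]] := H (v - x); first by rewrite linearB ex subKr.
exists u; split=> //; rewrite -(subrK x v) addrAC; apply: submodD.
- exact: submod_span.
- exact: span_catr.
- exact: span_catl.
Qed.

Lemma postcomp_exists K B C (p : {linear B -> C}) :
  exists P : {linear hom K B -> hom K C},
    forall (f : {linear K -> B}) a, (P f : {linear K -> C}) a = p (f a).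
Proof.
have [|P HP] := @make_linear R (hom K B) (hom K C) (fun f => p \o (f : {linear K -> B})).
  by move=> c f g; apply: homP => a /=; rewrite -[LHS]/(p (c *: f a + g a)) linearP.
by exists P => f a; rewrite HP.
Qed.

(** The maps on the n-th syzygy that represent zero in Ext^n(M, N). *)
Definition ext_bd n M N : set (hom (syz M n) N) :=
  if n is n'.+1 then restrictions (syz_incl (syz M n')) (N := N)
  else [set f : hom M N | f = 0].

Arguments ext_bd : clear implicits.

Lemma ext_smallE z n M N : ext_small z n M N = small z (ext_bd n M N).
Proof. by case: n. Qed.

Lemma ext_zeroP n M N :
  ext_zero n M N <-> forall f : {linear syz M n -> N}, ext_bd n M N f.
Proof. by rewrite /ext_zero ext_smallE small_trueP. Qed.

Lemma submod_ext_bd n M N : submod (ext_bd n M N).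
Proof.
case: n => [|n]; [exact: (submod_zero (hom M N))|exact: submod_restrictions].
Qed.

Lemma ext_bd_comp n M B C (p : {linear B -> C}) (f : {linear syz M n -> B}) :
  ext_bd n M B f -> ext_bd n M C (p \o f).
Proof.
case: n f => [|n] f /=; first by move=> f0; apply: homP => a; rewrite /= f0 linear0.
by move=> [g Hg]; exists (p \o g) => a; rewrite /= Hg.
Qed.

Lemma ext_bd_eq n M N (f g : {linear syz M n -> N}) :
  (forall a, f a = g a) -> ext_bd n M N f -> ext_bd n M N g.
Proof. by move=> e; have -> : f = g :> hom _ _ by apply: homP. Qed.

Lemma ext_bd_lift n M B C (p : {linear B -> C}) (f : {linear syz M n -> C}) :
  surj p -> ext_bd n M C f ->
  exists g : {linear syz M n -> B}, ext_bd n M B g /\ forall a, p (g a) = f a.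
Proof.
case: n f => [|n] f sp /=.
  by move=> f0; exists \0; split=> [|a]; [exact: homP|rewrite f0 linear0].
move=> [g Hg]; have [h Hh] := free_projective g sp.
by exists (h \o syz_incl (syz M n)); split=> [|a]; [exists h|rewrite /= Hh Hg].
Qed.

Section Sequence.
Context A B C (i : {linear A -> B}) (p : {linear B -> C}) (si : ses i p).

Lemma ses_factor K (f : {linear K -> B}) : (forall a, p (f a) = 0) ->
  exists g : {linear K -> A}, forall a, i (g a) = f a.
Proof. by have [ii _ ex] := si; move=> H; apply: factor_inj => // a; apply/ex. Qed.

Lemma ext_second_mid z n M :
  ext_small z n M A -> ext_small z n M C -> ext_small z n M B.
Proof.
rewrite !ext_smallE => -[s [sz Hs]] sC.
have [ii sp ex] := si.
have [Pi HPi] := postcomp_exists (syz M n) i.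
have [Pp HPp] := postcomp_exists (syz M n) p.
apply: (@small_ext _ _ _ _ _ Pp (map Pi s) (@submod_ext_bd _ _ _)
   (@submod_ext_bd _ _ _) sC); first by move/sz ->.
move=> f bf; have [g [bg Hg]] := ext_bd_lift sp bf.
have [|h Hh] := @ses_factor _ ((f : {linear _ -> _}) \- g).
  by move=> a; rewrite /= linearB Hg HPp subrr.
have [u [bu su]] := Hs h.
exists ((g : hom _ _) + Pi u); split.
  apply: submodD => //; first exact: submod_ext_bd.
  apply: ext_bd_eq (ext_bd_comp i bu) => a; exact/esym/HPi.
have -> : f - ((g : hom _ _) + Pi u) = Pi ((h : hom _ _) - u); last exact: span_map.
rewrite opprD addrA linearB; congr (_ - _); apply: homP => a.
by rewrite HPi Hh.
Qed.

(** The obstruction to lifting a map from the n-th syzygy of [M] to [C] along [p] lies in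
    Ext^(n+1)(M, A); if that is zero or finitely generated, all maps lift, respectively all lift up
    to finitely many. *)
Lemma ext_lift z n M : ext_small z n.+1 M A ->
  exists s : seq (hom (syz M n) C), (z -> s = [::]) /\
    forall f : {linear syz M n -> C}, exists (g : {linear syz M n -> B}) (h : hom (syz M n) C),
      lin_span s h /\ forall a, f a = (h : {linear _ -> _}) a + p (g a).
Proof.
move=> [s [sz Hs]]; have [ii sp ex] := si.
set K := syz M n in s sz Hs *.
(* The classes that die in Ext^(n+1)(M, B), which are the image of the connecting map. Generators
   must be chosen inside [G], as only these come from maps into [C]. *)
pose G : set (hom (syz M n.+1) A) := [set a : hom (syz M n.+1) A |
  exists e : {linear free_module R K -> B}, forall w, e (syz_incl K w) = i ((a : {linear _ -> _}) w)].
have SG : submod G.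
  split; first by exists \0 => w; rewrite /= linear0.
  move=> c x y [e He] [e' He']; exists (c *: (e : hom _ _) + e' : hom _ _) => w.
  rewrite -[LHS]/(c *: e (syz_incl K w) + e' (syz_incl K w)) He He' -linearP.
  by [].
have [|t [tz tG Ht]] := small_in SG (submod_restrictions (syz_incl K) A) sz (s := s).
  by move=> g _; apply: Hs.
have [s' [s'z Hs']] : exists s' : seq (hom K C), (z -> s' = [::]) /\
    forall x, lin_span t x -> exists (h : hom K C) (e : {linear free_module R K -> B}),
      [/\ lin_span s' h, forall w, e (syz_incl K w) = i ((x : {linear _ -> _}) w) &
        forall c, (h : {linear _ -> _}) (free_cover K c) = p (e c)].
  elim: t tz tG {Ht} => [|b t IH] tz tG.
    exists [::]; split=> // x /span_nil ->; exists 0, \0; split.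
    - exact/span_nil.
    - by move=> w; rewrite /= linear0.
    - by move=> c; rewrite /= linear0.
  have [||s' [_ Hs']] := IH; first by move/tz.
    by move=> x xt; apply: tG; rewrite inE xt orbT.
  have [|e He] := tG b; first by rewrite inE eqxx.
  have [_ sc ec] := syz_ses K.
  have [|h Hh] := factor_surj (f := p \o e) sc.
    by move=> _ /ec[w <-]; rewrite /= He (ses_comp _ si).
  exists ((h : hom K C) :: s'); split; first by move/tz.
  move=> x /span_cons[c [w [/Hs'[h' [e' [sh' He' Hh']]] ->]]].
  exists (c *: (h : hom K C) + h'), (c *: (e : hom _ _) + e' : hom _ _); split.
  - by apply/span_cons; exists c, h'.
  - move=> a; rewrite -[LHS]/(c *: e (syz_incl K a) + e' (syz_incl K a)) He He'.
    exact/esym/(linearP i).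
  - move=> a; rewrite -[LHS]/(c *: h (free_cover K a) + (h' : {linear _ -> _}) (free_cover K a)).
    by rewrite Hh Hh'; exact/esym/(linearP p).
exists s'; split=> // f.
have [_ sc ec] := syz_ses K.
have [e He] := free_projective (f \o free_cover K) sp.
have [|a Ha] := @ses_factor _ (e \o syz_incl K).
  by move=> w; rewrite /= He /= (ses_comp _ (syz_ses K)) linear0.
have [|u [[e' He'] su]] := Ht a; first by exists e => w; rewrite Ha.
have [h [e'' [sh He'' Hh]]] := Hs' _ su.
have [|g Hg] := factor_surj (f := (e \- e'') \- (i \o e')) sc.
  move=> _ /ec[w <-]; rewrite /= He''.
  rewrite -[(a - u : hom _ _) w]/(a w - (u : {linear _ -> _}) w) He' linearB Ha /= opprB.
  by rewrite addrCA subrr addr0 subrr.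
exists g, h; split=> // x; have [c <-] := sc x.
by rewrite Hh Hg /= !linearB /= (ses_comp _ si) subr0 He /= addrC subrK.
Qed.

Lemma ext_second_right z n M :
  ext_zero n M B -> ext_small z n.+1 M A -> ext_small z n M C.
Proof.
move=> /ext_zeroP VB /ext_lift[s [sz Hs]]; rewrite ext_smallE.
exists s; split=> // f; have [g [h [sh Hf]]] := Hs f.
pose pg : {linear syz M n -> C} := p \o g.
exists (pg : hom _ _); split; first exact: ext_bd_comp.
have -> : f - (pg : hom _ _) = h => //; apply: homP => a.
by rewrite -[LHS]/((f : {linear _ -> _}) a - p (g a)) Hf addrK.
Qed.

Lemma ext_zero_lift n M : ext_zero n.+1 M A ->
  forall f : {linear syz M n -> C}, exists g : {linear syz M n -> B}, forall a, p (g a) = f a.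
Proof.
move=> /ext_lift[s [/(_ isT) -> Hs]] f; have [g [h [/span_nil -> Hf]]] := Hs f.
by exists g => a; rewrite Hf add0r.
Qed.

(** Injectivity of Ext^(n+1)(M, A) -> Ext^(n+1)(M, B) when Ext^n(M, C) = 0. *)
Lemma ext_bd_reflect n M (f : {linear syz M n.+1 -> A}) :
  ext_zero n M C -> ext_bd n.+1 M B (i \o f) -> ext_bd n.+1 M A f.
Proof.
move=> /ext_zeroP VC [e He]; have [ii sp ex] := si.
have [_ sc ec] := syz_ses (syz M n).
have [|c Hc] := factor_surj (f := p \o e) sc.
  by move=> _ /ec[w <-]; rewrite /= -He /= (ses_comp _ si).
have [c' [_ Hc']] := ext_bd_lift sp (VC c).
have [|g Hg] := @ses_factor _ (e \- (c' \o free_cover (syz M n))).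
  by move=> x; rewrite /= linearB Hc' Hc subrr.
exists g => w; apply: ii; rewrite Hg /= -He /=.
by rewrite (ses_comp _ (syz_ses _)) linear0 subr0.
Qed.

Lemma ext_second_left n M :
  ext_zero n M C -> ext_zero n.+1 M B -> ext_zero n.+1 M A.
Proof.
move=> VC /ext_zeroP VB; apply/ext_zeroP => f.
by apply: ext_bd_reflect.
Qed.

Lemma ext_zero_second_mid n M :
  ext_zero n M A -> ext_zero n M C -> ext_zero n M B.
Proof. exact: ext_second_mid. Qed.

Lemma ext_zero_second_right n M :
  ext_zero n M B -> ext_zero n.+1 M A -> ext_zero n M C.
Proof. exact: ext_second_right. Qed.

End Sequence.

Lemma ext_zero_cod n M Z : zero_module Z -> ext_zero n M Z.
Proof.
move=> z0; apply/ext_zeroP => f.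
have -> : f = 0 :> hom _ _ by apply: homP => a; rewrite (z0 (f a)).
by case: (submod_ext_bd n M Z).
Qed.

Lemma small_of_true z V (U : set V) : small true U -> small z U.
Proof. by move=> [s [/(_ isT) -> Hs]]; exists [::]; split. Qed.

Lemma ext_small_of_zero z n M N : ext_zero n M N -> ext_small z n M N.
Proof. by rewrite /ext_zero !ext_smallE; apply: small_of_true. Qed.

Lemma ext_small_iso_cod z n M A B (i : {linear A -> B}) : bijective i ->
  ext_small z n M A -> ext_small z n M B.
Proof.
move=> /ses_iso[Z [p [si z0]]] sA; apply: (ext_second_mid si sA).
by apply: ext_small_of_zero; apply: ext_zero_cod.
Qed.

End LongExactSecond.

Arguments ext_bd {R} n M N.

(** * Finite generation of Ext, and agreement with its definition *)

Section FinitenessExt.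
Context {R : comNzRingType} (noethR : noetherian R).
Implicit Types (z : bool) (U V W A B C K L M N P Q X Z : lmodType R).

Definition dual_basis P : Prop :=
  exists n (x : nat -> P) (phi : nat -> {linear P -> R^o}),
    forall v, v = \sum_(i < n) phi i v *: x i.

Lemma dual_basis_retract P Q (i : {linear Q -> P}) (r : {linear P -> Q}) :
  cancel i r -> dual_basis P -> dual_basis Q.
Proof.
move=> ir [n [x [phi H]]]; exists n, (r \o x), (fun j => phi j \o i) => v.
rewrite -{1}(ir v) (H (i v)) linear_sum; apply: eq_bigr => j _.
by rewrite linearZ.
Qed.

(** The standard cover is free on the whole underlying set, so a finite free cover is built by
    adding one copy of R per generator. The other properties are proved along the same induction. *)
Lemma fg_free_cover L : fg L -> exists P (p : {linear P -> L}),
  [/\ fg P, projective_module P, surj p, dual_basis P &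
      forall N, fg N -> fg (hom P N)].
Proof.
move=> /fgP[s Hs].
suff [P [p [fP pP sp dP hP]]] : exists P (p : {linear P -> L}),
  [/\ fg P, projective_module P, forall v, lin_span s v -> exists u, p u = v,
      dual_basis P & forall N, fg N -> fg (hom P N)].
  by exists P, p; split=> // v; apply: sp.
elim: s {Hs} => [|v s [P [p [fP pP sp [n [x [phi Hphi]]] hP]]]].
  have [Z [j [ij Hj]]] := submodule_exists (submod_zero L).
  have z0 : zero_module Z.
    by move=> a; apply: ij; rewrite linear0; apply/(Hj (j a)); exists a.
  exists Z, j; split.
  - exact: fg_zero.
  - exact: projective_zero.
  - by move=> v /span_nil ->; exists 0; rewrite linear0.
  - exists 0%N, (fun=> 0), (fun=> \0) => u; rewrite big_ord0; exact: z0.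
  - move=> N _; apply: fg_zero => f; apply: homP => a.
    by rewrite (z0 a) linear0.
have [f Hf] := scale_map v.
have [q Hq] := copair_exists f p.
have [l Hl] := inl_exists (R^o : lmodType R) P.
have [r Hr] := inr_exists (R^o : lmodType R) P.
have [//|pr1 Hpr1] := @make_linear R ((R^o : lmodType R) * P)%type (R^o : lmodType R) fst.
have [//|pr2 Hpr2] := @make_linear R ((R^o : lmodType R) * P)%type P snd.
exists ((R^o : lmodType R) * P)%type, q; split.
- by apply: fg_prod => //; apply: fg_regular.
- by apply: projective_prod => //; apply: projective_regular.
- move=> w /span_cons[a [u [/sp[y <-] ->]]].
  by exists (a, y); rewrite Hq /= Hf.
- exists n.+1, (fun i => if i is j.+1 then r (x j) else l 1),
    (fun i => if i is j.+1 then phi j \o pr2 else pr1) => -[a y].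
  rewrite big_ord_recl /= Hpr1 /=.
  have -> : \sum_(i < n) phi i (pr2 (a, y)) *: r (x i) = r y.
    by rewrite (Hphi y) linear_sum; apply: eq_bigr => i _; rewrite linearZ Hpr2 -(Hphi y).
  by rewrite -linearZ /= [_ *: 1]mulr1 Hl Hr [RHS]surjective_pairing /= addr0 add0r.
- move=> N fN.
  have [|i Hi] := @make_linear R (hom P N) (hom ((R^o : lmodType R) * P)%type N) (fun g => (g : {linear P -> N}) \o pr2).
    by move=> c g h; apply: homP.
  have [//|e He] := @make_linear R (hom ((R^o : lmodType R) * P)%type N) N (fun g => (g : {linear _ -> N}) (l 1)).
  apply: (@fg_ext _ _ _ _ i e) => //; last exact: hP.
  split.
  + move=> g h; rewrite !Hi => e'; apply: homP => y.
    by have := congr1 (fun f : hom _ _ => (f : {linear _ -> N}) (r y)) e'; rewrite /= Hpr2 Hr.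
  + move=> y; have [g Hg] := scale_map y.
    by exists (g \o pr1 : {linear _ -> _}); rewrite He /= Hpr1 Hl Hg scale1r.
  + move=> g; rewrite He; split=> [g0|[h <-]].
      exists ((g : {linear _ -> N}) \o r : {linear _ -> _}); rewrite Hi; apply: homP => -[a y] /=.
      rewrite Hpr2 Hr /=.
      have -> : ((a, y) : ((R^o : lmodType R) * P)%type) = a *: l 1 + (0, y).
        by rewrite Hl [RHS]surjective_pairing /= addr0 scaler0 add0r [_ *: 1]mulr1.
      by rewrite linearD linearZ /= g0 scaler0 add0r.
    by rewrite Hi /= Hpr2 Hl /= linear0.
Qed.

Lemma dual_basis_fg_projective P : fg P -> projective_module P -> dual_basis P.
Proof.
move=> fP pP; have [Q [q [_ _ sq dQ _]]] := fg_free_cover fP.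
have [s Hs] := pP _ _ q (idfun : {linear P -> P}) sq.
exact: dual_basis_retract (Hs : cancel s q) dQ.
Qed.

Lemma fg_hom L N : fg L -> fg N -> fg (hom L N).
Proof.
move=> fL fN; have [P [p [_ _ sp _ hP]]] := fg_free_cover fL.
apply: (@fg_sub R noethR _ _ (precomp N p)); last exact: hP.
move=> f g e; apply: homP => v; have [u <-] := sp v.
by rewrite -![_ (p u)]precompE e.
Qed.

Lemma small_fg V (U : set V) : submod U -> fg V -> small false U.
Proof.
move=> [U0 _] /fgP[s Hs]; exists s; split=> // v; exists 0.
by rewrite subr0.
Qed.

Lemma ext_small_fg n L N : fg L -> fg N -> ext_small false n L N.
Proof.
move=> + fN; elim: n L => [|n IH] L fL.
  by apply: small_fg; [apply: (submod_zero (hom L N))|apply: fg_hom].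
have [P [p [fP pP sp _ _]]] := fg_free_cover fL.
have [K [i si]] := ses_of_surj sp.
have fK : fg K by have [ii _ _] := si; apply: fg_sub ii fP.
case: n IH => [|n] IH.
  apply/(ext_small1 false N si pP); apply: small_fg; last exact: fg_hom.
  exact: submod_restrictions.
by apply/(ext_small_shift false n N si pP); apply: IH.
Qed.

Lemma homology_proj A B C (f : {linear A -> B}) (g : {linear B -> C}) :
  exists p : {linear ker g -> homology f g}, surj p /\
    forall u, p u = 0 <-> exists a, f a = ker_val u.
Proof.
have [p [sp Hp]] := quotmod_proj
  (GRing.subsemimod_closedZ (GRing.submod_closed_semi (bound_pred_submod f g))).
by exists p; split=> // u; rewrite Hp inE.
Qed.

Lemma homology_zeroP A B C (f : {linear A -> B}) (g : {linear B -> C}) :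
  ~ nonzero_module (homology f g) <->
  forall b, g b = 0 -> exists a, f a = b.
Proof.
have [p [sp Hp]] := homology_proj f g.
rewrite -zero_moduleP; split=> H.
  move=> b gb; have kb : b \in ker_pred g by rewrite inE; apply/eqP.
  by have /Hp := H (p (Ker kb)).
move=> v; have [[b kb] <-] := sp v; apply/Hp; apply: H.
by have := kb; rewrite inE => /eqP.
Qed.

(** A cocycle on the n-th free module is a map vanishing on the next syzygy, hence a map on the n-th
    syzygy; this turns the homology into the cokernel. *)
Lemma Ext_zeroP n M N : ~ nonzero_module (Ext n M N) <-> ext_zero n M N.
Proof.
have cov K (f : {linear free_module R K -> N}) :
    (forall a, f (syz_incl K a) = 0) <->
    exists g : {linear K -> N}, forall c, f c = g (free_cover K c).
  have [_ sc ec] := syz_ses K; split=> [H|[g Hg] a].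
    have [|g Hg] := factor_surj (f := f) sc; last by exists g.
    by move=> _ /ec[w <-].
  by rewrite Hg (ses_comp _ (syz_ses K)) linear0.
have res k (f : {linear free_module R (syz M k) -> N}) :
    precomp N (res_diff M k) f = 0 <-> forall a, f (syz_incl (syz M k) a) = 0.
  split=> [e a|H].
    have [c <-] := free_cover_surj a.
    by have := congr1 (fun h : hom _ N => (h : {linear _ -> N}) c) e.
  by apply: homP => c; apply: H.
case: n => [|n]; rewrite homology_zeroP.
  rewrite ext_zero0; split=> H f.
    move=> a; have [c <-] := free_cover_surj a.
    have [|_ /= e] := H (f \o free_cover M : {linear _ -> _}).
      by apply/res/cov; exists f.
    by have := congr1 (fun h : hom _ N => (h : {linear _ -> N}) c) e => /= <-.
  move=> /res/cov[g Hg]; exists 0; rewrite linear0; apply: homP => c.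
  by rewrite Hg H.
rewrite -[ext_zero n.+1 M N]/(ext_zero 1 (syz M n) N).
rewrite (ext_zero1 N (syz_ses (syz M n)) (free_projective (V := _))).
split=> H f.
  have [|g Hg] := H (f \o free_cover (syz M n.+1) : {linear _ -> _}).
    by apply/res/cov; exists f.
  exists g => a; have [c <-] := free_cover_surj (V := syz M n.+1) a.
  by have := congr1 (fun h : hom _ N => (h : {linear _ -> N}) c) Hg => /= <-.
move=> /res/cov[g Hg]; have [e He] := H g.
by exists e; apply: homP => c; rewrite Hg He.
Qed.

End FinitenessExt.

(** * Depth *)

Section DepthTheory.
Context {R : comNzRingType} {m : set R}.
Context (noethR : noetherian R) (R_local : local_ring m).
Implicit Types (U V W A B C K L M N P Q X Z : lmodType R).

(* [dep L n]: some maximal [L]-regular sequence in [m] has length [n]. *)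
Inductive dep : lmodType R -> nat -> Prop :=
| dep0 L : socle_nonzero (m := m) L -> dep L 0
| depS L C x (p : {linear L -> C}) n : m x -> regular x L -> quot_by x p ->
    dep C n -> dep L n.+1.

Lemma dep_nonzero L n : dep L n -> nonzero_module L.
Proof.
elim=> {L n} [L [u [/eqP un _]]|L C x p n _ _ [sp _] _ [c /eqP cn]]; first by exists u.
have [u pu] := sp c; exists u; apply/eqP => u0; apply: cn.
by rewrite -pu u0 linear0.
Qed.

Section Residue.
Context (k : lmodType R) (rk : residue (m := m) k).

(** Multiplication by [x] is zero on [k], so it is null-homotopic on the resolution; [h] is built
    from the homotopy degree by degree. *)
Lemma residue_syz_kill x n : m x ->
  exists h : {linear free_module R (syz k n) -> syz k n.+1},
    forall a, h (syz_incl (syz k n) a) = x *: a.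
Proof.
move=> mx; elim: n => [|n [h Hh]].
  have [ii _ ex] := syz_ses k.
  have [|h Hh] := @factor_inj R _ _ _ (syz_incl k) (mulx x (free_module R k)) ii.
    by move=> c; apply/ex; rewrite linearZ; apply: (residue_kill R_local _ rk mx).
  by exists h => a; apply: ii; rewrite Hh [RHS]linearZ.
have [ii sc ex] := syz_ses (syz k n.+1).
have [h' Hh'] := free_projective h sc.
have [|h2 Hh2] := @factor_inj R _ _ _ (syz_incl (syz k n.+1))
    (mulx x _ \- (h' \o syz_incl (syz k n) \o free_cover (syz k n.+1))) ii.
  by move=> c; apply/ex; rewrite /= linearB Hh' Hh linearZ subrr.
exists h2 => a; apply: ii; rewrite Hh2 [RHS]linearZ.
set w := syz_incl _ a; rewrite -[LHS]/(x *: w - h' (syz_incl _ (free_cover _ w))).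
rewrite (ses_comp _ (syz_ses (syz k n.+1))).
by rewrite [X in h' X](linear0 (syz_incl _)) (linear0 h') subr0.
Qed.

Lemma residue_ext_kill x n N (f : {linear syz k n -> N}) : m x ->
  ext_bd n k N (mulx x N \o f).
Proof.
move=> mx; case: n f => [|n] f.
  by apply: homP => a; rewrite /= -linearZ (residue_kill R_local _ rk mx) linear0.
have [h Hh] := residue_syz_kill n mx.
by exists (f \o h) => a; rewrite /= Hh linearZ.
Qed.

(** Rees: the depth is the least degree with Ext^n(k, L) nonzero. Since [x] kills these groups,
    dividing by [x] lowers that degree by exactly one. *)
Lemma dep_ext L n : dep L n ->
  (forall i, (i < n)%N -> ext_zero i k L) /\ ~ ext_zero n k L.
Proof.
elim=> {L n} [L [u [un mu]]|L C x p n mx rx qp _ [IH1 IH2]].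
  split=> // /ext_zero0 H; have [p [sp Hp]] := rk.
  have [f Hf] := scale_map u.
  have [|g Hg] := factor_surj (f := f) sp.
    by move=> r /Hp mr; rewrite Hf mu.
  by apply: un; rewrite -[u]scale1r -Hf -Hg H.
have si := quot_by_ses rx qp.
have E i : (i <= n)%N -> ext_zero i k L.
  case: i => [|i] ni.
    apply/ext_zero0 => f a; apply: rx.
    by rewrite -linearZ (residue_kill R_local _ rk mx) linear0.
  apply/ext_zeroP => f; apply: (ext_bd_reflect si (IH1 _ ni)).
  exact: residue_ext_kill.
split=> [i /E //|V]; apply: IH2.
by apply: (ext_zero_second_right noethR si); first exact: E.
Qed.

End Residue.

Lemma dep_unique L n n' : dep L n -> dep L n' -> n = n'.
Proof.
have [k rk] := residue_exists R_local.
move=> /(dep_ext rk)[H1 H2] /(dep_ext rk)[H1' H2'].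
by case: (ltngtP n n') => // [/H1'|/H1].
Qed.

(** Noetherian induction on the kernel of a quotient of [L]: dividing the quotient by a regular
    element strictly enlarges the kernel. *)
Lemma dep_exists L : fg L -> nonzero_module L -> exists n, dep L n.
Proof.
move=> fL nL.
suff H (S : set L) : submod S -> forall Q (p : {linear L -> Q}), surj p ->
    (forall v, p v = 0 <-> S v) -> nonzero_module Q -> exists n, dep Q n.
  apply: (H _ (submod_zero L) L (idfun : {linear L -> L})) => //.
  by move=> v; exists v.
move: S; apply: (noetherian_ind noethR fL) => S SS IH Q p sp Hp nQ.
have [sQ|sQ] := pselect (socle_nonzero (m := m) Q); first by exists 0%N; apply: dep0.
have fQ : fg Q by apply: fg_surj sp fL.
have [x [mx rx]] := regular_element noethR R_local fQ sQ.
have [C [q qq]] := quot_by_exists x Q.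
have [|||||n Hn] := IH [set v | q (p v) = 0] (submod_ker (q \o p)) _ _ C (q \o p).
- by move=> v Sv /=; have /Hp -> := Sv; rewrite linear0.
- move=> e; have [u /eqP un] := nQ; apply: un; have [v ev] := sp u.
  have [w ew] := sp (x *: u); apply: rx; rewrite -ew; apply/Hp; rewrite -e /=.
  by apply/(qq.2); exists u.
- by move=> c; have [u <-] := qq.1 c; have [v <-] := sp u; exists v.
- by [].
- exact: (quot_by_nonzero noethR R_local mx fQ nQ qq).
by exists n.+1; apply: depS rx qq Hn.
Qed.

Lemma dep_quot L C x (p : {linear L -> C}) e : fg L -> m x -> regular x L ->
  quot_by x p -> dep L e -> exists e', e = e'.+1 /\ dep C e'.
Proof.
move=> fL mx rx qp de.
have nC := quot_by_nonzero noethR R_local mx fL (dep_nonzero de) qp.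
have [e' de'] := dep_exists (fg_surj qp.1 fL) nC.
by exists e'; split=> //; apply: dep_unique de _; apply: depS rx qp de'.
Qed.

Lemma dep0_socle L e : dep L e -> socle_nonzero (m := m) L -> e = 0%N.
Proof. by move=> de s; apply: dep_unique de (dep0 s). Qed.

Lemma dep0P L : dep L 0 -> socle_nonzero (m := m) L.
Proof. by move=> d; inversion d. Qed.

Lemma seq_mul_quot x L C (p : {linear L -> C}) ys u : quot_by x p ->
  @seq_mul R L (x :: ys) u <-> @seq_mul R C ys (p u).
Proof.
move=> [sp Hp]; split=> [[v ->]|[c Hc]].
  exists (fun i => p (v i.+1)); rewrite big_ord_recl linearD /=.
  have -> : p (x *: v 0%N) = 0 by apply/Hp; exists (v 0%N).
  rewrite add0r linear_sum; apply: eq_bigr => i _; by rewrite linearZ.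
have [l Hl] := choice sp.
have /Hp[w Hw] : p (u - \sum_(i < size ys) ys`_i *: l (c i)) = 0.
  rewrite linearB Hc linear_sum -sumrB big1 // => i _.
  by rewrite linearZ /= Hl subrr.
exists (fun i => if i is j.+1 then l (c j) else w).
by rewrite big_ord_recl /= -Hw subrK.
Qed.

Lemma regular_seq_cons x L C (p : {linear L -> C}) ys : quot_by x p ->
  regular_seq L (x :: ys) <-> regular x L /\ regular_seq C ys.
Proof.
move=> qp; have nil0 (u : L) : @seq_mul R L [::] u <-> u = 0.
  by split=> [[v ->]|->]; [rewrite big_ord0|exists (fun=> 0); rewrite big_ord0].
split=> [[H1 /eqP H2]|[rx [H1 /eqP H2]]].
  split; first by move=> u xu; apply/nil0; apply: (H1 0%N) => //=; apply/nil0.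
  split=> [i ni c|].
    have [u <-] := qp.1 c; rewrite -linearZ => /(seq_mul_quot _ _ qp) H.
    by apply/(seq_mul_quot _ _ qp); apply: (H1 i.+1).
  apply/eqP => e; apply: H2; apply/seteqP; split=> // u _.
  by apply/(seq_mul_quot _ _ qp); rewrite e.
split=> [[|i] ni u|].
- by move=> /nil0 xu; apply/nil0; apply: rx.
- move=> /(seq_mul_quot _ _ qp); rewrite linearZ => /(H1 i ni) H.
  exact/(seq_mul_quot _ _ qp).
- apply/eqP => e; apply: H2; apply/seteqP; split=> // c _.
  have [u <-] := qp.1 c; apply/(seq_mul_quot _ _ qp); by rewrite e.
Qed.

Lemma dep_regular_seq L n : dep L n -> exists xs : seq R,
  [/\ forall x, x \in xs -> m x, regular_seq L xs & size xs = n].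
Proof.
elim=> {L n} [L [u [un mu]]|L C x p n mx rx qp _ [xs [mxs rxs sxs]]].
  exists [::]; split=> //; split=> //; apply/eqP => e; apply: un.
  have [v ->] : @seq_mul R L [::] u by rewrite e.
  by rewrite big_ord0.
exists (x :: xs); split; last by rewrite /= sxs.
  by move=> y; rewrite inE => /orP[/eqP ->|/mxs].
exact/(regular_seq_cons xs qp).
Qed.

(** Every regular element of [m] lowers [dep] by one, so no regular sequence is longer than the
    given maximal one. *)
Lemma regular_seq_dep L n xs : fg L -> dep L n ->
  (forall x, x \in xs -> m x) -> regular_seq L xs -> (size xs <= n)%N.
Proof.
elim: xs L n => // x xs IH L n fL dL mxs.
have [C [p qp]] := quot_by_exists x L.
move=> /(regular_seq_cons xs qp)[rx rxs].
have mx : m x by apply: mxs; rewrite inE eqxx.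
have [e [-> dC]] := dep_quot fL mx rx qp dL.
rewrite ltnS; apply: (IH C e) => //; first exact: fg_surj qp.1 fL.
by move=> y ys; apply: mxs; rewrite inE ys orbT.
Qed.

End DepthTheory.

(** * Complexes and their cycles *)

Section DirectSums.
Context {R : comNzRingType} (noethR : noetherian R).
Implicit Types (U V W A B C K L M N P Q X Z : lmodType R).

Lemma dsumS_iso M a :
  exists f : {linear (M * dsum M a)%type -> dsum M a.+1}, bijective f.
Proof.
pose F (u : M * dsum M a) : dsum M a.+1 :=
  [ffun i => if unlift ord0 i is Some j then u.2 j else u.1].
have [|f Hf] := @make_linear R (M * dsum M a)%type (dsum M a.+1) F.
  move=> c u v; apply/ffunP => i; rewrite !ffunE.
  by case: unliftP => [j|] _ /=; rewrite ?ffunE.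
exists f; pose G (x : dsum M a.+1) : M * dsum M a := (x ord0, [ffun j => x (lift ord0 j)]).
exists G => [u|x].
  rewrite Hf [RHS]surjective_pairing /G /F; congr pair; first by rewrite ffunE unlift_none.
  by apply/ffunP => j; rewrite !ffunE liftK.
rewrite Hf; apply/ffunP => i; rewrite ffunE.
by case: unliftP => [j|] -> //=; rewrite ffunE.
Qed.

Lemma dsum0_zero M : zero_module (dsum M 0).
Proof. by move=> x; apply/ffunP => -[]. Qed.

Lemma fg_dsum M a : fg M -> fg (dsum M a).
Proof.
move=> fM; elim: a => [|a IH]; first exact/fg_zero/dsum0_zero.
have [f bf] := dsumS_iso M a.
exact/(fg_iso bf)/fg_prod.
Qed.

Lemma dsum_coord M a (j : 'I_a) :
  exists (p : {linear dsum M a -> M}), forall x, p x = x j.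
Proof. by apply: make_linear => c x y; rewrite ffunE ffunE. Qed.

Lemma dsum_const M a : exists (d : {linear M -> dsum M a}), forall x, d x = [ffun => x].
Proof. by apply: make_linear => c x y; apply/ffunP => i; rewrite !ffunE. Qed.

Lemma ext_dsum_cod n L N b : ext_zero n L N -> ext_zero n L (dsum N b).
Proof.
move=> /ext_zeroP V; elim: b => [|b IH]; first by apply: ext_zero_cod; apply: dsum0_zero.
have [f bf] := dsumS_iso N b.
apply: (ext_small_iso_cod noethR bf).
have [i [p s]] := prod_ses N (dsum N b).
by apply: (ext_zero_second_mid noethR s) => //; apply/ext_zeroP.
Qed.

Lemma ext_dsum_cod_inv n L N b : (0 < b)%N -> ext_zero n L (dsum N b) -> ext_zero n L N.
Proof.
case: b => // b _ /ext_zeroP V; apply/ext_zeroP => f.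
have [p Hp] := dsum_coord N (ord0 : 'I_b.+1).
have [d Hd] := dsum_const N b.+1.
apply: ext_bd_eq (ext_bd_comp p (V (d \o f))) => a.
by rewrite /= Hd Hp ffunE.
Qed.

Lemma ses_prod A B C A' B' C' (i : {linear A -> B}) (p : {linear B -> C})
    (i' : {linear A' -> B'}) (p' : {linear B' -> C'}) : ses i p -> ses i' p' ->
  exists (j : {linear (A * A')%type -> (B * B')%type})
         (q : {linear (B * B')%type -> (C * C')%type}),
  [/\ ses j q, forall u, j u = (i u.1, i' u.2) & forall u, q u = (p u.1, p' u.2)].
Proof.
move=> [ii sp ex] [ii' sp' ex'].
have [|j Hj] := @make_linear R (A * A')%type (B * B')%type (fun u => (i u.1, i' u.2)).
  by move=> a x y; rewrite [RHS]surjective_pairing /= !linearP.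
have [|q Hq] := @make_linear R (B * B')%type (C * C')%type (fun u => (p u.1, p' u.2)).
  by move=> a x y; rewrite [RHS]surjective_pairing /= !linearP.
exists j, q; split=> //; split.
- by move=> [x y] [x' y']; rewrite !Hj /= => -[/ii -> /ii' ->].
- move=> [x y]; have [u <-] := sp x; have [v <-] := sp' y.
  by exists (u, v); rewrite Hq.
- move=> [x y]; rewrite Hq /=; split=> [[/ex[a <-] /ex'[b <-]]|[[a b]]].
    by exists (a, b); rewrite Hj.
  rewrite Hj => -[<- <-] /=; congr pair; [apply/ex; by exists a|apply/ex'; by exists b].
Qed.

Lemma ext_prod_dom_inv n A C N : ext_zero n (A * C)%type N -> ext_zero n A N.
Proof.
elim: n A C => [|n IH] A C.
  move=> /ext_zero0 V; apply/ext_zero0 => f a.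
  have [//|p Hp] := @make_linear R (A * C)%type A fst.
  by have := V (f \o p) (a, 0); rewrite /= Hp.
have [j [q [sj Hj Hq]]] := ses_prod (syz_ses A) (syz_ses C).
have pF := projective_prod (free_projective (V := A)) (free_projective (V := C)).
case: n IH => [_|n IH].
  move=> /(ext_zero1 N sj pF) V.
  apply/(ext_zero1 N (syz_ses A) (free_projective (V := A))) => f.
  have [//|p Hp] := @make_linear R (ker (free_cover A) * ker (free_cover C))%type (ker (free_cover A)) fst.
  have [g Hg] := V (f \o p).
  have [l Hl] := inl_exists (free_module R A) (free_module R C).
  exists (g \o l) => a; have := Hg (a, 0); rewrite /= Hp /= => ->.
  by rewrite Hj Hl; congr (g (_, _)); apply: (linear0 (syz_incl C)).
move=> /(ext_small_shift true n N sj pF)/IH V.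
exact/(ext_small_shift true n N (syz_ses A) (free_projective (V := A))).
Qed.

Lemma ext_dsum_dom n M N a : ext_zero n M N -> ext_zero n (dsum M a) N.
Proof.
move=> V; elim: a => [|a IH]; first by apply: ext_zero_dom; apply: dsum0_zero.
have [f bf] := dsumS_iso M a; apply/(ext_zero_iso_dom n N bf).
have [i [p s]] := prod_ses M (dsum M a).
exact: (ext_first_mid s).
Qed.

Lemma ext_dsum_dom_inv n M N a : (0 < a)%N -> ext_zero n (dsum M a) N -> ext_zero n M N.
Proof.
case: a => // a _ V; have [f bf] := dsumS_iso M a.
by apply: (@ext_prod_dom_inv _ _ (dsum M a)); apply/(ext_zero_iso_dom n N bf).
Qed.

Lemma ext_zero_injective n L I : injective_module I -> ext_zero n.+1 L I.
Proof.
move=> iI; apply/ext_zeroP => f; have [ii _ _] := syz_ses (syz L n).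
have [g Hg] := iI _ _ _ f ii.
by exists g => a; rewrite Hg.
Qed.

End DirectSums.

Section Complexes.
Context {R : comNzRingType} (X : complex R).
Implicit Types (U V W A B C K L M N P Q Z : lmodType R) (i j : int).

(** All differentials out of degree [i] but one vanish by [diff_shape]. Quantifying over the other
    endpoint, here and in [bdry], avoids casts between the indices i and (i - 1) + 1. *)
Definition cycle i (x : X i) : Prop := forall j, diff X i j x = 0.
Definition bdry i (x : X i) : Prop := exists j (y : X j), diff X j i y = x.

Lemma cycleP i j (x : X i) : i = j + 1 -> cycle x <-> diff X i j x = 0.
Proof.
move=> ij; split=> [/(_ j)//|dx] l; have [il|il] := eqVneq i (l + 1).
  by have -> : l = j by apply: (addIr 1); rewrite -il.
by rewrite diff_shape.
Qed.

Lemma bdryP i j (x : X j) : i = j + 1 -> bdry x <-> exists y, diff X i j y = x.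
Proof.
move=> ij; split=> [[l [y <-]]|[y <-]]; last by exists i, y.
have [lj|lj] := eqVneq l (j + 1); last by exists 0; rewrite linear0 diff_shape.
by rewrite ij -lj; exists y.
Qed.

Lemma bdry_cycle i (x : X i) : bdry x -> cycle x.
Proof. by move=> [j [y <-]] l; rewrite diff_diff. Qed.

Lemma submod_cycle i : submod (@cycle i).
Proof.
split=> [j|a x y cx cy j]; first exact: linear0.
by rewrite linearP cx cy scaler0 addr0.
Qed.

Lemma submod_bdry i : submod (@bdry i).
Proof.
split=> [|a x y /(bdryP _ (erefl _))[x' <-] /(bdryP _ (erefl _))[y' <-]].
  by exists i, 0; rewrite linear0.
by exists (i + 1), (a *: x' + y'); rewrite linearP.
Qed.

Definition is_cycles i Z (z : {linear Z -> X i}) : Prop :=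
  injective z /\ forall x, cycle x <-> exists a, z a = x.

Lemma cycles_exists i : exists Z (z : {linear Z -> X i}), is_cycles z.
Proof. exact: submodule_exists (submod_cycle i). Qed.

Lemma homology_class i Z (z : {linear Z -> X i}) : is_cycles z ->
  exists h : {linear Z -> homology_at i X}, surj h /\ forall a, h a = 0 <-> bdry (z a).
Proof.
move=> [iz Hz]; have [p [sp Hp]] := homology_proj (diff X (i + 1) i) (diff X i (i - 1)).
have ei : i = i - 1 + 1 by rewrite subrK.
pose v : {linear ker (diff X i (i - 1)) -> X i} := (val : {linear _ -> _}).
have [||w Hw] := @factor_inj R _ (X i) Z v z.
- exact: val_inj.
- move=> a; have /(cycleP _ ei)/eqP ca : cycle (z a) by apply/Hz; exists a.
  by have h : z a \in ker_pred (diff X i (i - 1)) by []; exists (Ker h).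
exists (p \o w); split=> [c|a].
  have [[x kx] <-] := sp c.
  have /(cycleP _ ei)/Hz[a Ha] : diff X i (i - 1) x = 0 by apply/eqP.
  by exists a; rewrite /=; congr (p _); apply: val_inj; rewrite -[LHS]/(v (w a)) Hw Ha.
by rewrite /= Hp (bdryP (i := i + 1)) // -[ker_val _]/(v (w a)) Hw.
Qed.

Lemma homology_zero i : zero_module (homology_at i X) <-> forall x : X i, cycle x -> bdry x.
Proof.
have [Z [z cz]] := cycles_exists i; have [h [sh Hh]] := homology_class cz.
split=> [H x /cz.2[a <-]|H c]; first exact/Hh/H.
by have [a <-] := sh c; apply/Hh/H/cz.2; exists a.
Qed.

Lemma zero_homology i : zero_module (X i) -> zero_module (homology_at i X).
Proof.
move=> H; apply/homology_zero => x _; rewrite (H x).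
by case: (submod_bdry i).
Qed.

(** The sequences of boundaries, cycles, homology and of cycles, chains, boundaries, through which
    Ext is compared from one degree to the next. *)
Lemma cycles_ses i i' Z' (z' : {linear Z' -> X i'}) Z (z : {linear Z -> X i}) :
  i' = i + 1 -> is_cycles z' -> is_cycles z ->
  exists B (b : {linear B -> Z}) (h : {linear Z -> homology_at i X}) (e : {linear X i' -> B}),
    [/\ ses b h, ses z' e & forall x, z (b (e x)) = diff X i' i x].
Proof.
move=> ei cz' cz; have [h [sh Hh]] := homology_class cz.
have [B [b sb]] := ses_of_surj sh.
have [ib _ eb] := sb; have [iz Hz] := cz; have [iz' Hz'] := cz'.
have [|e1 He1] := @factor_inj R _ _ _ z (diff X i' i) iz.
  by move=> x; apply/Hz; apply: bdry_cycle; exists i', x.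
have [|e He] := @factor_inj R _ _ _ b e1 ib.
  by move=> x; apply/eb/Hh; rewrite He1; exists i', x.
exists B, b, h, e; split=> //; last by move=> x; rewrite He He1.
split=> //.
- move=> c; have /Hh/(bdryP _ ei)[y Hy] : h (b c) = 0 by apply/eb; exists c.
  by exists y; apply: ib; apply: iz; rewrite He He1.
- move=> x; rewrite -Hz' (cycleP _ ei); split=> [ex|dx].
    by rewrite -He1 -He ex !linear0.
  by apply: ib; apply: iz; rewrite He He1 dx !linear0.
Qed.

End Complexes.

(** * Complexes of injective modules *)

Lemma int_down (P : int -> Prop) (hi : int) : (forall i : int, hi < i -> P i) ->
  (forall i : int, P (i + 1) -> P i) -> forall i, P i.
Proof.
move=> H0 H i; have [/H0//|le] := ltP hi i.
have : i = hi + 1 - (absz (hi + 1 - i)%R)%:Z by lia.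
move: (absz (hi + 1 - i)%R) => n; elim: n i {le} => [|n IH] i e.
  by apply: H0; lia.
by apply: H; apply: IH; lia.
Qed.

Lemma int_up (P : int -> Prop) (lo : int) : (forall i : int, i < lo -> P i) ->
  (forall i : int, P (i - 1) -> P i) -> forall i, P i.
Proof.
move=> H0 H i; rewrite -(opprK i); move: (- i); apply: (@int_down _ (- lo)).
  by move=> j lj; apply: H0; lia.
by move=> j Hj; apply: H; rewrite -opprD.
Qed.

Lemma int_min (P : int -> Prop) (lo : int) : (forall i : int, P i -> lo <= i) -> (exists i, P i) ->
  exists i, P i /\ forall j : int, j < i -> ~ P j.
Proof.
move=> H [i0 P0]; apply: contrapT => no.
have none n : forall i : int, i < lo + n%:Z -> ~ P i.
  elim: n => [|n IH] i il Pi; first by have := H i Pi; lia.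
  apply: no; exists i; split=> // j ji; apply: IH; lia.
apply: (none (absz (i0 + 1 - lo)%R) i0) => //.
by have := H i0 P0; lia.
Qed.

Section InjectiveComplex.
Context {R : comNzRingType} {m : set R}.
Context (noethR : noetherian R) (R_local : local_ring m).
Context (I : complex R) (I_inj : forall i, injective_module (I i)).
Implicit Types (U V W A B C K L M N P Q Z : lmodType R) (i j : int).

(* [tvan i L]: the homology of Hom(L, I) vanishes in degree [i]. *)
Definition tvan i L : Prop :=
  forall f : {linear L -> I i}, (forall a, cycle (f a)) ->
  exists g : {linear L -> I (i + 1)}, forall a, f a = diff I (i + 1) i (g a).

Lemma tvan_zero i L : zero_module L -> tvan i L.
Proof. by move=> z0 f _; exists \0 => a; rewrite (z0 a) !linear0. Qed.

Lemma tvan_mid i A B C (u : {linear A -> B}) (p : {linear B -> C}) :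
  ses u p -> tvan i A -> tvan i C -> tvan i B.
Proof.
move=> [iu sp ex] TA TC f cf.
have [g Hg] := TA (f \o u) (fun a => cf (u a)).
have [g' Hg'] := I_inj g iu.
have [|h Hh] := factor_surj (f := f \- (diff I (i + 1) i \o g')) sp.
  by move=> _ /ex[a <-]; rewrite /= Hg' -Hg subrr.
have [c|k Hk] := TC h.
  have [b <-] := sp c; rewrite Hh /=; apply: (submodB (submod_cycle I i)).
    exact: cf.
  by apply: bdry_cycle; exists (i + 1), (g' b).
by exists (g' \+ (k \o p)) => b; rewrite linearD /= -Hk Hh /= addrC subrK.
Qed.

Lemma tvan_right i A B C (u : {linear A -> B}) (p : {linear B -> C}) :
  ses u p -> tvan (i + 1) A -> tvan i B -> tvan i C.
Proof.
move=> [iu sp ex] TA TB f cf.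
have [g Hg] := TB (f \o p) (fun a => cf (p a)).
have [a|h Hh] := TA (g \o u).
  apply/(cycleP _ (erefl _)); rewrite -Hg /=.
  by have /ex -> : exists a', u a' = u a by [exists a]; rewrite linear0.
have [h' Hh'] := I_inj h iu.
have [|k Hk] := factor_surj (f := g \- (diff I (i + 1 + 1) (i + 1) \o h')) sp.
  by move=> _ /ex[a <-]; rewrite /= Hh' -Hh subrr.
exists k => c; have [b <-] := sp c.
by rewrite Hk /= linearB diff_diff subr0 -Hg.
Qed.

(** Exactness at the cochain level: cycles of Hom(A, I) in degree i + 1 extend to cycles of Hom(B,
    I), because T_i(C) = 0 removes the obstruction. *)
Lemma tvan_extend i A B C (u : {linear A -> B}) (p : {linear B -> C}) :
  ses u p -> tvan i C -> forall f : {linear A -> I (i + 1)}, (forall a, cycle (f a)) ->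
  exists g : {linear B -> I (i + 1)}, (forall b, cycle (g b)) /\ forall a, f a = g (u a).
Proof.
move=> [iu sp ex] TC f cf.
have [g Hg] := I_inj f iu.
have [|k Hk] := factor_surj (f := diff I (i + 1) i \o g) sp.
  by move=> _ /ex[a <-]; rewrite /= Hg (cf a).
have [c|h Hh] := TC k.
  by have [b <-] := sp c; rewrite Hk /=; apply: bdry_cycle; exists (i + 1), (g b).
exists (g \- (h \o p)); split=> [b|a] /=.
  by apply/(cycleP _ (erefl _)); rewrite linearB -Hh Hk /= subrr.
by have /ex -> : exists a', u a' = u a by [exists a]; rewrite linear0 subr0 Hg.
Qed.

(** With [z] the inclusion of the cycles, T_i(L) is the quotient of Hom(L, Z) by this submodule. *)
Definition tbd i L Z (z : {linear Z -> I i}) : set (hom L Z) :=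
  [set f : hom L Z | exists g : {linear L -> I (i + 1)},
     forall a, z ((f : {linear L -> Z}) a) = diff I (i + 1) i (g a)].

Arguments tbd [i] L [Z] z.

Lemma submod_tbd i L Z (z : {linear Z -> I i}) : submod (tbd L z).
Proof.
split; first by exists \0 => a; rewrite /= !linear0.
move=> c f g [f' Hf] [g' Hg]; exists (c *: (f' : hom _ _) + (g' : hom _ _)) => a.
rewrite -[LHS]/(z (c *: (f : {linear _ -> _}) a + (g : {linear _ -> _}) a)).
by rewrite linearP Hf Hg; apply/esym/linearP.
Qed.

Lemma tvanP i L Z (z : {linear Z -> I i}) : is_cycles z ->
  tvan i L <-> forall f : {linear L -> Z}, tbd L z f.
Proof.
move=> [iz Hz]; split=> T f.
  by have [|g Hg] := T (z \o f); [move=> a; apply/Hz; exists (f a)|exists g].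
move=> cf; have [|f' Hf'] := @factor_inj R _ _ _ z f iz; first by move=> a; apply/Hz.
by have [g Hg] := T f'; exists g => a; rewrite -Hf' Hg.
Qed.

Section BoundedHomology.
Context (hi : int) (I_hi : forall i, hi < i -> zero_module (I i)).

Lemma cycles_zero i Z (z : {linear Z -> I i}) : zero_module (I i) -> is_cycles z ->
  zero_module Z.
Proof. by move=> z0 [iz _] a; apply: iz; rewrite (z0 (z a)) (z0 (z 0)). Qed.

(** The cycles are not finitely generated, but by injectivity of the terms Ext of the boundaries
    comes from Ext of the cycles one degree up, and the homology is finitely generated. *)
Lemma cycles_ext_fg L : fg L -> (forall i, fg (homology_at i I)) ->
  forall i n Z (z : {linear Z -> I i}), is_cycles z -> ext_small false n.+1 L Z.
Proof.
move=> fL fH; apply: (@int_down _ hi) => [i ih|i IH] n Z z cz.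
  apply: ext_small_of_zero.
  by apply: ext_zero_cod; apply: cycles_zero cz; apply: I_hi.
have [Z' [z' cz']] := cycles_exists I (i + 1).
have [B [b [h [e [sb se _]]]]] := cycles_ses (erefl _) cz' cz.
apply: (ext_second_mid noethR sb); last exact: ext_small_fg.
apply: (ext_second_right noethR se); first exact: ext_zero_injective.
exact: IH cz'.
Qed.

(** T_i(L) lies between two finitely generated modules: Ext^1(L, Z_(i+1)) for the maps into
    boundaries, and Hom(L, H_i(I)). *)
Lemma tbd_small i L Z (z : {linear Z -> I i}) : fg L -> (forall i, fg (homology_at i I)) ->
  is_cycles z -> small false (tbd L z).
Proof.
move=> fL fH cz; have [Z' [z' cz']] := cycles_exists I (i + 1).
have [B [b [h [e [sb se zb]]]]] := cycles_ses (erefl _) cz' cz.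
have [s [_ Hs]] := ext_lift noethR se (n := 0) (cycles_ext_fg fL fH 0 cz').
have [Ph HPh] := postcomp_exists L h.
have [Pb HPb] := postcomp_exists L b.
apply: (@small_ext _ noethR _ _ _ _ _ Ph (map Pb s)
   (submod_tbd L z) (submod_zero (hom L (homology_at i I)))) => //.
  by apply: small_fg; [exact: submod_zero|apply: fg_hom].
move=> f hf.
have [|f' Hf'] := ses_factor sb (f := f).
  by move=> a; rewrite -HPh hf.
have [g [h' [sh' Hg]]] := Hs f'.
have [beg Hbeg] : exists q : {linear L -> Z}, forall a, q a = b (e (g a)).
  by exists (b \o e \o g).
exists (beg : hom L Z); split; first by exists g => a; rewrite Hbeg zb.
have -> : f - (beg : hom L Z) = Pb h'; last exact: span_map.
apply: homP => a; rewrite HPb -[LHS]/((f : {linear L -> Z}) a - beg a) Hbeg -Hf' Hg linearD.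
by rewrite addrK.
Qed.

Context (H_fg : forall i, fg (homology_at i I)).

(** If T_i(L/xL) = 0, then multiplication by [x] is onto on T_(i+1)(L), which vanishes by Nakayama's
    lemma. *)
Lemma tvan_regular i x L C (p : {linear L -> C}) : fg L -> m x -> regular x L ->
  quot_by x p -> tvan i C -> tvan (i + 1) L.
Proof.
move=> fL mx rx qp TC; have si := quot_by_ses rx qp.
have [Z [z cz]] := cycles_exists I (i + 1).
have [iz Hz] := cz.
apply/(tvanP L cz); apply: (nakayama1 noethR R_local mx (submod_tbd L z)).
  by have [s [_ Hs]] := tbd_small fL H_fg cz; exists s.
move=> f; have [|g [cg Hg]] := tvan_extend si TC (f := z \o f).
  by move=> a; apply/Hz; exists (f a).
have [|g' Hg'] := @factor_inj R _ _ _ z g iz; first by move=> a; apply/Hz.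
exists (g' : hom L Z).
have -> : f - x *: (g' : hom L Z) = 0; last by case: (submod_tbd L z).
apply: homP => a; apply: iz.
rewrite -[(f - _ : hom _ _) a]/((f : {linear L -> Z}) a - x *: g' a) linearB.
have -> : z ((f : {linear L -> Z}) a) = x *: g a.
  by rewrite -[LHS]/((z \o f) a) Hg -[mulx x L a]/(x *: a) linearZ.
by rewrite linearZ /= Hg' subrr linear0.
Qed.

Lemma residue_iso k k' : residue (m := m) k -> residue (m := m) k' ->
  exists f : {linear k -> k'}, bijective f.
Proof.
move=> [p [sp Hp]] [p' [sp' Hp']].
have [|f Hf] := factor_surj (f := p') sp; first by move=> r /Hp/Hp'.
have [|g Hg] := factor_surj (f := p) sp'; first by move=> r /Hp'/Hp.
exists f, g => c; first by have [r <-] := sp c; rewrite Hf Hg.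
by have [r <-] := sp' c; rewrite Hg Hf.
Qed.

Lemma tvan_devissage k q : residue (m := m) k -> (forall i, i < q -> tvan i k) ->
  forall L, fg L -> forall i, i < q -> tvan i L.
Proof.
move=> rk Tk; apply: (devissage noethR R_local).
- by move=> L z0 i _; apply: tvan_zero.
- move=> k' rk' i iq; have [f /ses_iso[Z [p [sf z0]]]] := residue_iso rk rk'.
  by apply: (tvan_mid sf); [exact: Tk|exact: tvan_zero].
- by move=> A B C u p _ _ _ si TA TC i iq; apply: (tvan_mid si); [apply: TA|apply: TC].
- move=> x L C p fL mx rx qp TC i iq; rewrite -(subrK 1 i).
  by apply: (tvan_regular fL mx rx qp); apply: TC; lia.
Qed.

(* Ischebeck's argument. *)
Lemma tvan_dep k q : residue (m := m) k -> (forall i, i < q -> tvan i k) -> ~ tvan q k ->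
  forall L n, dep (m := m) L n -> fg L ->
    (forall i, i < q + n%:Z -> tvan i L) /\ ~ tvan (q + n%:Z) L.
Proof.
move=> rk Tk nTk L n; elim=> {L n} [L [u [un mu]]|L C x p n mx rx qp _ IH] fL.
  rewrite addr0; split; first exact: tvan_devissage rk Tk L fL.
  move=> TL; apply: nTk; have [p [sp Hp]] := rk.
  have [f Hf] := scale_map u.
  have [|g Hg] := factor_surj (f := f) sp.
    by move=> r /Hp mr; rewrite Hf mu.
  (* The socle element embeds [k] into [L]. Since T_(q-1) vanishes on the cokernel, T_q(L) maps onto
     T_q(k), which is nonzero. *)
  have ig : injective g.
    apply: injective_ker => c; have [r <-] := sp c; rewrite Hg Hf => ru.
    apply/Hp; apply: contrapT => /(unit_notin noethR R_local)[b br].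
    by apply: un; rewrite -[u]scale1r -br -scalerA ru scaler0.
  have [D [q' [sq' Hq']]] := quotient_exists (submod_im g).
  have si : ses g q' by split=> // b; rewrite Hq'; split=> -[a]; [move=> _ <-|move=> <-]; exists a.
  have TD : tvan (q - 1) D.
    by apply: (tvan_devissage rk Tk); [exact: fg_surj sq' fL|lia].
  rewrite -(subrK 1 q) in TL *; move=> f' cf'.
  have [g' [cg' Hg']] := tvan_extend si TD cf'.
  have [h Hh] := TL g' cg'.
  by exists (h \o g) => a; rewrite Hg' Hh.
have fC : fg C by apply: fg_surj qp.1 fL.
have [IH1 IH2] := IH fC.
have TL i : i < q + n.+1%:Z -> tvan i L.
  move=> iq; rewrite -(subrK 1 i); apply: (tvan_regular fL mx rx qp).
  by apply: IH1; lia.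
split=> // T; apply: IH2; apply: (tvan_right (quot_by_ses rx qp)).
  by have <- : q + n.+1%:Z = q + n%:Z + 1 by lia.
by apply: TL; lia.
Qed.

Lemma tvan_regular_module i :
  tvan i R^o <-> zero_module (homology_at i I).
Proof.
rewrite homology_zero; split=> T.
  move=> x cx; have [f Hf] := scale_map x.
  have [|g Hg] := T f; first by move=> r; rewrite Hf; apply: (submodZ r (submod_cycle I i)).
  by exists (i + 1), (g 1); rewrite -Hg Hf scale1r.
move=> f cf; have /(bdryP _ (erefl _))[y Hy] := T _ (cf 1).
have [g Hg] := scale_map y.
exists g => r; rewrite Hg linearZ /= Hy -linearZ; congr (f _).
exact/esym/mulr1.
Qed.

Section Corner.
Context (L : lmodType R) (n0 : nat).
Hypothesis VH : forall i (j : nat), (n0 <= j)%N -> ext_zero j L (homology_at i I).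

Lemma cycles_ext_zero i (j : nat) Z (z : {linear Z -> I i}) : is_cycles z ->
  (n0 <= j.+1)%N -> ext_zero j.+1 L Z.
Proof.
move: i j Z z; apply: (@int_down _ hi) => [i ih|i IH] j Z z cz nj.
  by apply: ext_zero_cod; apply: cycles_zero cz; apply: I_hi.
have [Z' [z' cz']] := cycles_exists I (i + 1).
have [B [b [h [e [sb se _]]]]] := cycles_ses (erefl _) cz' cz.
apply: (ext_zero_second_mid noethR sb); last exact: VH.
apply: (ext_zero_second_right noethR se); first exact: ext_zero_injective.
by apply: IH cz' _; apply: leq_trans nj _.
Qed.

End Corner.

Lemma tvan_of_ext i L Z' (z' : {linear Z' -> I (i + 1)}) : is_cycles z' ->
  ext_zero 1 L Z' -> ext_zero 0 L (homology_at i I) -> tvan i L.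
Proof.
move=> cz' V1 /ext_zero0 V0; have [Z [z cz]] := cycles_exists I i.
have [B [b [h [e [sb se zb]]]]] := cycles_ses (erefl _) cz' cz.
apply/(tvanP L cz) => f.
have [|f' Hf'] := ses_factor sb (f := f).
  by move=> a; rewrite -[LHS]/((h \o f) a) V0.
have [g Hg] := ext_zero_lift noethR se (n := 0) V1 f'.
by exists g => a; rewrite -Hf' -Hg zb.
Qed.

(** Where the homology vanishes, cycles are boundaries, so vanishing of T_i(L) says that maps from
    [L] to the boundaries lift to I_(i+1); this is Ext^1(L, Z_(i+1)) = 0. *)
Lemma ext_of_tvan i L Z' (z' : {linear Z' -> I (i + 1)}) : is_cycles z' ->
  zero_module (homology_at i I) -> tvan i L -> ext_zero 1 L Z'.
Proof.
move=> cz' z0 T; have [Z [z cz]] := cycles_exists I i; have [iz _] := cz.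
have [B [b [h [e [sb se zb]]]]] := cycles_ses (erefl _) cz' cz.
have [ib _ _] := sb; have [iz' se1 ee] := se.
have lift (c : {linear L -> B}) : exists g : {linear L -> I (i + 1)}, forall a, e (g a) = c a.
  have [g Hg] := (tvanP L cz).1 T (b \o c).
  by exists g => a; apply: ib; apply: iz; rewrite zb -Hg.
apply/(ext_zero1 _ (syz_ses L) (free_projective (V := L))) => f.
have [isy ssy esy] := syz_ses L.
have [e1 He1] := @I_inj (i + 1) _ _ (syz_incl L) (z' \o f) isy.
have [|c Hc] := factor_surj (f := e \o e1) ssy.
  by move=> _ /esy[w <-]; rewrite /= He1 /= (ses_comp _ se).
have [g Hg] := lift c.
have [|k Hk] := ses_factor se (f := e1 \- (g \o free_cover L)).
  by move=> a; rewrite /= linearB Hg Hc subrr.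
exists k => w; apply: iz'; rewrite Hk /= He1 /=.
by rewrite (ses_comp _ (syz_ses L)) linear0 subr0.
Qed.

Lemma cycles_ext_shift i (j : nat) L Z (z : {linear Z -> I i}) Z' (z' : {linear Z' -> I (i + 1)}) :
  is_cycles z -> is_cycles z' -> zero_module (homology_at i I) ->
  ext_zero j.+1 L Z <-> ext_zero j.+2 L Z'.
Proof.
move=> cz cz' z0.
have [B [b [h [e [sb se zb]]]]] := cycles_ses (erefl _) cz' cz.
have V0 l : ext_zero l L (homology_at i I) by apply: ext_zero_cod.
have VI l : ext_zero l.+1 L (I (i + 1)) by apply: ext_zero_injective.
split=> V.
  apply: (ext_second_left se) => //.
  exact: (ext_second_left sb).
apply: (ext_zero_second_mid noethR sb) => //.
exact: (ext_zero_second_right noethR se).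
Qed.

End BoundedHomology.
End InjectiveComplex.

Section IsoLemmas.
Context {R : comNzRingType}.
Implicit Types (U V W A B C K L M N P Q Z : lmodType R).

Lemma isomorphic_sym U V : isomorphic U V -> isomorphic V U.
Proof.
move=> [f [g fg gf]]; have [|h Hh] := @make_linear R V U g.
  by move=> a x y; apply: (can_inj fg); rewrite linearP !gf.
by exists h, f => x; rewrite Hh.
Qed.

Lemma zero_module_iso U V : isomorphic U V -> zero_module U -> zero_module V.
Proof. by move=> [f [g _ gf]] z0 v; rewrite -(gf v) (z0 (g v)) linear0. Qed.

Lemma dsum_zero N b : nonzero_module N -> zero_module (dsum N b) -> b = 0%N.
Proof.
case: b => // b [x /eqP xn] z0; case: xn.
have [d Hd] := dsum_const N b.+1.
by have := congr1 (fun u : dsum N b.+1 => u ord0) (z0 (d x)); rewrite Hd !ffunE.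
Qed.

Lemma ext_isomorphic_cod n L N N' : noetherian R -> isomorphic N N' ->
  ext_zero n L N <-> ext_zero n L N'.
Proof.
move=> Rn iso; split=> V.
  by have [f bf] := iso; apply: (ext_small_iso_cod Rn bf).
by have [f bf] := isomorphic_sym iso; apply: (ext_small_iso_cod Rn bf).
Qed.

Lemma ext_isomorphic_dom n M M' N : isomorphic M M' ->
  ext_zero n M N <-> ext_zero n M' N.
Proof. by move=> [f bf]; apply: ext_zero_iso_dom bf. Qed.

Lemma cycles_iso (X : complex R) (i : int) Z Z' (z : {linear Z -> X i}) (z' : {linear Z' -> X i}) :
  is_cycles z -> is_cycles z' -> isomorphic Z Z'.
Proof.
move=> [iz Hz] [iz' Hz'].
have [|f Hf] := @factor_inj R _ _ _ z' z iz'; first by move=> a; apply/Hz'/Hz; exists a.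
have [|g Hg] := @factor_inj R _ _ _ z z' iz; first by move=> a; apply/Hz/Hz'; exists a.
by exists f, g => a; [apply: iz|apply: iz']; rewrite ?Hg ?Hf ?Hg.
Qed.

(* That is, [n] is P_R(M, N). *)
Definition ext_top M N (n : nat) : Prop :=
  ~ ext_zero n M N /\ forall j, (n < j)%N -> ext_zero j M N.

End IsoLemmas.

(** * The formula when N has finite quasi-injective dimension *)

Section InjectiveCase.
Context {R : comNzRingType} {m : set R}.
Context (noethR : noetherian R) (R_local : local_ring m).
Context (I : complex R) (I_inj : forall i, injective_module (I i)).
Implicit Types (U V W A B C K L M N P Q Z : lmodType R) (i : int).
Context (lo hi : int) (I_lo : forall i, i < lo -> zero_module (I i)).
Context (I_hi : forall i, hi < i -> zero_module (I i)).

Lemma cycles_ext_chain L h (j k : nat) i Z (z : {linear Z -> I i})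
    (Zh : lmodType R) (zh : {linear Zh -> I h}) :
  (forall l, l < h -> zero_module (homology_at l I)) -> i + k%:Z = h ->
  is_cycles z -> is_cycles zh -> ext_zero j.+1 L Z <-> ext_zero (j + k).+1 L Zh.
Proof.
move=> H0; elim: k i j Z z => [|k IH] i j Z z e cz czh.
  rewrite addr0 in e; rewrite addn0; subst h.
  by apply: (ext_isomorphic_cod _ _ noethR); apply: cycles_iso cz czh.
have [Z' [z' cz']] := cycles_exists I (i + 1).
rewrite (cycles_ext_shift noethR I_inj j L cz cz'); last by apply: H0; lia.
by rewrite addnS -addSn; apply: IH cz' czh; lia.
Qed.

Lemma injective_case (M N : lmodType R) (b : int -> nat) e t :
  (forall i, isomorphic (homology_at i I) (dsum N (b i))) ->
  (exists i, b i <> 0%N) -> fg M -> fg N -> nonzero_module N ->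
  dep (m := m) M e -> dep (m := m) R^o t ->
  (forall j, ext_zero j M N) \/ (exists n, ext_top M N n) ->
  exists n, ext_top M N n /\ (n + e)%N = t.
Proof.
move=> Hb [i0 b0] fM fN nN dM dR ext.
have H_fg i : fg (homology_at i I).
  by have [f bf] := isomorphic_sym (Hb i); apply: (fg_iso bf); apply: fg_dsum.
have H0 i : zero_module (homology_at i I) -> b i = 0%N.
  by move=> z0; apply: (dsum_zero nN); apply: zero_module_iso (Hb i) z0.
have VH j i : ext_zero j M N -> ext_zero j M (homology_at i I).
  move=> V; apply/(ext_isomorphic_cod j M noethR (Hb i)).
  exact: (ext_dsum_cod noethR).
have [k rk] := residue_exists R_local.
(* Such a degree exists: otherwise devissage applied to R would make [I] exact, although b_(i0) is
   nonzero. *)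
have [||q [nTq Tq]] := @int_min (fun i => ~ tvan I i k) lo.
- move=> i nT; rewrite leNgt; apply/negP => il; apply: nT => f _.
  by exists \0 => a; rewrite linear0 (I_lo il (f a)).
- apply: contrapT => no; apply: b0; apply: H0; apply/tvan_regular_module.
  apply: (tvan_devissage noethR R_local I_inj I_hi H_fg (q := i0 + 1) rk).
  + by move=> i _; apply: contrapT => nT; apply: no; exists i.
  + exact: fg_regular.
  + by lia.
have {}Tq i : i < q -> tvan I i k by move=> iq; apply: contrapT; apply: Tq.
have [TR nTR] := tvan_dep noethR R_local I_inj I_hi H_fg rk Tq nTq dR (@fg_regular R).
have [TM nTM] := tvan_dep noethR R_local I_inj I_hi H_fg rk Tq nTq dM fM.
have Hz i : i < q + t%:Z -> zero_module (homology_at i I).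
  by move=> /TR/tvan_regular_module.
have nHz : ~ zero_module (homology_at (q + t%:Z) I) by move/tvan_regular_module.
case: ext => [V|[n [nV V]]].
  case: nTM; have [Z' [z' cz']] := cycles_exists I (q + e%:Z + 1).
  apply: (tvan_of_ext noethR cz'); last exact: VH.
  by apply: (cycles_ext_zero noethR I_inj I_hi (n0 := 0) _ cz') => // i j _; apply: VH.
exists n; split=> //.
move: nHz Hz => {TR nTR}; set h := q + t%:Z => nHz Hz.
have VZ i (j : nat) Z (z : {linear Z -> I i}) : is_cycles z -> (n <= j)%N -> ext_zero j.+1 M Z.
  move=> cz nj; apply: (cycles_ext_zero noethR I_inj I_hi (n0 := n.+1) _ cz) => //.
  by move=> i' j' /V; apply: VH.
have [Zh [zh czh]] := cycles_exists I h.
(* There is no homology below [h], so Ext^1(M, Z_(i+1)) shifts up to Ext^(h-i)(M, Z_h), which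
   vanishes because h - i exceeds [n]. *)
have T1 i : i < h - n%:Z -> tvan I i M.
  move=> ih; have [Z' [z' cz']] := cycles_exists I (i + 1).
  apply: (tvan_of_ext noethR cz').
    apply/(cycles_ext_chain (k := absz (h - i - 1)%R) M 0 Hz _ cz' czh); first by lia.
    by apply: (VZ _ _ _ _ czh); lia.
  by apply: ext_zero_cod; apply: Hz; lia.
have nVH : ~ ext_zero n M (homology_at h I).
  move=> /(ext_isomorphic_cod n M noethR (Hb h)) V'; apply: nV.
  apply: (ext_dsum_cod_inv _ V'); rewrite lt0n; apply/eqP => bh; apply: nHz.
  apply: (zero_module_iso (isomorphic_sym (Hb h))); rewrite bh; exact: dsum0_zero.
have [Z' [z' cz']] := cycles_exists I (h + 1).
have [B [c [hh [ee [sb se zb]]]]] := cycles_ses (erefl _) cz' czh.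
have VB : ext_zero n.+1 M B.
  apply: (ext_zero_second_right noethR se); first exact: ext_zero_injective.
  by apply: (VZ _ _ _ _ cz').
(* As Ext^(n+1) of the boundaries vanishes, Ext^n(M, Z_h) maps onto Ext^n(M, H_h), which is nonzero.
   For n = 0 the shift has no Ext^1 to start from, so maps into H_h are lifted by hand. *)
have nT : ~ tvan I (h - n%:Z) M.
  move=> T; apply: nVH; case: n nV V VZ T1 VB T => [|n] nV V VZ T1 VB T.
    apply/ext_zero0 => f a; rewrite subr0 in T.
    have [g Hg] := ext_zero_lift noethR sb (n := 0) VB f.
    have [g' Hg'] := (tvanP M czh).1 T g.
    have [_ _ ex] := sb; have [izh _] := czh.
    rewrite -Hg; apply/ex; exists (ee (g' a)); apply: izh.
    by rewrite zb Hg'.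
  apply: (ext_zero_second_right noethR sb) => //.
  have [Y [y cy]] := cycles_exists I (h - n.+1%:Z + 1).
  have V1 := ext_of_tvan I_inj cy (Hz _ _) T.
  have [|W _] := cycles_ext_chain (k := n) M 0 Hz _ cy czh; first by lia.
  by apply: W; apply: V1; lia.
have e1 : ~ (h - n%:Z < q + e%:Z) by move=> /TM.
have e2 : ~ (q + e%:Z < h - n%:Z) by move=> /T1.
by move: e1 e2; rewrite /h; lia.
Qed.

End InjectiveCase.

(** * Complexes acyclic for Hom *)

Section Covariant.
Context {R : comNzRingType} {m : set R}.
Context (noethR : noetherian R) (R_local : local_ring m).
Implicit Types (U V W A B C K L M N P Q T Z : lmodType R) (i j p q : int).

Definition cocyc (D : complex R) i L (f : hom (D i) L) : Prop :=
  forall j (y : D j), (f : {linear D i -> L}) (diff D j i y) = 0.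

Definition cobd (D : complex R) i L (f : hom (D i) L) : Prop :=
  exists j (g : {linear D j -> L}), forall x, (f : {linear D i -> L}) x = g (diff D i j x).

(* [covan D i L]: the cohomology of Hom(D, L) vanishes in degree [i]. *)
Definition covan (D : complex R) i L : Prop :=
  forall f : hom (D i) L, cocyc f -> cobd f.

Section Complex.
Context (D : complex R).

Lemma cocycP i j L (f : {linear D i -> L}) : j = i + 1 ->
  cocyc f <-> forall y, f (diff D j i y) = 0.
Proof.
move=> ji; split=> [H y|H l y]; first exact: H.
have [li|li] := eqVneq l (i + 1); last by rewrite diff_shape ?linear0.
by move: y; rewrite li -ji => y; apply: H.
Qed.

Lemma cobdP i j L (f : {linear D i -> L}) : i = j + 1 ->
  cobd f <-> exists g : {linear D j -> L}, forall x, f x = g (diff D i j x).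
Proof.
move=> ij; split=> [[l [g Hg]]|[g Hg]]; last by exists j, g.
have [il|il] := eqVneq i (l + 1).
  have e : l = j by apply: (addIr 1); rewrite -il.
  by subst l; exists g.
by exists \0 => x; rewrite Hg diff_shape ?linear0.
Qed.

Lemma submod_cocyc i L : submod (@cocyc D i L).
Proof.
split=> [j y|a f g cf cg j y]; first by [].
rewrite -[LHS]/(a *: (f : {linear D i -> L}) (diff D j i y) + (g : {linear D i -> L}) (diff D j i y)).
by rewrite cf cg scaler0 addr0.
Qed.

Lemma submod_cobd i L : submod (@cobd D i L).
Proof.
have ei : i = i - 1 + 1 by rewrite subrK.
split; first by exists i, \0.
move=> a f g /(cobdP _ ei)[f' Hf] /(cobdP _ ei)[g' Hg].
exists (i - 1), (a *: (f' : hom _ _) + (g' : hom _ _)) => x.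
by rewrite -[LHS]/(a *: (f : {linear D i -> L}) x + (g : {linear D i -> L}) x) Hf Hg.
Qed.

Lemma cobd_cocyc i L (f : hom (D i) L) : cobd f -> cocyc f.
Proof. by move=> [j [g Hg]] l y; rewrite Hg diff_diff linear0. Qed.

(** Weak enough to cover both complexes of projectives and complexes of totally reflexive modules
    with target R. *)
Definition Hom_acyclic L : Prop := forall i n, ext_zero n.+1 (D i) L.

Lemma Hom_acyclic_quot x L C (p : {linear L -> C}) : regular x L -> quot_by x p ->
  Hom_acyclic L -> Hom_acyclic C.
Proof.
by move=> rx qp E i n; apply: (ext_zero_second_right noethR (quot_by_ses rx qp)).
Qed.

Lemma Hom_lift x L C (p : {linear L -> C}) i : regular x L -> quot_by x p ->
  Hom_acyclic L -> forall f : {linear D i -> C},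
  exists g : {linear D i -> L}, forall a, p (g a) = f a.
Proof.
move=> rx qp E f.
exact: (ext_zero_lift noethR (quot_by_ses rx qp) (n := 0) (E i 0%N) f).
Qed.

(** The obstruction to lifting a cocycle from L/xL is a class in degree i + 1 killed by [x]; the
    last hypothesis says that it is zero. *)
Lemma cocyc_lift x L C (p : {linear L -> C}) i (f' : hom (D i) C) :
  regular x L -> quot_by x p -> Hom_acyclic L -> cocyc f' ->
  (forall g : hom (D (i + 1)) L, cocyc g -> cobd (x *: g) -> cobd g) ->
  exists f : hom (D i) L,
    cocyc f /\ forall y, p ((f : {linear _ -> _}) y) = (f' : {linear _ -> _}) y.
Proof.
move=> rx qp E cf' inj; have [f1 Hf1] := Hom_lift rx qp E f'.
have [|g1 Hg1] := ses_factor (quot_by_ses rx qp) (f := f1 \o diff D (i + 1) i).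
  by move=> y; rewrite /= Hf1 (cf' (i + 1)).
have /(cobdP _ (erefl _))[k Hk] : cobd (g1 : hom _ L).
  apply: inj; last by exists i, f1 => y; rewrite -[LHS]/(mulx x L (g1 y)) Hg1.
  move=> j y; apply: rx; have := Hg1 (diff D j (i + 1) y).
  by rewrite /= diff_diff linear0.
exists ((f1 : hom _ _) - x *: (k : hom _ _)); split.
  apply/(cocycP _ (erefl _)) => y.
  rewrite -[LHS]/(f1 (diff D (i + 1) i y) - x *: k (diff D (i + 1) i y)).
  by rewrite -Hk -[f1 _]/((f1 \o diff D (i + 1) i) y) -Hg1 subrr.
move=> y; rewrite -[X in p X = _]/(f1 y - x *: k y) linearB Hf1.
by have -> : p (x *: k y) = 0 by [apply/qp.2; exists (k y)]; rewrite subr0.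
Qed.

Section LowDegrees.
Context (lo : int) (D_lo : forall i, i < lo -> zero_module (D i)).
Context (q : int) (D_exact : forall i, i < q -> zero_module (homology_at i D)).

Lemma low_cycles_ext L : Hom_acyclic L -> forall i, i <= q ->
  forall n Z (z : {linear Z -> D i}), is_cycles z -> ext_zero n.+1 Z L.
Proof.
move=> E; apply: (@int_up _ lo) => [i il _|i IH iq] n Z z cz.
  by apply: ext_zero_dom; apply: cycles_zero cz; apply: D_lo.
have [Z' [z' cz']] := cycles_exists D (i - 1).
have [|B [b [h [e [sb se _]]]]] := cycles_ses (i := i - 1) (i' := i) _ cz cz'.
  by rewrite subrK.
apply: (ext_first_left se) => //; apply: (ext_first_left sb).
  by apply: IH cz'; lia.
by apply: ext_zero_dom; apply: D_exact; lia.
Qed.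

(** Such an [f] lives on the boundaries in degree i - 1. These are all the cycles there, and maps on
    the cycles extend to D_(i-1). *)
Lemma cobd_of_cycles L i (f : {linear D i -> L}) : Hom_acyclic L -> i <= q ->
  (forall x, cycle x -> f x = 0) -> cobd f.
Proof.
move=> E iq kill.
have [Z [z cz]] := cycles_exists D i.
have [Z1 [z1 cz1]] := cycles_exists D (i - 1).
have [Z2 [z2 cz2]] := cycles_exists D (i - 1 - 1).
have [|B [b [h [e [sb se zb]]]]] := cycles_ses (i := i - 1) (i' := i) _ cz cz1.
  by rewrite subrK.
have [|B2 [b2 [h2 [e2 [sb2 se2 zb2]]]]] := cycles_ses (i := i - 1 - 1) (i' := i - 1) _ cz1 cz2.
  by rewrite subrK.
have [_ sre ee] := se.
have [|f1 Hf1] := factor_surj (f := f) sre.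
  by move=> _ /ee[a <-]; apply: kill; apply/(cz.2); exists a.
have [|f2 Hf2] := ext_extend sb _ f1.
  by apply: ext_zero_dom; apply: D_exact; lia.
have [|f3 Hf3] := ext_extend se2 _ f2.
  apply: (ext_first_left sb2); first by apply: low_cycles_ext cz2 => //; lia.
  by apply: ext_zero_dom; apply: D_exact; lia.
by exists (i - 1), f3 => x; rewrite -zb -Hf3 -Hf2 Hf1.
Qed.

Lemma covan_low L i : Hom_acyclic L -> i < q -> covan D i L.
Proof.
move=> E iq f cf; apply: (cobd_of_cycles (f := f)) => //; first exact: ltW.
have /homology_zero H := D_exact iq.
by move=> x /H[j [y <-]]; apply: cf.
Qed.

Context (Hq_nonzero : ~ zero_module (homology_at q D)) (Hq_fg : fg (homology_at q D)).

(** The map is H_q(D) -> k -> L, extended from the cycles to D_q. *)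
Lemma socle_cocycle L : Hom_acyclic L -> socle_nonzero (m := m) L ->
  exists f : hom (D q) L, [/\ cocyc f, ~ cobd f & forall a, m a -> cobd (a *: f)].
Proof.
move=> E [u [un mu]].
have [Z [z cz]] := cycles_exists D q; have [iz Hz] := cz.
have [h [sh Hh]] := homology_class cz.
have [k rk] := residue_exists R_local.
have nH : nonzero_module (homology_at q D) by apply: contrapT => /zero_moduleP.
have [v sv] := residue_quotient noethR R_local rk Hq_fg nH.
have [p [sp Hp]] := rk.
have [g Hg] := scale_map u.
have [|w Hw] := factor_surj (f := g) sp.
  by move=> r /Hp mr; rewrite Hg mu.
have [Z1 [z1 cz1]] := cycles_exists D (q - 1).
have [|B [b [h1 [e [sb se zb]]]]] := cycles_ses (i := q - 1) (i' := q) _ cz cz1.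
  by rewrite subrK.
have [|f Hf] := ext_extend se _ (w \o v \o h).
  apply: (ext_first_left sb); first by apply: low_cycles_ext cz1 => //; lia.
  by apply: ext_zero_dom; apply: D_exact; lia.
exists f; split.
- move=> j y; have bd : bdry (diff D j q y) by exists j, y.
  have /Hz[a Ha] := bdry_cycle bd; rewrite -Ha -Hf /=.
  by have -> : h a = 0 by [apply/Hh; rewrite Ha]; rewrite !linear0.
- move=> [j [f' Hf']]; apply: un.
  have [c Hc] := sv (p 1); have [a Ha] := sh c.
  have := Hf a; rewrite /= Ha Hc Hw Hg scale1r => ->.
  have /(_ j) ca : cycle (z a) by apply/Hz; exists a.
  by rewrite Hf' ca linear0.
- move=> a ma.
  apply: (cobd_of_cycles (f := a *: (f : hom _ _))) => //.
  move=> x /Hz[c <-]; rewrite -[LHS]/(a *: f (z c)) -Hf /=.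
  by rewrite -linearZ (residue_kill R_local _ rk ma) linear0.
Qed.

(* Replacing [L] by [L/xL] with [x] regular lowers both [p] and the depth of [L]
   by one, since [f] becomes the image of a connecting map; at depth zero the
   socle of [L] forces [p = q]. *)
Lemma socle_degree L e : dep (m := m) L e -> Hom_acyclic L -> forall p,
  (forall i, i < p -> covan D i L) ->
  (exists f : hom (D p) L, [/\ cocyc f, ~ cobd f & forall a, m a -> cobd (a *: f)]) ->
  p = q + e%:Z.
Proof.
elim=> {L e} [L sL|L C x pr e mx rx qp _ IH] E p vp [f [cf nf mf]].
  rewrite addr0; have [f' [cf' nf' _]] := socle_cocycle E sL.
  have e1 : ~ (q < p) by move=> /vp/(_ _ cf').
  have e2 : ~ (p < q) by move=> /(covan_low E)/(_ _ cf).
  by lia.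
have ep : p = p - 1 + 1 by rewrite subrK.
have EC := Hom_acyclic_quot rx qp E.
have /(cobdP _ ep)[g Hg] := mf x mx.
suff : p - 1 = q + e%:Z by lia.
apply: IH => //.
  move=> i ip f' cf'.
  have [|f1 [cf1 Hf1]] := cocyc_lift rx qp E cf'.
    by move=> g1 cg1 _; apply: vp => //; lia.
  have [|j [l Hl]] := vp i _ f1 cf1; first by lia.
  by exists j, (pr \o l) => a; rewrite /= -Hl Hf1.
have gx a : g (diff D p (p - 1) a) = x *: (f : {linear _ -> _}) a by rewrite -Hg.
exists (pr \o g : {linear _ -> _}); split.
- apply/(cocycP _ ep) => y /=; rewrite gx.
  by apply/qp.2; exists ((f : {linear _ -> _}) y).
- move=> [j [h' Hh']]; apply: nf.
  have [h Hh] := Hom_lift rx qp E h'.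
  have [|g' Hg'] := ses_factor (quot_by_ses rx qp) (f := g \- (h \o diff D (p - 1) j)).
    by move=> a; rewrite /= linearB Hh -Hh' /= subrr.
  exists (p - 1), g' => a.
  have /eqP := Hg' (diff D p (p - 1) a); rewrite /= diff_diff linear0 subr0 gx.
  rewrite -[mulx x L _]/(x *: _) -subr_eq0 -scalerBr => /eqP/rx/eqP.
  by rewrite subr_eq0 => /eqP e0; rewrite e0.
(* The cochain a g - x b is a cocycle below degree [p], hence a coboundary, and it reduces to a g
   modulo [x]. *)
- move=> a ma; have /(cobdP _ ep)[b Hb] := mf a ma.
  have [||j [l Hl]] := vp (p - 1) _ (a *: (g : hom _ _) - x *: (b : hom _ _)); first by lia.
    apply/(cocycP _ ep) => y.
    rewrite -[LHS]/(a *: g (diff D p (p - 1) y) - x *: b (diff D p (p - 1) y)).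
    by rewrite gx -Hb -[X in _ - _ *: X]/(a *: (f : {linear _ -> _}) y) !scalerA mulrC subrr.
  exists j, (pr \o l) => y; rewrite /= -Hl -[LHS]/(a *: pr (g y)).
  rewrite -[RHS]/(pr (a *: g y - x *: b y)) linearB linearZ.
  by have -> : pr (x *: b y) = 0 by [apply/qp.2; exists (b y)]; rewrite subr0.
Qed.

End LowDegrees.

(* An isomorphism of the cohomology of Hom(D, L) in degree [i] with [T], as a map
   on all cochains that is only meaningful on cocycles. *)
Definition cohomology_iso i L T : Prop :=
  exists pi : hom (D i) L -> T,
    [/\ forall a f g, cocyc f -> cocyc g -> pi (a *: f + g) = a *: pi f + pi g,
        forall t, exists f, cocyc f /\ pi f = t &
        forall f, cocyc f -> pi f = 0 <-> cobd f].

(** [x] is injective on the cohomology in degree i + 1, a power of [M]. So the cohomology with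
    values in L/xL is the old one modulo [x], a power of M/xM. *)
Lemma cohomology_iso_quot i x L L' (p : {linear L -> L'}) M M' (r : {linear M -> M'}) a a1 :
  regular x L -> quot_by x p -> regular x M -> quot_by x r -> Hom_acyclic L ->
  cohomology_iso i L (dsum M a) -> cohomology_iso (i + 1) L (dsum M a1) ->
  cohomology_iso i L' (dsum M' a).
Proof.
move=> rx qp rM qr E [pi [pl ps pk]] [pi1 [pl1 _ pk1]].
have si := quot_by_ses rx qp.
have rT b : regular x (dsum M b).
  move=> u xu; apply/ffunP => j; rewrite ffunE; apply: rM.
  by have := congr1 (fun w : dsum M b => w j) xu; rewrite !ffunE.
have pB f g : cocyc f -> cocyc g -> pi (f - g) = pi f - pi g.
  by move=> cf cg; rewrite addrC -scaleN1r pl // scaleN1r addrC.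
have p0 : pi 0 = 0.
  by apply/pk; [case: (submod_cocyc i L)|case: (submod_cobd i L)].
have pZ c f : cocyc f -> pi (c *: f) = c *: pi f.
  by move=> cf; rewrite -[c *: f]addr0 pl ?p0 ?addr0 //; case: (submod_cocyc i L).
have p10 : pi1 0 = 0.
  by apply/pk1; [case: (submod_cocyc (i + 1) L)|case: (submod_cobd (i + 1) L)].
have divx (f : hom (D i) L) : cocyc f -> (forall y, p ((f : {linear _ -> _}) y) = 0) ->
    exists g : hom (D i) L, cocyc g /\ f = x *: g.
  move=> cf pf; have [g Hg] := ses_factor si pf.
  exists g; split; last by apply: homP => y; rewrite -Hg.
  move=> j y; apply: rx; have := Hg (diff D j i y); rewrite cf => e; exact: e.
have lift (f' : hom (D i) L') : cocyc f' -> exists f : hom (D i) L,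
    cocyc f /\ forall y, p ((f : {linear _ -> _}) y) = (f' : {linear _ -> _}) y.
  move=> cf'; apply: (cocyc_lift rx qp E cf') => g cg bg.
  apply/(pk1 _ cg); apply: rT; rewrite -[RHS]((pk1 _ (cobd_cocyc bg)).2 bg).
  rewrite -[x *: g]addr0 pl1 ?p10 ?addr0 //.
(* The chosen lifts need not be linear in the cocycle; [wd] shows that the resulting class modulo
   [x] does not depend on them. *)
have [s Hs] : exists s : hom (D i) L' -> hom (D i) L, forall f', cocyc f' ->
    cocyc (s f') /\ forall y, p ((s f' : {linear _ -> _}) y) = (f' : {linear _ -> _}) y.
  have ex (f' : hom (D i) L') : exists f : hom (D i) L, cocyc f' ->
      cocyc f /\ forall y, p ((f : {linear _ -> _}) y) = (f' : {linear _ -> _}) y.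
    have [cf'|ncf'] := pselect (cocyc f'); last by exists 0 => /ncf'.
    by have [f Hf] := lift f' cf'; exists f.
  by have [s Hs] := choice ex; exists s.
pose rr (t : dsum M a) : dsum M' a := [ffun o => r (t o)].
have rrl c u v : rr (c *: u + v) = c *: rr u + rr v.
  by apply/ffunP => j; rewrite !ffunE linearP.
have rr0 t : rr t = 0 <-> exists u, t = x *: u.
  split=> [e|[u ->]].
    have H (o : 'I_a) : exists w, t o = x *: w.
      by apply/qr.2; have := congr1 (fun w : dsum M' a => w o) e; rewrite !ffunE.
    have [u Hu] := choice H; exists [ffun o => u o].
    by apply/ffunP => j; rewrite !ffunE.
  by apply/ffunP => j; rewrite !ffunE; apply/qr.2; exists (u j).
have rrB u v : rr (u - v) = rr u - rr v.
  by rewrite addrC -scaleN1r rrl scaleN1r addrC.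
have wd f g : cocyc f -> cocyc g ->
    (forall y, p ((f : {linear _ -> _}) y) = p ((g : {linear _ -> _}) y)) ->
    rr (pi f) = rr (pi g).
  move=> cf cg e; apply/eqP; rewrite -subr_eq0 -rrB -pB //; apply/eqP.
  have [|y|h [ch ->]] := divx (f - g).
  - exact: (submodB (submod_cocyc i L)).
  - by rewrite -[X in p X]/((f : {linear _ -> _}) y - (g : {linear _ -> _}) y) linearB e subrr.
  - by rewrite pZ //; apply/rr0; exists (pi h).
exists (fun f' => rr (pi (s f'))); split.
- move=> c f g cf cg; have [cs1 Hs1] := Hs f cf; have [cs2 Hs2] := Hs g cg.
  have [cs3 Hs3] := Hs (c *: f + g) ((submod_cocyc i L').2 c f g cf cg).
  rewrite -rrl -pl //; apply: wd => //; first exact: (submod_cocyc i L).2.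
  move=> y; rewrite Hs3 -[X in _ = p X]/(c *: (s f : {linear _ -> _}) y + (s g : {linear _ -> _}) y).
  by rewrite linearP Hs1 Hs2.
- move=> t'; have [t Ht] := choice (fun o : 'I_a => qr.1 (t' o)).
  have [f [cf ef]] := ps [ffun o => t o].
  have cpf : cocyc (p \o (f : {linear _ -> _}) : {linear _ -> _}).
    by move=> j y; rewrite /= cf linear0.
  exists (p \o (f : {linear _ -> _}) : {linear _ -> _}); split=> //.
  have [cs1 Hs1] := Hs _ cpf.
  rewrite (wd _ f) // ef; apply/ffunP => j; by rewrite !ffunE Ht.
- move=> f' cf'; have [cs Hss] := Hs f' cf'; split.
    move=> /rr0[u Hu]; have [g [cg eg]] := ps u.
    have cd : cocyc (s f' - x *: g).
      by apply: (submodB (submod_cocyc i L)) => //; apply: (submodZ x (submod_cocyc i L)).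
    have [|j [h Hh]] := (pk _ cd).1.
      rewrite pB ?pZ ?Hu ?eg ?subrr //; exact: (submodZ x (submod_cocyc i L)).
    exists j, (p \o h) => y; rewrite /= -Hh.
    rewrite -[X in _ = p X]/((s f' : {linear _ -> _}) y - x *: (g : {linear _ -> _}) y) linearB Hss.
    by have -> : p (x *: (g : {linear _ -> _}) y) = 0 by [apply/qp.2; eexists]; rewrite subr0.
  move=> [j [h' Hh']]; have [h Hh] := Hom_lift rx qp E h'.
  pose hd : {linear D i -> L} := h \o diff D i j.
  have bhd : cobd (hd : hom _ _) by exists j, h.
  have chd := cobd_cocyc bhd.
  rewrite (wd _ hd) //; last by move=> y; rewrite Hss Hh' /= Hh.
  have -> : pi hd = 0 by apply/pk.
  by apply/rr0; exists 0; rewrite scaler0.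
Qed.

(* Divide [L] and [M] by a common regular element until one of them has a socle;
   if [M] does, [socle_degree] applies, and if only [L] did, [socle_cocycle]
   would put a socle into a power of [M]. *)
Lemma cohomology_depth lo q : (forall i, i < lo -> zero_module (D i)) ->
  (forall i, i < q -> zero_module (homology_at i D)) ->
  ~ zero_module (homology_at q D) -> fg (homology_at q D) ->
  forall d M L e p (a : int -> nat), dep (m := m) M d -> dep (m := m) L e ->
    fg M -> fg L -> Hom_acyclic L ->
    (forall i, cohomology_iso i L (dsum M (a i))) ->
    (forall i, i < p -> a i = 0%N) -> a p <> 0%N -> p + d%:Z = q + e%:Z.
Proof.
move=> Dlo Dex nHq fHq; elim=> [|d IH] M L e p a dM dL fM fL E iso a0 ap.
  rewrite addr0; apply: (socle_degree Dlo Dex nHq fHq dL E).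
    move=> i ip f cf; have [pi [_ _ pk]] := iso i; apply/(pk _ cf).
    by move: (pi f); rewrite a0 // => t; apply: dsum0_zero.
  have [u [un mu]] := dep0P dM; have [pi [pl ps pk]] := iso p.
  have c0 : cocyc (0 : hom (D p) L) by case: (submod_cocyc p L).
  have p0 : pi 0 = 0 by apply/pk => //; case: (submod_cobd p L).
  have [f [cf ef]] := ps [ffun => u]; exists f; split=> //.
    move=> /(pk _ cf); rewrite ef => /(congr1 (fun w : dsum M (a p) => w)) e0.
    case: (a p) ap e0 => // n _ e0; apply: un.
    by have := congr1 (fun w : dsum M n.+1 => w ord0) e0; rewrite !ffunE.
  move=> c mc; apply/pk; first exact: (submodZ c (submod_cocyc p L)).
  rewrite -[c *: f]addr0 pl // p0 addr0 ef; apply/ffunP => j.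
  by rewrite !ffunE mu.
have sM : ~ socle_nonzero (m := m) M.
  by move=> /(dep0_socle noethR R_local dM).
have [sL|sL] := pselect (socle_nonzero (m := m) L).
  have [f [cf nf mf]] := socle_cocycle Dlo Dex nHq fHq E sL.
  have [pi [pl ps pk]] := iso q.
  have c0 : cocyc (0 : hom (D q) L) by case: (submod_cocyc q L).
  have p0 : pi 0 = 0 by apply/pk => //; case: (submod_cobd q L).
  case: sM; apply: contrapT => no; apply: nf; apply/pk => //.
  apply/ffunP => j; rewrite ffunE; apply: contrapT => un; apply: no.
  exists (pi f j); split=> // c mc.
  have /pk e0 := mf c mc.
  have := congr1 (fun w : dsum M (a q) => w j) (e0 (submodZ c (submod_cocyc q L) cf)).
  by rewrite -[c *: f]addr0 pl // p0 addr0 !ffunE.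
have [x [mx rL rM]] := regular_element2 noethR R_local fL fM sL sM.
have [L' [p' qp]] := quot_by_exists x L.
have [M' [r qr]] := quot_by_exists x M.
have [e' [-> dL']] := dep_quot noethR R_local fL mx rL qp dL.
have [d' [[ed] dM']] := dep_quot noethR R_local fM mx rM qr dM.
rewrite -ed in dM'.
have := IH M' L' e' p a dM' dL' (fg_surj qr.1 fM) (fg_surj qp.1 fL)
  (Hom_acyclic_quot rL qp E) _ a0 ap.
have H i : cohomology_iso i L' (dsum M' (a i)).
  exact: (cohomology_iso_quot rL qp rM qr E (iso i) (iso (i + 1))).
by move=> /(_ H); lia.
Qed.

End Complex.
End Covariant.

(** * The dual complex and its cohomology *)

Section DualComplex.
Context {R : comNzRingType} {m : set R}.
Context (noethR : noetherian R) (R_local : local_ring m).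
Implicit Types (U V W A B C K L M N Q T Z : lmodType R).

Lemma dual_basis_projective (Q : lmodType R) : dual_basis Q -> projective_module Q.
Proof.
move=> [n [x [phi H]]] A B g f sg; have [a Ha] := choice (fun i => sg (f (x i))).
have [h Hh] : exists h : {linear Q -> A}, forall v, h v = \sum_(i < n) phi i v *: a i.
  apply: make_linear => c u v; rewrite scaler_sumr -big_split; apply: eq_bigr => i _ /=.
  by rewrite linearP scalerDl -scalerA.
exists h => v; rewrite Hh linear_sum {2}(H v) linear_sum; apply: eq_bigr => i _.
by rewrite !linearZ /= Ha.
Qed.

Lemma dual_basis_form (Q : lmodType R) n (x : nat -> Q) (phi : nat -> {linear Q -> R^o}) :
  (forall v, v = \sum_(i < n) phi i v *: x i) -> forall f : hom Q R^o,
  f = \sum_(i < n) ((f : {linear _ -> _}) (x i) : R) *: (phi i : hom _ _).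
Proof.
move=> H f; apply: homP => v; rewrite {1}(H v) linear_sum.
pose ev : {linear hom Q R^o -> R^o} := eval_at v.
rewrite -[RHS]/(ev _) linear_sum; apply: eq_bigr => i _.
by rewrite !linearZ /= -[LHS]/(phi i v * _) mulrC.
Qed.

Lemma dual_basis_dual (Q : lmodType R) : dual_basis Q -> dual_basis (dual_module Q).
Proof.
move=> [n [x [phi H]]].
exists n, (fun i => phi i : hom _ _), (fun i => eval_at (x i) : {linear _ -> _}) => f.
exact: dual_basis_form.
Qed.

Lemma dual_basis_reflexive (Q : lmodType R) : dual_basis Q -> reflexive Q.
Proof.
move=> [n [x [phi H]]].
exists (fun F : dual_module (dual_module Q) =>
  \sum_(i < n) (F : {linear _ -> R^o}) (phi i : hom _ _) *: x i) => [v|F].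
  by rewrite {2}(H v).
apply: homP => f; rewrite -[LHS]/((f : {linear _ -> _}) _) linear_sum.
rewrite [in RHS](dual_basis_form H f) linear_sum; apply: eq_bigr => i _.
by rewrite !linearZ /= -[LHS]/(_ * _) mulrC.
Qed.

Context (P : complex R).
Implicit Types i j p q : int.

(** Degrees are negated so that the dual is again indexed homologically. *)
Definition dual_obj (i : int) : lmodType R := hom (P (- i)) R^o.
Definition dual_diff i j : {linear dual_obj i -> dual_obj j} :=
  precomp R^o (diff P (- j) (- i)).

Fact dual_shape i j : i != j + 1 -> forall x, dual_diff i j x = 0.
Proof.
move=> ij x; apply: homP => y; rewrite [LHS]precompE diff_shape ?linear0 //.
by apply: contraNneq ij => e; lia.
Qed.

Fact dual_dd i j k x : dual_diff j k (dual_diff i j x) = 0.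
Proof. by apply: homP => y; rewrite /dual_diff [LHS]precompE precompE diff_diff linear0. Qed.

Definition dualc : complex R := Complex dual_shape dual_dd.

Lemma dual_cycleP i (f : dualc i) : cycle f <-> cocyc (f : hom (P (- i)) R^o).
Proof.
split=> [H l y|H j].
  have {}H j : forall y, (f : {linear _ -> _}) (diff P (- j) (- i) y) = 0.
    by move=> z; rewrite -precompE -[precomp _ _ _]/(diff dualc i j f) H.
  by have := H (- l); rewrite opprK; apply.
by apply: homP => y; rewrite [LHS]precompE H.
Qed.

Lemma dual_bdryP i (f : dualc i) : bdry f <-> cobd (f : hom (P (- i)) R^o).
Proof.
split=> [[j [g <-]]|[l [g Hg]]].
  by exists (- j), g => x.
move: g Hg; rewrite -(opprK l) => g Hg; exists (- l), (g : hom _ _).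
by apply: homP => y; rewrite [LHS]precompE Hg.
Qed.

Lemma dual_homology_zero i :
  zero_module (homology_at i dualc) <-> covan P (- i) R^o.
Proof.
rewrite homology_zero; split=> H f.
  by move=> /dual_cycleP/H/dual_bdryP.
by move=> /dual_cycleP/H/dual_bdryP.
Qed.

(** By reflexivity every cochain on the dual is evaluation at an element of P, and cocycles and
    coboundaries match cycles and boundaries. *)
Lemma dual_cohomology_iso i T : (forall j, reflexive (P j)) ->
  isomorphic (homology_at (- i) P) T -> cohomology_iso dualc i R^o T.
Proof.
move=> refl [phi [psi phiK psiK]].
have inj j : injective (@biduality R (P j)) by apply: bij_inj; apply: refl.
have sur j (F : hom (hom (P j) R^o) R^o) : exists v, biduality v = F.
  by have [g _ gf] := refl j; exists (g F); rewrite gf.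
have [Z [z cz]] := cycles_exists P (- i); have [iz Hz] := cz.
have [h [sh Hh]] := homology_class cz.
have bE j (v : P j) (y : {linear P j -> R^o}) : (biduality v : {linear _ -> _}) (y : hom _ _) = y v by [].
have cE (v : P (- i)) : cocyc (D := dualc) (i := i) (biduality v) <-> cycle v.
  split=> [H l|H j y].
    apply: inj; apply: homP => y; rewrite bE.
    have {}H j : forall y : {linear P (- j) -> R^o}, y (diff P (- i) (- j) v) = 0.
      by move=> y'; have := H j (y' : hom _ _).
    have -> : (biduality 0 : {linear _ -> _}) y = (y : {linear _ -> _}) 0 by [].
    by have := H (- l); rewrite opprK => ->; rewrite linear0.
  by rewrite bE /= H linear0.
have dE (v : P (- i)) : cobd (D := dualc) (i := i) (biduality v) <-> bdry v.
  split=> [[j [F HF]]|[l [u Hu]]].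
    have [u Hu] := sur _ F; exists (- j), u; apply: inj; apply: homP => y.
    by have := HF y; rewrite -Hu.
  move: u Hu; rewrite -(opprK l) => u Hu.
  by exists (- l), (biduality u) => y; rewrite -Hu.
pose class (F : hom (dualc i) R^o) t := cocyc F -> exists a, biduality (z a) = F /\ t = phi (h a).
have ex F : exists t, class F t.
  have [v Hv] := sur _ F; have [cF|ncF] := pselect (cocyc F); last by exists 0 => /ncF.
  have /Hz[a Ha] : cycle v by apply/cE; rewrite Hv.
  by exists (phi (h a)) => _; exists a; rewrite Ha.
have [pi Hpi] := choice ex.
exists pi; split.
- move=> a f g cf cg; have [u [eu ->]] := Hpi f cf; have [v [ev ->]] := Hpi g cg.
  have [w [ew ->]] := Hpi (a *: f + g) ((submod_cocyc _ _ _).2 a f g cf cg).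
  rewrite -!linearP; congr (phi (h _)); apply: iz; apply: inj; rewrite ew -eu -ev.
  apply: homP => y; rewrite bE !linearP.
  by [].
- move=> t; have [a Ha] := sh (psi t).
  have cF : cocyc (D := dualc) (i := i) (biduality (z a)) by apply/cE/Hz; exists a.
  exists (biduality (z a)); split=> //.
  have [b [eb ->]] := Hpi _ cF.
  by have -> : b = a by [apply: iz; apply: inj]; rewrite Ha psiK.
- move=> F cF; have [a [ea ->]] := Hpi F cF; rewrite -ea dE -Hh.
  split=> [e|->]; last exact: linear0.
  by apply: (can_inj phiK); rewrite e linear0.
Qed.

Lemma dual_homology_fg i : (forall j, fg (P j)) -> fg (homology_at i dualc).
Proof.
move=> fP; have [Z [z cz]] := cycles_exists dualc i.
have [h [sh _]] := homology_class cz.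
apply: (fg_surj sh); apply: (fg_sub noethR cz.1).
exact: (fg_hom noethR (fP _) (@fg_regular R)).
Qed.

Section DepthFormula.
Context (lo hi : int).
Context (P_hi : forall i, hi < i -> zero_module (P i)).
Context (P_reflexive : forall i, reflexive (P i)) (P_fg : forall i, fg (P i)).
Context (P_acyclic : Hom_acyclic dualc R^o).
Context (M : lmodType R) (a : int -> nat).
Context (P_homology : forall i, isomorphic (homology_at i P) (dsum M (a i))).
Context (s : int) (a_s : a s <> 0%N).

Let dual_lo i : i < - hi -> zero_module (dualc i).
Proof.
move=> il f; apply: homP => v; have /P_hi z0 : hi < - i by lia.
by rewrite (z0 v) !linear0.
Qed.

(** Otherwise the dual complex is exact, bounded below and acyclic for Hom into R, so dualizing
    again makes P exact as well, against a_s being nonzero. *)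
Lemma covan_regular_not_all : nonzero_module M -> ~ forall i, covan P i R^o.
Proof.
move=> [u /eqP un] H; case: (a s) a_s (P_homology s) => // b _ iso.
move: iso; rewrite -{1}(opprK s) => iso.
have [pi [pl ps pk]] := dual_cohomology_iso P_reflexive iso.
have ex i : zero_module (homology_at i dualc) by apply/dual_homology_zero.
have [f [cf ef]] := ps [ffun => u]; apply: un.
have bf : cobd f.
  by apply: (covan_low dual_lo (q := - s + 1) (fun i _ => ex i) P_acyclic) => //; lia.
have /(congr1 (fun w : dsum M b.+1 => w ord0)) := (pk f cf).2 bf.
by rewrite ef !ffunE.
Qed.

Lemma dual_depth_formula d t c : dep (m := m) M d -> dep (m := m) R^o t -> fg M ->
  (forall i, s < i -> a i = 0%N) ->
  (forall i, c < i -> covan P i R^o) -> ~ covan P c R^o ->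
  c + d%:Z = s + t%:Z.
Proof.
move=> dM dR fM a0 vc nc.
have iso i : cohomology_iso dualc i R^o (dsum M (a (- i))).
  by apply: dual_cohomology_iso.
have := cohomology_depth noethR R_local dual_lo (q := - c) _ _
  (dual_homology_fg (- c) P_fg) (a := fun i => a (- i)) (p := - s) dM dR fM (@fg_regular R) P_acyclic iso.
have H1 i : i < - c -> zero_module (homology_at i dualc).
  by move=> ic; apply/dual_homology_zero; apply: vc; lia.
have H2 : ~ zero_module (homology_at (- c) dualc).
  by move/dual_homology_zero; rewrite opprK.
have H3 i : i < - s -> a (- i) = 0%N by move=> is0; apply: a0; lia.
by move=> /(_ H1 H2 H3); rewrite opprK => /(_ a_s); lia.
Qed.

End DepthFormula.
End DualComplex.

(** * Quasi-projective resolutions in the first variable *)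

Section CornerFirst.
Context {R : comNzRingType}.
Implicit Types (U V W A B C K L M N Q T Z : lmodType R).

Lemma ext_zero1_of_extend A B C (i : {linear A -> B}) (p : {linear B -> C}) N :
  ses i p -> ext_zero 1 B N ->
  (forall f : {linear A -> N}, exists g : {linear B -> N}, forall a, f a = g (i a)) ->
  ext_zero 1 C N.
Proof.
move=> si VB ext.
have [P [K [K' [kB [c [kC [j [r [pP sB sC sj [kj ir]]]]]]]]]] := ses_rotate si.
apply/(ext_zero1 N sC pP) => f.
have [g Hg] := (ext_zero1 N sB pP).1 VB (f \o j).
have [_ sr er] := sj.
have [|h Hh] := factor_surj (f := f \- (g \o kC)) sr.
  by move=> _ /er[b <-]; rewrite /= kj -Hg subrr.
have [h' Hh'] := ext h.
exists (g \+ (h' \o c)) => x; rewrite /= -ir -Hh' Hh /=.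
by rewrite addrC subrK.
Qed.

Context (P : complex R).
Implicit Types i j p q : int.

Definition is_coker i C (c : {linear P i -> C}) : Prop :=
  surj c /\ forall x, c x = 0 <-> bdry x.

Lemma coker_exists i : exists C (c : {linear P i -> C}), is_coker c.
Proof. exact: quotient_exists (submod_bdry P i). Qed.

Lemma coker_iso i C C' (c : {linear P i -> C}) (c' : {linear P i -> C'}) :
  is_coker c -> is_coker c' -> isomorphic C C'.
Proof.
move=> [sc Hc] [sc' Hc'].
have [|f Hf] := factor_surj (f := c') sc; first by move=> x /Hc/Hc'.
have [|g Hg] := factor_surj (f := c) sc'; first by move=> x /Hc'/Hc.
exists f, g => y; first by have [x <-] := sc y; rewrite Hf Hg.
by have [x <-] := sc' y; rewrite Hg Hf.
Qed.

(** The counterpart of [cycles_ses] for contravariant use: cokernels of differentials take the place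
    of cycles. *)
Lemma coker_ses i i' C' (c' : {linear P i' -> C'}) C (c : {linear P i -> C}) :
  i' = i + 1 -> is_coker c' -> is_coker c ->
  exists B (h : {linear homology_at i' P -> C'}) (e : {linear C' -> B}) (b : {linear B -> P i}),
    [/\ ses h e, ses b c & forall x, b (e (c' x)) = diff P i' i x].
Proof.
move=> ei [sc' Hc'] [sc Hc].
have [B [b [ib Hb]]] := submodule_exists (submod_bdry P i).
have [|d Hd] := @factor_inj R _ _ _ b (diff P i' i) ib.
  by move=> x; apply/Hb; exists i', x.
have [|e He] := factor_surj (f := d) sc'.
  move=> x /Hc'/bdry_cycle cx; apply: ib; by rewrite Hd cx linear0.
have [Z [z cz]] := cycles_exists P i'; have [iz Hz] := cz.
have [cl [scl Hcl]] := homology_class cz.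
have [|h Hh] := factor_surj (f := c' \o z) scl.
  by move=> a /Hcl/Hc'.
exists B, h, e, b; split; last by move=> x; rewrite He Hd.
- split.
  + apply: injective_ker => y; have [a <-] := scl y; rewrite Hh /= => /Hc'.
    by move/Hcl.
  + move=> y; have /Hb/(bdryP _ ei)[x Hx] : exists a, b a = b y by exists y.
    by exists (c' x); rewrite He; apply: ib; rewrite Hd.
  + move=> y; have [x <-] := sc' y; rewrite He; split=> [dx|[w Hw]].
      have /Hz[a Ha] : cycle x by apply/(cycleP _ ei); rewrite -Hd dx linear0.
      by exists (cl a); rewrite Hh /= Ha.
    have [a Ha] := scl w; move: Hw; rewrite -Ha Hh /= => e'.
    have ca : cycle (z a) by apply/Hz; exists a.
    rewrite -He -e' He; apply: ib.
    by rewrite Hd linear0; apply: ca.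
- split=> // x; rewrite Hc Hb.
  by split=> -[a <-]; exists a.
Qed.

Section Target.
Context (N : lmodType R) (P_acyclic : Hom_acyclic P N).

Lemma covan_of_ext i C (c : {linear P (i - 1) -> C}) : is_coker c ->
  ext_zero 1 C N -> ext_zero 0 (homology_at i P) N -> covan P i N.
Proof.
move=> cc V1 /ext_zero0 V0 f cf.
have [C' [c' cc']] := coker_exists i.
have [|B [h [e [b [sh sb bE]]]]] := coker_ses (i := i - 1) (i' := i) _ cc' cc.
  by rewrite subrK.
have [|f1 Hf1] := factor_surj (f := f : {linear _ -> _}) cc'.1.
  by move=> x /cc'.2[j [y <-]].
have [_ se ee] := sh.
have [|f2 Hf2] := factor_surj (f := f1) se.
  by move=> _ /ee[y <-]; rewrite -[LHS]/((f1 \o h) y) V0.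
have [g Hg] := ext_extend sb V1 f2.
by exists (i - 1), g => x; rewrite -bE -Hg Hf2 Hf1.
Qed.

Lemma ext_of_covan i C (c : {linear P (i - 1) -> C}) : is_coker c ->
  zero_module (homology_at i P) -> covan P i N -> ext_zero 1 C N.
Proof.
move=> cc z0 T; have [C' [c' cc']] := coker_exists i.
have ei : i = i - 1 + 1 by rewrite subrK.
have [B [h [e [b [sh sb bE]]]]] := coker_ses ei cc' cc.
apply: (ext_zero1_of_extend sb); first exact: P_acyclic.
move=> f; pose fe : {linear P i -> N} := f \o e \o c'.
have [|g Hg] := (cobdP _ ei).1 (T fe _).
  move=> j y; rewrite /fe /=.
  have -> : c' (diff P j i y) = 0 by apply/cc'.2; exists j, y.
  by rewrite !linear0.
exists g => y; have [_ se _] := sh; have [w <-] := se y; have [x <-] := cc'.1 w.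
by rewrite bE -Hg.
Qed.

Lemma coker_ext_shift i (j : nat) C (c : {linear P (i - 1) -> C}) C' (c' : {linear P i -> C'}) :
  is_coker c -> is_coker c' -> zero_module (homology_at i P) ->
  ext_zero j.+1 C' N <-> ext_zero j.+2 C N.
Proof.
move=> cc cc' z0; have ei : i = i - 1 + 1 by rewrite subrK.
have [B [h [e [b [sh sb _]]]]] := coker_ses ei cc' cc.
have V0 l : ext_zero l (homology_at i P) N by apply: ext_zero_dom.
split=> V.
  by apply: (ext_first_right sb) => //; apply: (ext_first_right sh).
by apply: (ext_first_mid sh) => //; apply: (ext_first_left sb).
Qed.

Lemma coker_ext_chain s (j k : nat) i C (c : {linear P i -> C})
    (Cs : lmodType R) (cs : {linear P s -> Cs}) :
  (forall l, s < l -> zero_module (homology_at l P)) -> i = s + k%:Z ->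
  is_coker c -> is_coker cs -> ext_zero j.+1 C N <-> ext_zero (j + k).+1 Cs N.
Proof.
move=> H0; elim: k i j C c => [|k IH] i j C c e cc ccs.
  rewrite addr0 in e; rewrite addn0; subst i.
  by apply: ext_isomorphic_dom; apply: coker_iso cc ccs.
have [C' [c' cc']] := coker_exists (i - 1).
rewrite (coker_ext_shift j cc' cc); last by apply: H0; lia.
by rewrite addnS -addSn; apply: IH cc' ccs; lia.
Qed.

Context (lo : int) (P_lo : forall i, i < lo -> zero_module (P i)).

Lemma coker_ext_zero n0 :
  (forall i (j : nat), (n0 <= j)%N -> ext_zero j (homology_at i P) N) ->
  forall i (j : nat) C (c : {linear P i -> C}), is_coker c ->
    (n0 <= j.+1)%N -> ext_zero j.+1 C N.
Proof.
move=> VH; apply: (@int_up _ lo) => [i il|i IH] j C c cc nj.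
  apply: ext_zero_dom => y; have [x <-] := cc.1 y.
  by rewrite (P_lo il x) linear0.
have [C' [c' cc']] := coker_exists (i - 1).
have [|B [h [e [b [sh sb _]]]]] := coker_ses (i := i - 1) (i' := i) _ cc cc'.
  by rewrite subrK.
apply: (ext_first_mid sh); first exact: VH.
apply: (ext_first_left sb); first exact: P_acyclic.
by apply: IH cc' _; apply: leq_trans nj _.
Qed.

Context (M : lmodType R) (a : int -> nat) (s : int).
Context (P_homology : forall i, isomorphic (homology_at i P) (dsum M (a i))).
Context (a_s : a s <> 0%N) (a_top : forall i, s < i -> a i = 0%N).

Let VH (j : nat) i : ext_zero j M N -> ext_zero j (homology_at i P) N.
Proof.
move=> V; apply/(ext_isomorphic_dom j N (P_homology i)).
exact: ext_dsum_dom.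
Qed.

Lemma corner_all_zero : (forall j : nat, ext_zero j M N) -> forall i, covan P i N.
Proof.
move=> V i; have [C [c cc]] := coker_exists (i - 1).
apply: (covan_of_ext cc); last exact: VH.
by apply: (coker_ext_zero (n0 := 0) _ cc) => // l j _; apply: VH.
Qed.

(** Above [s] the complex is exact, so Ext^1 of the cokernel in degree s + k shifts to Ext^(k+1) of
    the one in degree s. The latter maps onto Ext of H_s in degree [n], because Ext^(n+1) of the
    boundaries in degree s - 1 vanishes. *)
Lemma corner_top n : ext_top M N n ->
  (forall i, s + n%:Z < i -> covan P i N) /\ ~ covan P (s + n%:Z) N.
Proof.
move=> [nV V].
have H0 i : s < i -> zero_module (homology_at i P).
  move=> si; apply: (zero_module_iso (isomorphic_sym (P_homology i))).
  by rewrite a_top //; apply: dsum0_zero.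
have VC i (j : nat) C (c : {linear P i -> C}) : is_coker c -> (n <= j)%N -> ext_zero j.+1 C N.
  move=> cc nj; apply: (coker_ext_zero (n0 := n.+1) _ cc) => //.
  by move=> i' j' /V; apply: VH.
have [Cs [cs ccs]] := coker_exists s.
have T1 i : s + n%:Z < i -> covan P i N.
  move=> ih; have [C [c cc]] := coker_exists (i - 1).
  apply: (covan_of_ext cc).
    apply/(coker_ext_chain (k := absz (i - 1 - s)%R) 0 H0 _ cc ccs); first by lia.
    by apply: (VC _ _ _ _ ccs); lia.
  by apply: ext_zero_dom; apply: H0; lia.
split=> // T.
have nVH : ~ ext_zero n (homology_at s P) N.
  move=> /(ext_isomorphic_dom n N (P_homology s)) V'; apply: nV.
  apply: (ext_dsum_dom_inv _ V'); rewrite lt0n; exact/eqP.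
apply: nVH.
have [C [c cc]] := coker_exists (s - 1).
have es : s = s - 1 + 1 by rewrite subrK.
have [B [h [e [b [sh sb bE]]]]] := coker_ses es ccs cc.
have VB : ext_zero n.+1 B N.
  apply: (ext_first_left sb); first exact: P_acyclic.
  by apply: (VC _ _ _ _ cc).
case: n nV V VC T1 VB T => [|n] nV V VC T1 VB T.
  apply/ext_zero0 => f x; rewrite addr0 in T.
  have [g Hg] := ext_extend sh VB f.
  pose gc : {linear P s -> N} := g \o cs.
  have [|g' Hg'] := (cobdP _ es).1 (T gc _).
    move=> j y; rewrite /gc /=.
    have -> : cs (diff P j s y) = 0 by apply/ccs.2; exists j, y.
    by rewrite linear0.
  have [y Hy] := ccs.1 (h x).
  rewrite Hg -Hy -[LHS]/(gc y) Hg' -bE Hy.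
  by rewrite (ses_comp _ sh) !linear0.
apply: (ext_first_left sh) => //.
have [C1 [c1 cc1]] := coker_exists (s + n.+1%:Z - 1).
have V1 : ext_zero 1 C1 N by apply: (ext_of_covan cc1 _ T); apply: H0; lia.
have [|W _] := coker_ext_chain (k := n) 0 H0 _ cc1 ccs; first by lia.
exact: W.
Qed.

End Target.
End CornerFirst.

(** * The formula when M has finite quasi-projective dimension *)

Section ProjectiveCase.
Context {R : comNzRingType} {m : set R}.
Context (noethR : noetherian R) (R_local : local_ring m).
Context (P : complex R) (P_proj : forall i, projective_module (P i)).
Context (P_fg : forall i, fg (P i)).
Implicit Types (U V W A B C K L M N Q T Z : lmodType R) (i j p q : int).

Lemma covan_zero i L : zero_module L -> covan P i L.
Proof. by move=> z0 f _; exists i, \0 => x; apply: z0. Qed.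

Lemma covan_mid i A B C (u : {linear A -> B}) (p : {linear B -> C}) :
  ses u p -> covan P i A -> covan P i C -> covan P i B.
Proof.
move=> si TA TC f cf; have [iu sp ex] := si.
have ei : i = i - 1 + 1 by rewrite subrK.
pose pf : {linear P i -> C} := p \o (f : {linear _ -> _}).
have [|g Hg] := (cobdP _ ei).1 (TC pf _).
  by move=> j y; rewrite /pf /= cf linear0.
have [g' Hg'] := P_proj g sp.
have [|h Hh] := ses_factor si (f := (f : {linear _ -> _}) \- (g' \o diff P i (i - 1))).
  by move=> x; rewrite /= linearB Hg' -Hg subrr.
have [|k Hk] := (cobdP _ ei).1 (TA h _).
  move=> j y; apply: iu; rewrite Hh /= cf diff_diff linear0 sub0r oppr0 linear0 //.
exists (i - 1), (g' \+ (u \o k)) => x.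
by rewrite /= -Hk Hh /= addrC subrK.
Qed.

Lemma covan_right i A B C (u : {linear A -> B}) (p : {linear B -> C}) :
  ses u p -> covan P (i + 1) A -> covan P i B -> covan P i C.
Proof.
move=> si TA TB f cf; have [iu sp ex] := si.
have [g Hg] := P_proj (f : {linear _ -> _}) sp.
have [|h Hh] := ses_factor si (f := g \o diff P (i + 1) i).
  by move=> y; rewrite /= Hg cf.
have [|k Hk] := (cobdP _ (erefl (i + 1))).1 (TA h _).
  by move=> j y; apply: iu; rewrite Hh /= diff_diff !linear0.
have [|j [l Hl]] := TB (g \- (u \o k) : {linear _ -> _}).
  apply/(cocycP _ (erefl _)) => y.
  by rewrite /= -Hk Hh /= subrr.
exists j, (p \o l) => x; rewrite /= -Hl /= linearB Hg.
by rewrite (ses_comp _ si) subr0.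
Qed.

(** If the cohomology with values in L/xL vanishes, [x] acts surjectively on the one with values in
    [L], and Nakayama's lemma applies. *)
Lemma covan_regular_quot i x L C (p : {linear L -> C}) : fg L -> m x -> regular x L ->
  quot_by x p -> covan P i C -> covan P i L.
Proof.
move=> fL mx rx qp TC; have si := quot_by_ses rx qp; have [_ sp ex] := si.
have ei : i = i - 1 + 1 by rewrite subrK.
have [K [k [ik Hk]]] := submodule_exists (submod_cocyc P i L).
have fK : fg K by apply: (fg_sub noethR ik); apply: fg_hom.
pose U := k @^-1` (@cobd R P i L).
have SU : submod U := submod_preim k (submod_cobd P i L).
suff H : forall v, U v by move=> f /Hk[v <-]; apply: H.
apply: (nakayama1 noethR R_local mx SU).
  by have [s [_ Hs]] := small_fg SU fK; exists s.
move=> v; have cv : cocyc (k v) by apply/Hk; exists v.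
pose pf : {linear P i -> C} := p \o (k v : {linear _ -> _}).
have [|g Hg] := (cobdP _ ei).1 (TC pf _).
  by move=> j y; rewrite /pf /= cv linear0.
have [g' Hg'] := P_proj g sp.
have [|h Hh] := ses_factor si (f := (k v : {linear _ -> _}) \- (g' \o diff P i (i - 1))).
  by move=> y; rewrite /= linearB Hg' -Hg subrr.
have /Hk[w Hw] : cocyc (h : hom _ _).
  move=> j y; apply: rx; have := Hh (diff P j i y).
  by rewrite /= cv diff_diff linear0 subrr.
exists w; rewrite /U /= linearB linearZ /= Hw; exists (i - 1), g' => y.
rewrite -[LHS]/((k v : {linear _ -> _}) y - x *: h y) -[x *: h y]/(mulx x L (h y)) Hh.
by rewrite /= subKr.
Qed.

Lemma covan_all i N : fg N -> nonzero_module N ->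
  (forall L, fg L -> covan P (i + 1) L) -> covan P i N ->
  forall L, fg L -> covan P i L.
Proof.
move=> fN nN next TN; apply: (devissage noethR R_local).
- by move=> L z0; apply: covan_zero.
- move=> k rk; have [u su] := residue_quotient noethR R_local rk fN nN.
  have [A [j sj]] := ses_of_surj su; have [ij _ _] := sj.
  by apply: (covan_right sj) => //; apply: next; apply: fg_sub ij fN.
- by move=> A B C u p _ _ _ si TA TC; apply: (covan_mid si).
- by move=> x L C p fL mx rx qp TC; apply: (covan_regular_quot fL mx rx qp TC).
Qed.

Context (hi : int) (P_hi : forall i, hi < i -> zero_module (P i)).

Lemma covan_above N c : fg N -> nonzero_module N -> (forall i, c < i -> covan P i N) ->
  forall i, c < i -> forall L, fg L -> covan P i L.
Proof.
move=> fN nN TN; apply: (@int_down _ hi) => [i ih _ L _ f _|i IH ic].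
  by exists i, \0 => x; rewrite (P_hi ih x) linear0.
by apply: (covan_all fN nN); [apply: IH; lia|apply: TN].
Qed.

Lemma projective_acyclic N : Hom_acyclic P N.
Proof. by move=> i n; apply: ext_zero_projective. Qed.

Lemma projective_dual_acyclic : Hom_acyclic (dualc P) R^o.
Proof.
move=> i n; apply: ext_zero_projective; apply: dual_basis_projective.
exact/dual_basis_dual/dual_basis_fg_projective.
Qed.

Lemma projective_reflexive i : reflexive (P i).
Proof. by apply: dual_basis_reflexive; apply: dual_basis_fg_projective. Qed.

Context (lo : int) (P_lo : forall i, i < lo -> zero_module (P i)).

Lemma projective_case M N (a : int -> nat) d t :
  (forall i, isomorphic (homology_at i P) (dsum M (a i))) ->
  (exists i, a i <> 0%N) -> fg M -> nonzero_module M -> fg N -> nonzero_module N ->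
  dep (m := m) M d -> dep (m := m) R^o t ->
  (forall j : nat, ext_zero j M N) \/ (exists n, ext_top M N n) ->
  exists n, ext_top M N n /\ (n + d)%N = t.
Proof.
move=> Ha exa fM nM fN nN dM dR ext.
(* The top degree with homology is found as a minimum after negation. *)
have [||s' [as0 atop]] := @int_min (fun i => a (- i) <> 0%N) (- hi).
- move=> i ai; rewrite leNgt; apply/negP => ih; apply: ai.
  apply: (dsum_zero nM); apply: zero_module_iso (Ha (- i)) _.
  by apply: zero_homology; apply: P_hi; lia.
- by have [i ai] := exa; exists (- i); rewrite opprK.
set s := - s' in as0.
have a_top i : s < i -> a i = 0%N.
  by move=> si; apply: contrapT => ai; apply: (atop (- i)); rewrite ?opprK /s in si *; lia.
have nall := covan_regular_not_all P_hi projective_reflexive projective_dual_acyclic Ha as0 nM.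
(* If every Ext vanished, Hom(P, N) would be exact, and then Hom(P, R) too, contrary to [nall]. *)
case: ext => [V|[n tn]].
  case: nall => i; have T := corner_all_zero (projective_acyclic N) P_lo Ha V.
  by apply: (@covan_above N (i - 1)) => //; [lia|exact: fg_regular].
exists n; split=> //.
have [T1 T2] := corner_top (projective_acyclic N) P_lo Ha as0 a_top tn.
have above := covan_above fN nN T1.
have := dual_depth_formula noethR R_local P_hi projective_reflexive P_fg
  projective_dual_acyclic Ha as0 (c := s + n%:Z) dM dR fM a_top.
have H1 i : s + n%:Z < i -> covan P i R^o by move=> si; apply: above => //; apply: fg_regular.
have H2 : ~ covan P (s + n%:Z) R^o.
  move=> T; apply: T2; apply: (covan_all (@fg_regular R) _ _ T fN).
    by have [k [p [sp Hp]]] := residue_exists R_local; exists 1; apply: oner_neq0.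
  by move=> L fL; apply: above => //; lia.
by move=> /(_ H1 H2); lia.
Qed.

End ProjectiveCase.

(** * Finite Gorenstein dimension *)

Section NatComplex.
Context {R : comNzRingType}.
Implicit Types (U V W A B C K L M N Q T Z : lmodType R).
Context (G : nat -> lmodType R) (d : forall i, {linear G i.+1 -> G i}).
Context (dd : forall i x, d i (d i.+1 x) = 0).

(** A [complex] needs a map for every pair of degrees, so the given differential is transported
    along a decided equality of indices. *)
Definition nat_diff (i j : nat) : {linear G i -> G j} :=
  if i =P j.+1 is ReflectT e
  then eq_rect j.+1 (fun l => {linear G l -> G j}) (d j) i (esym e) else \0.

Lemma nat_diffS j : nat_diff j.+1 j = d j.
Proof.
rewrite /nat_diff; case: eqP => // e.
by rewrite (eq_irrelevance e (erefl _)).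
Qed.

Definition nat_obj (i : int) : lmodType R :=
  if i is Posz n then G n else dsum R^o 0.

Definition nat_obj_diff (i j : int) : {linear nat_obj i -> nat_obj j} :=
  match i, j return {linear nat_obj i -> nat_obj j} with
  | Posz i', Posz j' => nat_diff i' j'
  | _, _ => \0
  end.

Fact nat_shape i j : i != j + 1 -> forall x, nat_obj_diff i j x = 0.
Proof.
case: i j => [i|i] [j|j] //= ij x; rewrite /nat_diff; case: eqP => // e.
by case/eqP: ij; rewrite e; lia.
Qed.

Fact nat_dd i j l x : nat_obj_diff j l (nat_obj_diff i j x) = 0.
Proof.
case: i j l x => [i|i] [j|j] [l|l] x //=; rewrite ?linear0 //.
have [ji|ij] := eqVneq i j.+1; last first.
  by rewrite (@nat_shape (Posz i) (Posz j)) ?linear0 //; apply: contraNneq ij; lia.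
have [lj|jl] := eqVneq j l.+1; last first.
  by rewrite [LHS](@nat_shape (Posz j) (Posz l)) //; apply: contraNneq jl; lia.
by subst i j; rewrite !nat_diffS dd.
Qed.

Definition nat_complex : complex R := Complex nat_shape nat_dd.

Lemma nat_complex_lo i : i < 0 -> zero_module (nat_complex i).
Proof. by case: i => [i|i] // _; apply: dsum0_zero. Qed.

Lemma nat_bdryP n (x : G n) : bdry (X := nat_complex) (i := Posz n) x <-> exists y, d n y = x.
Proof.
rewrite (@bdryP _ nat_complex (Posz n.+1) (Posz n)); last by lia.
by rewrite /= nat_diffS.
Qed.

Lemma nat_homologyS n : exact_at (d n.+1) (d n) ->
  zero_module (homology_at (Posz n.+1) nat_complex).
Proof.
move=> ex; apply/homology_zero => x.
rewrite (@cycleP _ nat_complex (Posz n.+1) (Posz n)); last by lia.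
by rewrite /= nat_diffS => /ex H; apply/nat_bdryP.
Qed.

Lemma nat_coker0 M (e : {linear G 0 -> M}) : surj e -> exact_at (d 0) e ->
  is_coker (P := nat_complex) (i := 0) e.
Proof. by move=> se ex; split=> // x; rewrite ex nat_bdryP. Qed.

Lemma nat_homology0 M (e : {linear G 0 -> M}) : surj e -> exact_at (d 0) e ->
  isomorphic (homology_at 0 nat_complex) M.
Proof.
move=> se ex.
have cz : is_cycles (X := nat_complex) (i := 0) (idfun : {linear G 0 -> G 0}).
  split=> // x; split=> _; first by exists x.
  by case=> [j|j] //=; rewrite /nat_diff; case: eqP.
have [h [sh Hh]] := homology_class cz.
have [|f Hf] := factor_surj (f := e) sh.
  by move=> x /Hh/nat_bdryP/ex.
have [|g Hg] := factor_surj (f := h) se.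
  by move=> x /ex H; apply/Hh/nat_bdryP.
exists f, g => y; first by have [x <-] := sh y; rewrite Hf Hg.
by have [x <-] := se y; rewrite Hg Hf.
Qed.

End NatComplex.

Section GorensteinCase.
Context {R : comNzRingType} {m : set R}.
Context (noethR : noetherian R) (R_local : local_ring m).
Implicit Types (U V W A B C K L M N Q T Z : lmodType R).

Lemma ext_top_exists M N b : (forall j, (b < j)%N -> ext_zero j M N) ->
  (forall j, ext_zero j M N) \/ exists n, ext_top M N n.
Proof.
elim: b => [|b IH] H; last first.
  have [V|V] := pselect (ext_zero b.+1 M N); last by right; exists b.+1.
  apply: IH => j; rewrite leq_eqVlt => /orP[/eqP <- //|]; exact: H.
have [V|V] := pselect (ext_zero 0 M N); last by right; exists 0%N.
by left=> -[|j] //; apply: H.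
Qed.

Lemma dual_basis_zero Z : zero_module Z -> dual_basis Z.
Proof.
by move=> z0; exists 0%N, (fun=> 0), (fun=> \0) => v; rewrite big_ord0; apply: z0.
Qed.

(* The dual of a G-resolution is acyclic for Hom(-, R), and Hom of it into R is
   the resolution again by reflexivity, so the depth formula for complexes
   applies although the terms are not projective. *)
Lemma Gdim_formula M k d t : G_resolution M k -> fg M -> nonzero_module M ->
  dep (m := m) M d -> dep (m := m) R^o t ->
  exists g, ext_top M R^o g /\ (g + d)%N = t.
Proof.
move=> [G [dG [e [TR G0 se ex0 ex]]]] fM nM dM dR.
have dd i x : dG i (dG i.+1 x) = 0 by apply/ex; exists x.
pose X := nat_complex dd.
have ob (i : int) : zero_module (X i) \/ totally_reflexive (X i).
  case: i => [i|i]; last by left; apply: dsum0_zero.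
  have [ik|ki] := leqP i k; first by right; apply: TR.
  by left; apply/zero_moduleP; apply: G0.
have X_fg i : fg (X i) by case: (ob i) => [/fg_zero|[]].
have X_refl i : reflexive (X i).
  by case: (ob i) => [z0|[_ r _] //]; apply/dual_basis_reflexive/dual_basis_zero.
have X_ac : Hom_acyclic X R^o.
  move=> i n; case: (ob i) => [z0|[_ _ H]]; first exact: ext_zero_dom.
  by apply/Ext_zeroP; have [] := H n.+1 isT.
have D_ac : Hom_acyclic (dualc X) R^o.
  move=> i n; case: (ob (- i)) => [z0|[_ _ H]].
    by apply: ext_zero_dom => f; apply: homP => v; rewrite (z0 v) !linear0.
  by apply/Ext_zeroP; have [] := H n.+1 isT.
have X_hi i : k%:Z < i -> zero_module (X i).
  by case: i => [i|i] // ki; apply/zero_moduleP; apply: G0; lia.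
have X_lo i : i < 0 -> zero_module (X i) by apply: nat_complex_lo.
pose a (i : int) := if i == 0 then 1%N else 0%N.
have Hp i : 0 < i -> zero_module (homology_at i X).
  by case: i => [[|i]|i] // _; apply: nat_homologyS.
have X_H i : isomorphic (homology_at i X) (dsum M (a i)).
  rewrite /a; case: eqP => [->|i0].
    have [f bf] := nat_homology0 dd se ex0.
    have [c Hc] := dsum_const M 1.
    exists (c \o f); apply: bij_comp => //.
    exists (fun u : dsum M 1 => u ord0) => [x|u]; first by rewrite Hc ffunE.
    by apply/ffunP => o; rewrite Hc ffunE (ord1 o).
  have z0 : zero_module (homology_at i X).
    have [il|] := ltP i 0; first by apply: zero_homology; apply: X_lo.
    by move=> ?; apply: Hp; lia.
  by exists \0, (fun=> 0) => y; [rewrite [RHS]z0|rewrite [RHS]dsum0_zero].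
have a0 : a 0 <> 0%N by rewrite /a eqxx.
have a_top i : 0 < i -> a i = 0%N by rewrite /a; case: eqP => // ->.
(* A crude bound suffices to get a top degree: these Ext shift to Ext of the cokernel in degree k +
   1, which is zero. *)
have van j : (k.+1 < j)%N -> ext_zero j M R^o.
  move=> kj; have [C [c cc]] := coker_exists X (k.+1)%:Z.
  have c0 := nat_coker0 dd se ex0.
  have [|W _] := coker_ext_chain X_ac (k := k.+1) (j - k.+2) Hp _ cc c0; first by lia.
  have -> : j = (j - k.+2 + k.+1).+1 by lia.
  apply: W; apply: ext_zero_dom => y; have [x <-] := cc.1 y.
  by have -> : x = 0 by [apply: X_hi; lia]; rewrite linear0.
have [V|[g tg]] := ext_top_exists van.
  case: (covan_regular_not_all X_hi X_refl D_ac X_H a0 nM) => i.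
  exact: (corner_all_zero X_ac X_lo X_H V).
exists g; split=> //.
have [T1 T2] := corner_top X_ac X_lo X_H a0 a_top tg.
have := dual_depth_formula noethR R_local X_hi X_refl X_fg D_ac X_H a0 dM dR fM a_top T1 T2.
by lia.
Qed.

Lemma ext_zero_dual_basis n M Q : ext_zero n M R^o -> dual_basis Q -> ext_zero n M Q.
Proof.
move=> /ext_zeroP V [l [x [phi H]]]; apply/ext_zeroP => f.
have sm (y : Q) := scale_map y.
have [sc Hsc] := choice sm.
pose F i : hom (syz M n) Q := (sc (x i) \o (phi i \o f : {linear _ -> _}) : {linear _ -> _}).
suff -> : (f : hom _ _) = \sum_(i < l) F i.
  apply: (submod_sum (submod_ext_bd n M Q)) => i _.
  by apply: ext_bd_comp; apply: V.
apply: homP => v.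
have [//|ev Hev] := @make_linear R (hom (syz M n) Q) Q (fun f => (f : {linear _ -> _}) v).
rewrite -[RHS]Hev linear_sum {1}(H (f v)); apply: eq_bigr => i _.
by rewrite Hev /F /= Hsc.
Qed.

(** Lift [u] along R -> k. The lift takes a unit value, and rescaling the argument makes that value
    1. *)
Lemma residue_form Q (k : lmodType R) (u : {linear Q -> k}) : residue (m := m) k -> dual_basis Q ->
  surj u -> exists (phi : {linear Q -> R^o}) x,
    phi x = 1 /\ forall y, u y = 0 -> m (phi y).
Proof.
move=> [p [sp Hp]] [n [x [f H]]] su.
have [c Hc] := choice (fun i => sp (u (x i))).
have [phi Hphi] : exists phi : {linear Q -> R^o}, forall v, phi v = \sum_(i < n) f i v *: c i.
  apply: make_linear => a v w; rewrite scaler_sumr -big_split; apply: eq_bigr => i _ /=.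
  by rewrite linearP scalerDl -scalerA.
have pphi v : p (phi v) = u v.
  rewrite Hphi linear_sum {2}(H v) linear_sum; apply: eq_bigr => i _.
  by rewrite !linearZ /= Hc.
have [x0 Hx0] := su (p 1).
have [|b Hb] := @unit_notin _ _ noethR R_local (phi x0).
  move=> /Hp; rewrite pphi Hx0 => /Hp; exact: (m_proper R_local).
exists phi, (b *: x0); split; first by rewrite linearZ.
by move=> y uy; apply/Hp; rewrite pphi.
Qed.

(** * Comparing P(M, N) with P(M, R) for N quasi-resolved by projectives *)

Section ProjectiveTarget.
Context (P : complex R) (P_proj : forall i, projective_module (P i)).
Context (P_fg : forall i, fg (P i)).
Context (lo hi : int).
Context (P_lo : forall i, i < lo -> zero_module (P i)).
Context (P_hi : forall i, hi < i -> zero_module (P i)).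
Context (M N : lmodType R) (a : int -> nat).
Context (P_homology : forall i, isomorphic (homology_at i P) (dsum N (a i))).
Context (h : int) (a_h : a h <> 0%N) (a_low : forall i, i < h -> a i = 0%N).
Context (g : nat) (Mg : ext_top M R^o g).

Let ext_P i (j : nat) : (g < j)%N -> ext_zero j M (P i).
Proof.
move=> gj; apply: ext_zero_dual_basis; first exact: Mg.2.
exact: dual_basis_fg_projective.
Qed.

Let ext_H i (j : nat) : ext_zero j M N -> ext_zero j M (homology_at i P).
Proof.
move=> V; apply/(ext_isomorphic_cod j M noethR (P_homology i)).
exact: (ext_dsum_cod noethR).
Qed.

Lemma target_cycles_ext n : (g <= n)%N -> (forall j, (n < j)%N -> ext_zero j M N) ->
  forall i j Z (z : {linear Z -> P i}), is_cycles z -> (n < j)%N -> ext_zero j M Z.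
Proof.
move=> gn VN; apply: (@int_down _ hi) => [i ih|i IH] j Z z cz nj.
  by apply: ext_zero_cod; apply: cycles_zero cz; apply: P_hi.
have [Z' [z' cz']] := cycles_exists P (i + 1).
have [B [b [c [e [sb se _]]]]] := cycles_ses (erefl _) cz' cz.
apply: (ext_zero_second_mid noethR sb); last by apply: ext_H; apply: VN.
apply: (ext_zero_second_right noethR se).
  by apply: ext_P; apply: leq_ltn_trans nj.
by apply: IH cz' _; apply: ltnW.
Qed.

(** Below [h] the complex is exact and bounded, so it splits from the bottom. *)
Lemma bottom_cycles_projective i : i <= h ->
  forall Z (z : {linear Z -> P i}), is_cycles z -> projective_module Z.
Proof.
move: i; apply: (@int_up _ lo) => [i il _|i IH ih] Z z cz.
  by apply: projective_zero; apply: cycles_zero cz; apply: P_lo.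
have [Z' [z' cz']] := cycles_exists P (i - 1).
have [|B [b [c [e [sb se _]]]]] := cycles_ses (i := i - 1) (i' := i) _ cz cz'.
  by rewrite subrK.
have pZ' : projective_module Z' by apply: IH cz'; lia.
have z0 : zero_module (homology_at (i - 1) P).
  apply: (zero_module_iso (isomorphic_sym (P_homology (i - 1)))).
  by rewrite a_low; [exact: dsum0_zero|lia].
have [s [r [_ br _]]] := ses_split sb (projective_zero z0).
have [s' [r' [_ ir _]]] := ses_split se (projective_retract br pZ').
by apply: (projective_retract ir); apply: P_proj.
Qed.

(** For n > g, Ext^n(M, H_h) is squeezed between Ext^n(M, Z_h) = 0, where Z_h is projective, and
    Ext^(n+1) of the boundaries, which is zero as well. This contradicts a_h being nonzero. *)
Lemma target_top_le n : ext_top M N n -> (n <= g)%N.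
Proof.
move=> [nV VN]; rewrite leqNgt; apply/negP => gn; apply: nV.
apply: (@ext_dsum_cod_inv _ _ _ _ (a h)); first by rewrite lt0n; apply/eqP.
apply/(ext_isomorphic_cod n M noethR (P_homology h)).
have [Z [z cz]] := cycles_exists P h.
have [Z' [z' cz']] := cycles_exists P (h + 1).
have [B [b [c [e [sb se _]]]]] := cycles_ses (erefl _) cz' cz.
have pZ := bottom_cycles_projective (lexx h) cz.
apply: (ext_zero_second_right noethR sb).
  apply: ext_zero_dual_basis; first exact: Mg.2.
  by apply: dual_basis_fg_projective => //; apply: (fg_sub noethR cz.1).
apply: (ext_zero_second_right noethR se).
  by apply: ext_P; apply: ltnW.
by apply: (target_cycles_ext (ltnW gn) VN cz').
Qed.

(* Otherwise Ext^g(M, P_(h+1)) -> Ext^g(M, Z_h) is onto, [Z_h] being the cycles in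
   the lowest degree with homology. Composing with a split form [Z_h -> R] that
   maps boundaries into [m] gives Ext^g(M, R) = m Ext^g(M, R). *)
Lemma target_top_ge : fg M -> fg N -> nonzero_module N ->
  ~ forall j, (g <= j)%N -> ext_zero j M N.
Proof.
move=> fM fN nN VN; apply: (Mg.1); apply/ext_zeroP.
have [Z [z cz]] := cycles_exists P h.
have [Z' [z' cz']] := cycles_exists P (h + 1).
have [B [b [c [e [sb se _]]]]] := cycles_ses (erefl _) cz' cz.
have pZ := bottom_cycles_projective (lexx h) cz.
have dZ : dual_basis Z.
  by apply: dual_basis_fg_projective => //; apply: (fg_sub noethR cz.1).
have fH : fg (homology_at h P) by have [_ sc _] := sb; apply: fg_surj sc (fg_sub noethR cz.1 (P_fg h)).
have nH : nonzero_module (homology_at h P).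
  apply: contrapT => /zero_moduleP z0; apply: a_h.
  by apply: (dsum_zero nN); apply: zero_module_iso (P_homology h) z0.
have [k rk] := residue_exists R_local.
have [u su] := residue_quotient noethR R_local rk fH nH.
have suc : surj (u \o c).
  by move=> y; have [w <-] := su y; have [_ sc _] := sb; have [v <-] := sc w; exists v.
have [phi [x [phix phim]]] := residue_form rk dZ suc.
have VZ' : ext_zero g.+1 M Z'.
  by apply: (target_cycles_ext (leqnn g) _ cz') => // j gj; apply: VN; apply: ltnW.
have /ext_zeroP VH : ext_zero g M (homology_at h P) by apply: ext_H; apply: VN.
have [l [w [psi Hpsi]]] := dual_basis_fg_projective (P_fg (h + 1)) (@P_proj (h + 1)).
have [sx Hsx] := scale_map x.
apply: (nakayama noethR R_local (submod_ext_bd g M R^o)).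
  have := ext_small_fg noethR g fM (@fg_regular R).
  by rewrite ext_smallE => -[s [_ Hs]]; exists s.
move=> f; pose f' : {linear syz M g -> Z} := sx \o (f : {linear _ -> _}).
have [_ sc ec] := sb.
have [g0 [bg0 Hg0]] := ext_bd_lift sc (VH (c \o f')).
have [|f2 Hf2] := ses_factor sb (f := f' \- g0).
  by move=> v; rewrite /= linearB Hg0 subrr.
have [f3 Hf3] := ext_zero_lift noethR se VZ' f2.
pose psi3 (i : nat) : {linear syz M g -> R^o} := psi i \o f3.
pose phi0 : {linear syz M g -> R^o} := phi \o g0.
(* Modulo a coboundary, [x] times [f] takes values in boundaries. Expanding [f3] in the dual basis
   of P_(h+1) and applying [phi] gives coefficients in [m], and phi(x) = 1 recovers [f]. *)
exists l, (fun i => phi (b (e (w i)))), psi3, phi0.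
split.
- by move=> i _; apply: phim; rewrite /= (ses_comp _ sb) linear0.
- exact: ext_bd_comp.
- apply: homP => v.
  have [//|ev Hev] := @make_linear R (hom (syz M g) R^o) R^o (fun f => (f : {linear _ -> _}) v).
  rewrite -[RHS]Hev linearD linear_sum Hev /=.
  have -> : (f : {linear _ -> _}) v = phi (f' v).
    by rewrite /f' /= Hsx linearZ /= phix [_ *: 1]mulr1.
  have -> : f' v = b (e (f3 v)) + g0 v by rewrite Hf3 Hf2 /= subrK.
  rewrite linearD; congr (_ + _).
  rewrite {1}(Hpsi (f3 v)) !linear_sum; apply: eq_bigr => i _.
  by rewrite !linearZ Hev /= -[LHS]/(_ * _) mulrC.
Qed.

End ProjectiveTarget.

Lemma Gorenstein_case (P : complex R) (lo hi : int) (M N : lmodType R) (a : int -> nat) r d t :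
  (forall i, projective_module (P i)) -> (forall i, fg (P i)) ->
  (forall i, i < lo -> zero_module (P i)) -> (forall i, hi < i -> zero_module (P i)) ->
  (forall i, isomorphic (homology_at i P) (dsum N (a i))) ->
  (exists i, a i <> 0%N) -> fg M -> nonzero_module M -> fg N -> nonzero_module N ->
  dep (m := m) M d -> dep (m := m) R^o t -> G_resolution M r ->
  (forall j, ext_zero j M N) \/ (exists n, ext_top M N n) ->
  exists n, ext_top M N n /\ (n + d)%N = t.
Proof.
move=> pP fP Plo Phi HP exa fM nM fN nN dM dR GM ext.
have [g [tg e]] := Gdim_formula GM fM nM dM dR.
have [|//|h [ah low]] := @int_min (fun i => a i <> 0%N) lo.
  move=> i ai; rewrite leNgt; apply/negP => il; apply: ai.
  by apply: (dsum_zero nN); apply: zero_module_iso (HP i) _; apply: zero_homology; apply: Plo.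
have a_low i : i < h -> a i = 0%N by move=> /low/contrapT.
have ge := target_top_ge pP fP Plo Phi HP ah a_low tg fM fN nN.
case: ext => [V|[n tn]]; first by case: ge.
exists n; split=> //.
have le := target_top_le pP fP Plo Phi HP ah a_low tg tn.
suff : (g <= n)%N by lia.
rewrite leqNgt; apply/negP => ng; apply: ge => j gj.
by apply: tn.2; apply: leq_trans gj.
Qed.

End GorensteinCase.

(** * Extended integers and the theorem *)

Section ExtendedIntegers.
Implicit Types (S : set int) (n i : int).

Lemma supremum_eq (A : set (\bar int)) x : A !=set0 -> supremums A x ->
  supremum -oo%E A = x.
Proof.
move=> /set0P/negbTE A0 sx; rewrite /supremum A0.
case: xgetP => [y _ sy|/(_ x)/(_ sx)//].
exact: (is_subset1_supremums sy sx).
Qed.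

Lemma infimum_eq (A : set (\bar int)) x : A !=set0 -> infimums A x ->
  infimum +oo%E A = x.
Proof.
move=> /set0P/negbTE A0 sx; rewrite /infimum A0.
case: xgetP => [y _ sy|/(_ x)/(_ sx)//].
exact: (is_subset1_infimums sy sx).
Qed.

Lemma esupz_max S n : S n -> (forall i, S i -> i <= n) -> esupz S = n%:E.
Proof.
move=> Sn H; apply: supremum_eq; first by exists n%:E, n.
split=> [_ [i Si <-]|y uy]; first by rewrite lee_fin; apply: H.
by apply: uy; exists n.
Qed.

Lemma esupz_pinfty S : (forall n, exists i, S i /\ n < i) -> esupz S = +oo%E.
Proof.
move=> H; apply: supremum_eq; first by have [i [Si _]] := H 0; exists i%:E, i.
split=> [y _|y uy]; first exact: leey.
have ub i : S i -> (i%:E <= y)%E by move=> Si; apply: uy; exists i.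
case: y uy ub => [n||] // uy ub.
  by have [i [/ub]] := H n; rewrite lee_fin; lia.
by have [i [/ub]] := H 0.
Qed.

Lemma einfz_min S n : S n -> (forall i, S i -> n <= i) -> einfz S = n%:E.
Proof.
move=> Sn H; apply: infimum_eq; first by exists n%:E, n.
split=> [_ [i Si <-]|y uy]; first by rewrite lee_fin; apply: H.
by apply: uy; exists n.
Qed.

Lemma einfz_ninfty S : (forall n, exists i, S i /\ i < n) -> einfz S = -oo%E.
Proof.
move=> H; apply: infimum_eq; first by have [i [Si _]] := H 0; exists i%:E, i.
split=> [y _|y uy]; first exact: leNye.
have ub i : S i -> (y <= i%:E)%E by move=> Si; apply: uy; exists i.
case: y uy ub => [n||] // uy ub.
  by have [i [/ub]] := H n; rewrite lee_fin; lia.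
by have [i [/ub]] := H 0.
Qed.

Lemma esupz_cases S : S !=set0 ->
  (exists n, [/\ S n, forall i, S i -> i <= n & esupz S = n%:E]) \/ esupz S = +oo%E.
Proof.
move=> [i0 Si0]; have [[n Hn]|no] := pselect (exists n, forall i, S i -> i <= n).
  left; have [||k [Sk Hk]] := @int_min (fun i => S (- i)) (- n).
  - by move=> i /Hn; lia.
  - by exists (- i0); rewrite opprK.
  have mx i : S i -> i <= - k.
    move=> Si; rewrite leNgt; apply/negP => ki; apply: (Hk (- i)); first by lia.
    by rewrite opprK.
  by exists (- k); split=> //; apply: esupz_max.
right; apply: esupz_pinfty => n; apply: contrapT => no'; apply: no; exists n => i Si.
by rewrite leNgt; apply/negP => ni; apply: no'; exists i.
Qed.

Lemma einfz_cases S : S !=set0 ->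
  (exists n, [/\ S n, forall i, S i -> n <= i & einfz S = n%:E]) \/ einfz S = -oo%E.
Proof.
move=> [i0 Si0]; have [[n Hn]|no] := pselect (exists n, forall i, S i -> n <= i).
  left; have [//||k [Sk Hk]] := @int_min S n; first by exists i0.
  have mn i : S i -> k <= i.
    by move=> Si; rewrite leNgt; apply/negP => ik; apply: (Hk i).
  by exists k; split=> //; apply: einfz_min.
right; apply: einfz_ninfty => n; apply: contrapT => no'; apply: no; exists n => i Si.
by rewrite leNgt; apply/negP => ni; apply: no'; exists i.
Qed.

Lemma einfz_le S i : S i -> (einfz S <= i%:E)%E.
Proof.
move=> Si; have [|[n [_ H ->]]| ->] := @einfz_cases S; first by exists i.
  by rewrite lee_fin; apply: H.
exact: leNye.
Qed.

Lemma esupz_ge S i : S i -> (i%:E <= esupz S)%E.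
Proof.
move=> Si; have [|[n [_ H ->]]| ->] := @esupz_cases S; first by exists i.
  by rewrite lee_fin; apply: H.
exact: leey.
Qed.

Lemma einf_lt_pinfty (S : set (\bar int)) : (einf S < +oo)%E -> exists x, S x.
Proof.
move=> lt; apply: contrapT => no; move: lt.
suff -> : S = set0 by rewrite /einf /infimum eqxx ltxx.
by apply/seteqP; split=> // x Sx; apply: no; exists x.
Qed.

End ExtendedIntegers.

Section Translation.
Context {R : comNzRingType} {m : set R}.
Context (noethR : noetherian R) (R_local : local_ring m).
Implicit Types (L M N : lmodType R) (P : complex R).

Lemma bounded_range P : bounded P -> exists lo hi : int,
  (forall i : int, i < lo -> zero_module (P i)) /\ (forall i : int, hi < i -> zero_module (P i)).
Proof.
rewrite /bounded /csup /cinf; set S := [set i | _] => lt.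
have out i : ~ S i -> zero_module (P i) by move=> /zero_moduleP.
have [[i0 Si0]|none] := pselect (S !=set0); last first.
  (* The zero complex, where any range will do. *)
  by exists 0, 0; split=> i _; apply: out => Si; apply: none; exists i.
have ne : S !=set0 by exists i0.
have [[hi [_ Hhi eh]]|eh] := esupz_cases ne; last first.
  by move: lt; rewrite eh; have [[n [_ _ ->]]| ->] := einfz_cases ne.
have [[lo [_ Hlo el]]|el] := einfz_cases ne; last by move: lt; rewrite eh el.
exists lo, hi; split=> i Hi; apply: out; first by move=> /Hlo; lia.
by move=> /Hhi; lia.
Qed.

Lemma qpd_finite M : nonzero_module M -> (qpd M < +oo)%E ->
  exists P (lo hi : int) (a : int -> nat),
    [/\ forall i, projective_module (P i), forall i, fg (P i),
        forall i : int, i < lo -> zero_module (P i), forall i : int, hi < i -> zero_module (P i) &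
        (forall i, isomorphic (homology_at i P) (dsum M (a i))) /\ exists i, a i <> 0%N].
Proof.
move=> nM; rewrite /qpd asboolT // => /einf_lt_pinfty[_ [P [bP [_ fpP [a [Ha [i0 [i0c ai0]]]]] _]]].
have [lo [hi [Hlo Hhi]]] := bounded_range bP.
(* Exponents are only prescribed from the infimum of P upwards; below it P vanishes, and exponent 0
   is correct. *)
exists P, lo, hi, (fun i => if (cinf P <= i%:E)%E then a i else 0%N); split=> //.
- by move=> i; have [] := fpP i.
- by move=> i; have [] := fpP i.
split; last by exists i0; rewrite i0c; apply/eqP.
move=> i; case: ifPn => [ic|nic]; first exact: Ha.
have z0 : zero_module (homology_at i P).
  apply: zero_homology; apply/zero_moduleP => ni.
  by move/negP: nic; apply; apply: einfz_le.
by exists \0, (fun=> 0) => y; [rewrite [RHS]z0|rewrite [RHS]dsum0_zero].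
Qed.

Lemma qid_finite N : nonzero_module N -> (qid N < +oo)%E ->
  exists (I : complex R) (lo hi : int) (b : int -> nat),
    [/\ forall i, injective_module (I i),
        forall i : int, i < lo -> zero_module (I i), forall i : int, hi < i -> zero_module (I i),
        forall i, isomorphic (homology_at i I) (dsum N (b i)) & exists i, b i <> 0%N].
Proof.
move=> nM; rewrite /qid asboolT // => /einf_lt_pinfty[_ [P [bP [_ iP [a [Ha [i0 [i0c ai0]]]]] _]]].
have [lo [hi [Hlo Hhi]]] := bounded_range bP.
exists P, lo, hi, (fun i => if (i%:E <= csup P)%E then a i else 0%N); split=> //.
  move=> i; case: ifPn => [ic|nic]; first exact: Ha.
  have z0 : zero_module (homology_at i P).
    apply: zero_homology; apply/zero_moduleP => ni.
    by move/negP: nic; apply; apply: esupz_ge.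
  by exists \0, (fun=> 0) => y; [rewrite [RHS]z0|rewrite [RHS]dsum0_zero].
by exists i0; rewrite i0c; apply/eqP.
Qed.

Lemma Gdim_finite M : (Gdim M < +oo)%E -> exists k, G_resolution M k.
Proof.
by move=> /einf_lt_pinfty[_ [_ [k Gk _] _]]; exists k.
Qed.

Lemma depth_dep L n : fg L -> dep (m := m) L n -> depth m L = (n%:Z)%:E.
Proof.
move=> fL dL; apply: esupz_max.
  have [xs [mxs rxs <-]] := dep_regular_seq dL.
  by exists xs.
move=> _ [xs [mxs rxs ->]].
by rewrite lez_nat; apply: (regular_seq_dep noethR R_local fL dL mxs rxs).
Qed.

Lemma ext_sup_top M N n : ext_top M N n -> ext_sup M N = (n%:Z)%:E.
Proof.
move=> [nV V]; apply: esupz_max.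
  by exists n => //=; apply: contrapT => /Ext_zeroP.
move=> _ [j nj <-]; rewrite lez_nat leqNgt; apply/negP => /V.
by move=> /Ext_zeroP; apply.
Qed.

(** The first alternative is the value -oo, which a bound from above cannot exclude. *)
Lemma ext_sup_finite M N : (ext_sup M N < +oo)%E ->
  (forall j, ext_zero j M N) \/ (exists n, ext_top M N n).
Proof.
rewrite /ext_sup; set S := [set _ | _ in _] => lt.
have [b Hb] : exists b : nat, forall j, (b < j)%N -> ext_zero j M N.
  apply: contrapT => no; move: lt; rewrite esupz_pinfty ?ltxx // => n.
  apply: contrapT => no'; apply: no; exists (absz n) => j nj.
  apply/Ext_zeroP => nE; apply: no'; exists j%:Z; split; first by exists j.
  by lia.
exact: ext_top_exists Hb.
Qed.

End Translation.

Local Open Scope ereal_scope.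

Theorem theorem1p1 (R : comNzRingType) (m : set R)
    (R_noetherian : noetherian R) (R_local : local_ring m)
    (M N : lmodType R)
    (M_nonzero : nonzero_module M) (M_fg : fg M)
    (N_nonzero : nonzero_module N) (N_fg : fg N)
    (Ext_bounded : ext_sup M N < +oo) :
  [\/ qpd M < +oo,
      Gdim M < +oo /\ qpd N < +oo
    | qid N < +oo] ->
  ext_sup M N = depth m R^o - depth m M.
Proof.
move=> cases.
have ext := ext_sup_finite Ext_bounded.
have R_nonzero : nonzero_module (R^o : lmodType R) by exists 1%R; apply: oner_neq0.
have [d dM] := dep_exists R_noetherian R_local M_fg M_nonzero.
have [t dR] := dep_exists R_noetherian R_local (@fg_regular R) R_nonzero.
have [n [tn e]] : exists n, ext_top M N n /\ (n + d)%N = t.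
  case: cases => [qM|[GM qN]|qN].
  - have [P [lo [hi [a [pP fP Plo Phi [Ha exa]]]]]] := qpd_finite M_nonzero qM.
    exact: (projective_case R_noetherian R_local pP fP Phi Plo Ha).
  - have [P [lo [hi [a [pP fP Plo Phi [Ha exa]]]]]] := qpd_finite N_nonzero qN.
    have [k Gk] := Gdim_finite GM.
    exact: (Gorenstein_case R_noetherian R_local pP fP Plo Phi Ha exa M_fg
      M_nonzero N_fg N_nonzero dM dR Gk).
  - have [I [lo [hi [b [iI Ilo Ihi Hb exb]]]]] := qid_finite N_nonzero qN.
    exact: (injective_case R_noetherian R_local iI Ilo Ihi Hb).
rewrite (ext_sup_top tn) (depth_dep R_noetherian R_local (@fg_regular R) dR).
rewrite (depth_dep R_noetherian R_local M_fg dM) -EFinB; congr EFin.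
by rewrite -e; lia.
Qed.
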